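(* Let $\psi$ be the characteristic exponent of a one-dimensional Lévy process without Gaussian component, and assume $$\frac{1}{\mathrm{Re}\,\psi(\xi)}=o(|\xi|^{-1})\quad\text{as }|\xi|\to\infty.$$ Let $a:[0,\infty)\times\mathbb R\to\mathbb R$ be measurable with $|a(t,x)|\le K$ for all $t,x$, for some constant $K>0$. Then for every $x_0\in\mathbb R$ there exists a (weak) solution of $$dX_t=dS_t+a(t,X_t)\,dt,\quad t\ge0,\quad X_0=x_0.$$
   Context: A process $(S,\mathbb F)$ with $S_0=0$ on a filtered complete probability space is a Lévy process with characteristic exponent $\psi$ if its paths are càdlàg and $\mathbf E(e^{i\xi(S_t-S_s)}\mid\mathcal F_s)=e^{-(t-s)\psi(\xi)}$ for all $t>s\ge0$, $\xi\in\mathbb R$, with $\psi$ continuous; $\psi(\xi)=ic\xi+\tfrac12Q\xi^2+\int(1-e^{i\xi z}+i\xi z\mathbf 1_{\{|z|<1\}})\nu(dz)$, and ''no Gaussian component'' means $Q=0$. A (weak) solution with initial value $x_0$ is a càdlàg process $(X,\mathbb F)$ on some filtered probability space $(\Omega,\mathcal F,\mathbf P)$ together with a Lévy process $(S,\mathbb F)$ with characteristic exponent $\psi$ such that $X_t=x_0+S_t+\int_0^ta(s,X_s)\,ds$ for all $t\ge0$, $\mathbf P$-a.s. *)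

(* Defs.v *)
From HB Require Import structures.
From mathcomp Require Import all_boot all_order all_algebra.
From mathcomp Require Import all_classical all_reals all_analysis.
Set Implicit Arguments. Unset Strict Implicit. Unset Printing Implicit Defensive.
Import Order.TTheory GRing.Theory Num.Theory.
Import numFieldNormedType.Exports.
Local Open Scope classical_set_scope.
Local Open Scope ring_scope.

Section Defs.
Variable R : realType.

Definition levy_measure (nu : {measure set R -> \bar R}) : Prop :=
  nu [set 0] = 0%E /\
  (\int[nu]_(z in setT) ((Num.min 1 (z ^+ 2))%:E) < +oo)%E.

(* Characteristic exponent with no Gaussian component (Q = 0):
   psi(xi) = i c xi + int (1 - e^{i xi z} + i xi z 1_{|z|<1}) nu(dz),
   split into real and imaginary parts. *)
Definition psi_re (nu : {measure set R -> \bar R}) (xi : R) : R :=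
  Rintegral nu setT (fun z => 1 - cos (xi * z)).

Definition psi_im (c : R) (nu : {measure set R -> \bar R}) (xi : R) : R :=
  c * xi + Rintegral nu setT
    (fun z : R => - sin (xi * z) + xi * z * (`|z| < 1 :> R)%:R).

Definition cadlag (f : R -> R) : Prop :=
  (forall t, 0 <= t -> f @ t^'+ --> f t) /\
  (forall t, 0 < t -> exists l : R, f @ t^'- --> l).

Section Prob.
Context {d : measure_display} {T : measurableType d}.

Definition complete_prob (P : probability T R) : Prop :=
  forall N, measurable N -> P N = 0%E ->
    forall A, A `<=` N -> measurable A.

Definition filtration (F : R -> set (set T)) : Prop :=
  (forall t, 0 <= t -> sigma_algebra setT (F t)) /\
  (forall t, 0 <= t -> F t `<=` measurable) /\
  (forall s t, 0 <= s -> s <= t -> F s `<=` F t).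

Definition adapted (F : R -> set (set T)) (X : R -> T -> R) : Prop :=
  forall t, 0 <= t -> forall B : set R, measurable B -> F t (X t @^-1` B).

(* (S, F) is a Levy process with characteristic exponent psi = psi_re + i psi_im:
   S_0 = 0, cadlag paths, adapted, and
   E(e^{i xi (S_t - S_s)} | F_s) = e^{-(t-s) psi(xi)}, written through its
   defining property E[1_A e^{i xi (S_t-S_s)}] = P(A) e^{-(t-s)psi(xi)} for
   all A in F_s (real and imaginary parts). *)
Definition levy_process (P : probability T R) (F : R -> set (set T))
    (S : R -> T -> R) (pre pim : R -> R) : Prop :=
  (forall w, S 0 w = 0) /\
  (forall w, cadlag (fun t => S t w)) /\
  adapted F S /\
  (forall s t xi, 0 <= s -> s < t -> forall A, F s A ->
     Rintegral P A (fun w => cos (xi * (S t w - S s w))) =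
       fine (P A) * (expR (- (t - s) * pre xi) * cos ((t - s) * pim xi)) /\
     Rintegral P A (fun w => sin (xi * (S t w - S s w))) =
       - (fine (P A) * (expR (- (t - s) * pre xi) * sin ((t - s) * pim xi)))).

End Prob.
End Defs.

(* Main.v *)
(* The drift coefficient is averaged over small space-time cells and the Levy
   process is replaced by a random walk on a lattice: finitely many jumps with
   rates approximating nu, and a small nearest-neighbour noise, of vanishing
   variance, which carries the drift.  This gives Markov chains with values in
   x0 + h Z.  The Loeb measure along a nonprincipal ultrafilter turns their
   expectations into a complete probability space, on which ultralimits of
   functionals of the chains are random variables.

   Increments over consecutive dyadic intervals are rarely both large, so
   Chentsov's chaining argument yields a cadlag version X of the ultralimit of
   the chains.  The Fourier transform of the law of the chain satisfies a linear
   recursion, damped by Re psi and forced by the bounded drift; as Re psi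
   dominates |xi|, Plancherel bounds the L^2 norm of the (time-weighted)
   occupation density, uniformly along the sequence, whence a Krylov estimate:
   sets of small Lebesgue measure are rarely visited.  It allows a monotone class
   argument, starting from Lipschitz functions, to identify the ultralimit of the
   accumulated drifts with the integral of a(s, X_s).  The remaining part
   X - x0 - int a(s, X_s) ds is a version of the ultralimit of the accumulated
   noises, and the characteristic function of its increments, conditionally on
   the past, passes to the limit. *)

(* The obstacle is that [a] is merely measurable, so that [a(s, X_s)] depends continuously on the
   path in no useful sense; the accumulated drifts converge only because the occupation measures
   have controlled densities. In Fourier space the drift forces the energy with a strength K |xi|
   relative to the damping Re psi(xi). The condition on psi makes this ratio small at high
   frequencies, and the constant 4 K is chosen so that the forcing gives back at most half of the
   energy, which is then absorbed. Low frequencies need no damping, since characteristic functions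
   are bounded by 1. Finitely many lattice jumps have a bounded symbol, so they cannot reproduce the
   growth of Re psi at all frequencies; the nearest-neighbour noise takes over where they fail, and
   its variance vanishes along the sequence, so that no Gaussian part survives. The jumps need not
   have moments: sizes of increments are measured by the bounded function y^2 / (1 + y^2). *)
Require Import Defs.
From HB Require Import structures.
From mathcomp Require Import all_boot all_order all_algebra.
From mathcomp Require Import all_classical all_reals all_analysis.
From mathcomp Require Import measurable_realfun ring lra zify.
Import Order.TTheory GRing.Theory Num.Theory.
Import numFieldNormedType.Exports.
Local Open Scope classical_set_scope.
Local Open Scope ring_scope.

Set Implicit Arguments.
Unset Strict Implicit.
Unset Printing Implicit Defensive.

(** * Means, ultralimits and the Loeb measure *)

Section Mean.
Context {R : realType} {W : Type}.

(** Expectations are positive normalised linear functionals on all functions, so the path space of a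
    chain needs no sigma-algebra. *)
Record is_mean (E : (W -> R) -> R) : Prop := IsMean {
  mean_lin : forall a b f g,
    E (fun w => a * f w + b * g w) = a * E f + b * E g;
  mean_ge0 : forall f, (forall w, 0 <= f w) -> 0 <= E f;
  mean1 : E (fun=> 1) = 1 }.

Variables (E : (W -> R) -> R) (HE : is_mean E).

Lemma mean_cst r : E (fun=> r) = r.
Proof.
have := mean_lin HE r 0 (fun=> 1) (fun=> 1).
by rewrite (mean1 HE) mulr1 mul0r addr0.
Qed.

Lemma meanD f g : E (fun w => f w + g w) = E f + E g.
Proof.
have := mean_lin HE 1 1 f g; rewrite !mul1r => <-.
by under [in RHS]eq_fun do rewrite !mul1r.
Qed.

Lemma meanZ r f : E (fun w => r * f w) = r * E f.
Proof.
have := mean_lin HE r 0 f f; rewrite mul0r addr0 => <-.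
by under [in RHS]eq_fun do rewrite mul0r addr0.
Qed.

Lemma meanB f g : E (fun w => f w - g w) = E f - E g.
Proof.
have := mean_lin HE 1 (-1) f g; rewrite mul1r mulN1r => <-.
by under [in RHS]eq_fun do rewrite mul1r mulN1r.
Qed.

Lemma meanN f : E (fun w => - f w) = - E f.
Proof. by have := meanZ (-1) f; rewrite mulN1r => <-; under [in RHS]eq_fun do rewrite mulN1r. Qed.

Lemma le_mean f g : (forall w, f w <= g w) -> E f <= E g.
Proof.
move=> fg; rewrite -subr_ge0 -meanB; apply: mean_ge0 => // w.
by rewrite subr_ge0.
Qed.

Lemma mean_norm f : `|E f| <= E (fun w => `|f w|).
Proof.
rewrite ler_norml; apply/andP; split.
  by rewrite -meanN; apply: le_mean => w; rewrite lerNl -normrN ler_norm.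
by apply: le_mean => w; exact: ler_norm.
Qed.

Lemma mean_sum I (s : seq I) (Q : pred I) (f : I -> W -> R) :
  E (fun w => \sum_(i <- s | Q i) f i w) = \sum_(i <- s | Q i) E (f i).
Proof.
elim: s => [|i s IH].
  under eq_fun do rewrite big_nil; rewrite big_nil.
  by rewrite mean_cst.
rewrite big_cons -IH; case: ifP => Qi.
  by rewrite -meanD; congr E; apply/funext => w; rewrite big_cons Qi.
by congr E; apply/funext => w; rewrite big_cons Qi.
Qed.

End Mean.

Section Ulim.
Context {R : realType} (U : set_system nat) {UU : UltraFilter U}.
Hypothesis Uoo : \oo `<=` U.

Definition ulim (u : nat -> R) : R := lim (u @ U).

(** The image of [U] is an ultrafilter carried by a compact segment, hence it converges. *)
Lemma ulim_cvg u (B : R) : (\forall n \near U, `|u n| <= B) -> u @ U --> ulim u.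
Proof.
move=> uB.
have cB := @segment_compact R (- B) B; rewrite compact_ultra in cB.
have UUu : UltraFilter (u @ U).
  split; first exact: fmap_proper_filter.
  move=> G GF sG; apply/funext => A; apply/propext; split=> [GA|]; last exact: sG.
  have [//|UA] := in_ultra_setVsetC (u @^-1` A) UU.
  have /sG GnA : (u @ U) (~` A) by [].
  by have /filter_ex[? []] : G (A `&` ~` A) by exact: filterI.
have /(cB _ UUu)[l [_ ul]] : (u @ U) `[- B, B]%classic.
  by apply: (filterS _ uB) => n /=; rewrite in_itv/= -ler_norml.
by apply/cvg_ex; exists l.
Qed.

Lemma ulimP u (l : R) : u @ U --> l -> ulim u = l.
Proof. exact: cvg_lim. Qed.

Lemma ulim_cvg_oo u (l : R) : u @ \oo --> l -> ulim u = l.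
Proof.
by move=> ul; apply: ulimP; apply: cvg_trans ul; apply: cvg_app => A; exact: Uoo.
Qed.

Lemma ulim_eq u v : (\forall n \near U, u n = v n) -> ulim u = ulim v.
Proof.
move=> uv; rewrite /ulim; congr (lim _); apply/funext => A; apply/propext.
have uvU : U [set n | u n = v n] by exact: uv.
split => UA.
  have UA' : U (u @^-1` A) by exact: UA.
  suff : U (v @^-1` A) by [].
  by apply: filterS2 uvU UA' => n /= ->.
have UA' : U (v @^-1` A) by exact: UA.
suff : U (u @^-1` A) by [].
by apply: filterS2 uvU UA' => n /= ->.
Qed.

Lemma ulim_le u v (B : R) : (\forall n \near U, `|u n| <= B) ->
  (\forall n \near U, `|v n| <= B) ->
  (\forall n \near U, u n <= v n) -> ulim u <= ulim v.
Proof.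
move=> uB vB uv; apply: (ler_cvg_to (ulim_cvg uB) (ulim_cvg vB)).
exact: uv.
Qed.

Lemma ulim_cst r : ulim (fun=> r) = r.
Proof. by apply: ulimP; exact: cvg_cst. Qed.

End Ulim.

Section CaratheodoryProbability.
Context {R : realType} {T : pointedType}.
Variables (mu : {outer_measure set T -> \bar R}) (mu1 : mu setT = 1%E).

(** The proof of mass one is an argument so that the probability instance can be attached to a term
    that contains it. *)
Definition caratheodory_probability (_ : mu setT = 1%E) :
  set (caratheodory_type mu) -> \bar R := mu.

HB.instance Definition _ := Measure.on (caratheodory_probability mu1).
HB.instance Definition _ := Measure_isProbability.Build _ _ _
  (caratheodory_probability mu1) mu1.

End CaratheodoryProbability.

Section Loeb.
Context {R : realType} (U : set_system nat) {UU : UltraFilter U}.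
Hypothesis Uoo : \oo `<=` U.
Context {W : pointedType} (E : nat -> (W -> R) -> R).
Hypothesis HE : forall n, is_mean (E n).

Let p n (A : set W) : R := E n (\1_A).

Let p_ge0 n A : 0 <= p n A.
Proof. by apply: mean_ge0 => // w; rewrite indicE. Qed.

Let p_le n A B : A `<=` B -> p n A <= p n B.
Proof.
move=> AB; apply: (le_mean (HE n)) => w; rewrite !indicE ler_nat.
by case: (boolP (w \in A)) => //; rewrite inE => Aw; rewrite mem_set//; exact: AB.
Qed.

Let p_le1 n A : p n A <= 1.
Proof.
rewrite -(mean1 (HE n)); apply: le_mean => // w; rewrite indicE; case: (_ \in _).
Qed.

Let pU n A B : p n (A `|` B) <= p n A + p n B.
Proof.
rewrite /p -(meanD (HE n)); apply: (le_mean (HE n)) => w.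
rewrite !indicE in_setU; case: (w \in A); case: (w \in B) => //=; lra.
Qed.

Let pbd (A : nat -> set W) : \forall n \near U, `|p n (A n)| <= 1.
Proof. by near=> n; rewrite ger0_norm. Unshelve. all: by end_near. Qed.

(** The ultraproduct of the sets [A n], read on sequences of points instead of their classes modulo
    [U]. *)
Definition internal (A : nat -> set W) : set (nat -> W) :=
  [set t | \forall n \near U, A n (t n)].

(** A single internal cover replaces the usual countable covers; that the result is still countably
    subadditive is the saturation property of ultraproducts. *)
Definition loeb_fun (X : set (nat -> W)) : \bar R :=
  ereal_inf [set (ulim U (fun n => p n (A n)))%:E | A in [set A | X `<=` internal A]].

Let ulim_ge0 A : 0 <= ulim U (fun n => p n (A n)).
Proof.
rewrite -[leLHS](ulim_cst (U := U)); apply: (@ulim_le _ U _ _ _ 1).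
- by near=> n; rewrite normr0.
- exact: pbd.
- by near=> n.
Unshelve. all: by end_near. Qed.

Let loeb_ge0 X : (0 <= loeb_fun X)%E.
Proof. by apply: le_ereal_inf_tmp => _ [A _ <-]; rewrite lee_fin. Qed.

Let loeb_le X Y : X `<=` Y -> (loeb_fun X <= loeb_fun Y)%E.
Proof.
move=> XY; apply: le_ereal_inf_tmp => _ [A /= YA <-]; apply: ereal_inf_lbound.
by exists A => //=; exact: subset_trans YA.
Qed.

Let loeb_lt X A : X `<=` internal A -> (loeb_fun X <= (ulim U (fun n => p n (A n)))%:E)%E.
Proof. by move=> XA; apply: ereal_inf_lbound; exists A. Qed.

Let loeb_le1 X : (loeb_fun X <= 1)%E.
Proof.
apply: (le_trans (@loeb_lt X (fun=> setT) _)).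
  by move=> t _; rewrite /internal/=; near=> n.
rewrite lee_fin -[leRHS](ulim_cst (U := U)); apply: (@ulim_le _ U _ _ _ 1).
- exact: pbd.
- by near=> n; rewrite normr1.
- by near=> n.
Unshelve. all: by end_near. Qed.

Let loeb_fin X : loeb_fun X \is a fin_num.
Proof.
by rewrite ge0_fin_numE// (le_lt_trans (loeb_le1 X))// ltry.
Qed.

Lemma loeb_internal A : loeb_fun (internal A) = (ulim U (fun n => p n (A n)))%:E.
Proof.
apply/eqP; rewrite eq_le loeb_lt//=; apply: le_ereal_inf_tmp => _ [B /= AB <-].
rewrite lee_fin; apply: (@ulim_le _ U _ _ _ 1); [exact: pbd|exact: pbd|].
suff : \forall n \near U, A n `<=` B n by apply: filterS => n; exact: p_le.
(* otherwise a sequence of points of [A n `\` B n] separates the internal sets *)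
apply: contrapT => nAB.
have [//|NU] := in_ultra_setVsetC [set n | A n `<=` B n] UU.
have /choice[t ht] : forall n, exists w, ~ A n `<=` B n -> A n w /\ ~ B n w.
  move=> n; have [AB'|] := pselect (A n `<=` B n); first by exists point.
  move=> h; move: (h) => /existsNP[w /not_implyP wP]; by exists w.
have /AB At : internal A t.
  by apply: (filterS _ NU) => n /= /ht[].
have : U set0.
  by apply: filterS2 NU At => n /= /ht[].
exact: filter_not_empty.
Qed.

Let loeb0 : loeb_fun set0 = 0%E.
Proof.
apply/eqP; rewrite eq_le loeb_ge0 andbT.
apply: (le_trans (@loeb_lt set0 (fun=> set0) _)) => //.
rewrite lee_fin [leLHS](_ : _ = 0)//.
rewrite -[RHS](ulim_cst (U := U)); apply: ulim_eq; near=> n.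
rewrite /p -(mean_cst (HE n) 0); congr (E n _); apply/funext => w.
by rewrite indicE in_set0.
Unshelve. all: by end_near. Qed.

Let sum_pow_le (e : R) k : 0 < e -> \sum_(i < k) e / 2 ^+ i.+1 <= e.
Proof.
move=> e0; suff -> : \sum_(i < k) e / 2 ^+ i.+1 = e - e / 2 ^+ k.
  by rewrite gerBl divr_ge0// ltW.
elim: k => [|k IH]; first by rewrite big_ord0 expr0 divr1 subrr.
rewrite big_ord_recr/= IH exprS invfM; field.
by rewrite expf_neq0.
Qed.

(** Saturation by a diagonal choice: level [n] keeps the covers [A i n] as long as the union of the
    first ones has mass at most [S] there. Each cover is kept at [U]-almost every level, so one
    internal set contains all the [F i]. *)
Let loeb_sub : sigma_subadditive loeb_fun.
Proof.
move=> F; have [->|ninf] := eqVneq (\sum_(i <oo) loeb_fun (F i))%E +oo%E.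
  by rewrite leey.
have s0 : (0 <= \sum_(i <oo) loeb_fun (F i))%E by apply: nneseries_ge0 => i _ _.
have sfin : (\sum_(i <oo) loeb_fun (F i))%E \is a fin_num.
  by rewrite ge0_fin_numE// ltey.
rewrite -(fineK sfin); set s := fine _.
apply/lee_addgt0Pr => e' e'0; set e : R := e' / 2.
have e0 : 0 < e by rewrite divr_gt0.
have /choice[A hA] : forall i, exists A, F i `<=` internal A /\
   ulim U (fun n => p n (A n)) <= fine (loeb_fun (F i)) + e / 2 ^+ i.+1.
  move=> i; have e2 : (0 < e / 2 ^+ i.+1) by rewrite divr_gt0// exprn_gt0.
  have [_ [A /= FA <-] Alt] := lb_ereal_inf_adherent e2 (loeb_fin (F i)).
  exists A; split => //; rewrite -lee_fin EFinD fineK//.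
  exact: ltW.
pose V k n : set W := [set w | exists2 i, (i < k)%N & A i n w].
pose S := s + e'.
have partial k : \sum_(i < k) ulim U (fun n => p n (A i n)) <= s + e.
  apply: (le_trans (ler_sum _ (fun (i : 'I_k) _ => (hA i).2))).
  rewrite big_split/= lerD ?sum_pow_le// -lee_fin -sumEFin fineK//.
  under eq_bigr do rewrite fineK//.
  have := @nneseries_lim_ge R (fun i => loeb_fun (F i)) xpredT 0 k.
  by rewrite big_mkord; apply => i _ _.
have Vle k n : p n (V k n) <= \sum_(i < k) p n (A i n).
  elim: k => [|k IH].
    rewrite big_ord0 -(mean_cst (HE n) 0); apply: (le_mean (HE n)) => w.
    rewrite indicE; case: (boolP (w \in V 0%N n)) => //.
    by rewrite inE => -[].
  rewrite big_ord_recr/=; apply: le_trans (lerD IH (lexx _)).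
  apply: le_trans (pU _ _ _); apply: p_le => w [i].
  by rewrite ltnS leq_eqVlt => /predU1P[->|ik] Aw; [right|left; exists i].
(* The clause [k <= n] leaves finitely many admissible [k] at level [n]; the union [V] for the
   largest one contains [B n]. *)
pose G k : set nat := [set n | (k <= n)%N /\ p n (V k n) <= S].
have UG k : U (G k).
  have cS : (fun n => \sum_(i < k) p n (A i n)) @ U -->
      \sum_(i < k) ulim U (fun n => p n (A i n)).
      by apply: cvg_big => [|i _]; [exact: add_continuous|
      exact: (ulim_cvg (pbd (A i)))].
  have /cvgrPdist_lt/(_ e e0) h := cS.
  have kn : U [set n | (k <= n)%N] by apply: Uoo; exact: nbhs_infty_ge.
  apply: filterS2 kn h => n kn; rewrite ltr_norml => /andP[h _].
  split => //; apply: (le_trans (Vle k n)).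
  have := partial k; rewrite /S; move: h; rewrite /e; lra.
pose B n : set W := [set w | exists2 i, G i.+1 n & A i n w].
have Ble n : p n (B n) <= S.
  have [[i0 Gi0]|nG] := pselect (exists i, G i.+1 n); last first.
    suff -> : B n = V 0%N n.
      apply: (le_trans (Vle 0%N n)); rewrite big_ord0 /S addr_ge0//; last exact: ltW.
      by rewrite /s fine_ge0.
    by apply/seteqP; split => w [i h]; [exfalso; apply: nG; exists i|].
  have ex0 : exists i, `[< G i.+1 n >] by exists i0; apply/asboolP.
  have bd i : `[< G i.+1 n >] -> (i <= n)%N by move/asboolP => -[/ltnW].
  case: (ex_maxnP ex0 bd) => m /asboolP[mn GV] mmax.
  apply: le_trans GV; apply: p_le => w [i Gi Aw]; exists i => //.
  by rewrite ltnS; apply: mmax; apply/asboolP.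
have FB : \bigcup_i F i `<=` internal B.
  move=> t [i _ /(hA i).1]; rewrite /internal/= => At.
  by apply: filterS2 At (UG i.+1) => n /= Aw Gn; exists i.
apply: (le_trans (loeb_lt FB)); rewrite -EFinD lee_fin.
rewrite -[leRHS](ulim_cst (U := U)); apply: (@ulim_le _ U _ _ _ (1 + `|S|)).
- near=> n; apply: (@le_trans _ _ 1); last by rewrite lerDl.
  by rewrite ger0_norm; [exact: p_le1|exact: p_ge0].
- by near=> n; rewrite lerDr.
- by near=> n; exact: Ble.
Unshelve. all: by end_near. Qed.

Let loeb_outer : {outer_measure set (nat -> W) -> \bar R} :=
  HB.pack loeb_fun (isOuterMeasure.Build R (nat -> W) loeb_fun loeb0 loeb_ge0
    loeb_le loeb_sub).

Let LT := caratheodory_type loeb_outer.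

(** Caratheodory's criterion: an internal cover is cut by [A] level by level, and [ulim] is
    additive. *)
Let internal_measurable (A : nat -> set W) : measurable (internal A : set LT).
Proof.
apply: le_caratheodory_measurable => X /=; apply: le_ereal_inf_tmp => _ [B /= XB <-].
have -> : ulim U (fun n => p n (B n)) = ulim U (fun n => p n (B n `&` A n)) +
    ulim U (fun n => p n (B n `&` ~` A n)).
  apply: ulimP; rewrite (_ : (fun n => _) = fun n => p n (B n `&` A n) +
     p n (B n `&` ~` A n)).
    by apply: cvgD; apply: ulim_cvg; exact: pbd.
  apply/funext => n; rewrite /p -(meanD (HE n)); congr (E n _); apply/funext => w.
  rewrite !indicE !in_setI in_setC.
  by case: (w \in B n); case: (w \in A n) => //=; lra.
rewrite EFinD; apply: leeD; apply: loeb_lt => t [/XB Bt].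
  by move=> At; rewrite /internal/=; near=> n; split; near: n.
move=> nAt; have [//|NU] := in_ultra_setVsetC [set n | A n (t n)] UU.
by rewrite /internal/=; near=> n; split; near: n.
Unshelve. all: by end_near. Qed.

Let loebT : loeb_outer setT = 1%E.
Proof.
have -> : [set: nat -> W] = internal (fun=> setT).
  by apply/seteqP; split => // t _; rewrite /internal/=; near=> n.
rewrite [LHS]loeb_internal; congr EFin; rewrite -[RHS](ulim_cst (U := U)).
apply: ulim_eq; near=> n; rewrite /p -[RHS](mean1 (HE n)); congr (E n _).
by apply/funext => w; rewrite indicE in_setT.
Unshelve. all: by end_near. Qed.

Let loebP : probability LT R :=
  caratheodory_probability loebT.

(* The first component of the space is the sequence space itself; only the
   point map [t] and the values on internal sets are needed afterwards. *)
Lemma loeb_space : exists (d : measure_display) (T : measurableType d)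
    (P : probability T R) (t : T -> nat -> W), complete_prob P /\
  forall A : nat -> set W,
    measurable [set w | \forall n \near U, A n (t w n)] /\
    P [set w | \forall n \near U, A n (t w n)] =
      (ulim U (fun n => E n (\1_(A n))))%:E.
Proof.
exists _, LT, loebP, (fun t => t); split.
  move=> N mN PN A AN; apply: (@measure_is_complete_caratheodory R _ loeb_outer).
  by exists N; split.
by move=> A; split; [exact: internal_measurable|exact: loeb_internal].
Qed.

End Loeb.

(** * Integration of ultralimits *)

Section BoundedIntegral.
Context {d} {T : measurableType d} {R : realType}.
Variable mu : {measure set T -> \bar R}.
Implicit Types (D A : set T) (f g : T -> R).

Definition bmf D f := measurable_fun D f /\ exists B, forall x, D x -> `|f x| <= B.

Lemma bmf_cst D r : bmf D (fun=> r).
Proof. by split; [exact: measurable_cst|exists `|r|]. Qed.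

Lemma bmfD D f g : bmf D f -> bmf D g -> bmf D (fun x => f x + g x).
Proof.
move=> [mf [B fB]] [mg [C gC]]; split; first exact: measurable_funD.
exists (B + C) => x Dx; rewrite (le_trans (ler_normD _ _))// lerD//; auto.
Qed.

Lemma bmfN D f : bmf D f -> bmf D (fun x => - f x).
Proof.
move=> [mf [B fB]]; split; first exact: measurableT_comp.
by exists B => x Dx; rewrite normrN; exact: fB.
Qed.

Lemma bmfB D f g : bmf D f -> bmf D g -> bmf D (fun x => f x - g x).
Proof. by move=> bf /bmfN; exact: bmfD. Qed.

Lemma bmfM D f g : bmf D f -> bmf D g -> bmf D (fun x => f x * g x).
Proof.
move=> [mf [B fB]] [mg [C gC]]; split; first exact: measurable_funM.
exists (B * C) => x Dx; rewrite normrM ler_pM//; auto.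
Qed.

Lemma bmf_norm D f : bmf D f -> bmf D (fun x => `|f x|).
Proof.
move=> [mf [B fB]]; split; first exact: measurableT_comp.
by exists B => x Dx; rewrite normr_id; exact: fB.
Qed.

Lemma bmf_sum D I (s : seq I) (F : I -> T -> R) :
  (forall i, bmf D (F i)) -> bmf D (fun x => \sum_(i <- s) F i x).
Proof.
move=> bF; elim: s => [|i s IH].
  by under eq_fun do rewrite big_nil; exact: bmf_cst.
by under eq_fun do rewrite big_cons; exact: bmfD.
Qed.

Lemma bmf_indic D A : measurable D -> measurable A -> bmf D (\1_A).
Proof.
move=> mD mA; split; first by apply: measurable_funTS; exact: measurable_indic.
by exists 1 => x _; rewrite indicE; case: (_ \in _); rewrite ?normr1 ?normr0.
Qed.

Lemma bmfS D D' f : measurable D -> D' `<=` D -> bmf D f -> bmf D' f.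
Proof.
move=> mD D'D [mf [B fB]]; split; first exact: measurable_funS mf.
by exists B => x /D'D/fB.
Qed.

Variable D : set T.
Hypotheses (mD : measurable D) (muD : (mu D < +oo)%E).

Lemma bmf_integrable f : bmf D f -> mu.-integrable D (EFin \o f).
Proof.
move=> [mf [B fB]]; apply: measurable_bounded_integrable => //.
by exists B; split; [exact: num_real|move=> M BM x Dx; exact: le_trans (fB _ Dx) (ltW BM)].
Qed.

Lemma bintD f g : bmf D f -> bmf D g -> Rintegral mu D (fun x => f x + g x) =
  Rintegral mu D f + Rintegral mu D g.
Proof. by move=> bf bg; apply: RintegralD => //; exact: bmf_integrable. Qed.

Lemma bintB f g : bmf D f -> bmf D g -> Rintegral mu D (fun x => f x - g x) =
  Rintegral mu D f - Rintegral mu D g.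
Proof. by move=> bf bg; apply: RintegralB => //; exact: bmf_integrable. Qed.

Lemma bintZ r f : bmf D f -> Rintegral mu D (fun x => r * f x) = r * Rintegral mu D f.
Proof. by move=> bf; apply: RintegralZl => //; exact: bmf_integrable. Qed.

Lemma bint_sum I (s : seq I) (F : I -> T -> R) : (forall i, bmf D (F i)) ->
  Rintegral mu D (fun x => \sum_(i <- s) F i x) = \sum_(i <- s) Rintegral mu D (F i).
Proof.
move=> bF; elim: s => [|i s IH].
  rewrite big_nil -[RHS](mul0r (fine (mu D))) -Rintegral_cst//.
  by apply: eq_Rintegral => x _; rewrite big_nil.
rewrite big_cons -IH -bintD//; last exact: bmf_sum.
by apply: eq_Rintegral => x _; rewrite big_cons.
Qed.

Lemma bint_le f g : bmf D f -> bmf D g -> (forall x, D x -> f x <= g x) ->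
  Rintegral mu D f <= Rintegral mu D g.
Proof. by move=> bf bg fg; apply: le_Rintegral => //; exact: bmf_integrable. Qed.

Lemma bint_norm f : bmf D f -> `|Rintegral mu D f| <= Rintegral mu D (fun x => `|f x|).
Proof. by move=> bf; apply: le_normr_Rintegral => //; exact: bmf_integrable. Qed.

Lemma bint_bound f (B : R) : bmf D f -> (forall x, D x -> `|f x| <= B) ->
  `|Rintegral mu D f| <= B * fine (mu D).
Proof.
move=> bf fB; rewrite -Rintegral_cst//; apply: (le_trans (bint_norm bf)).
by apply: bint_le => //; [exact: bmf_norm|exact: bmf_cst].
Qed.

Lemma bint_indic A : measurable A -> Rintegral mu D (\1_A) = fine (mu (A `&` D)).
Proof. by move=> mA; rewrite /Rintegral integral_indic. Qed.

Lemma bint_cvg (F : nat -> T -> R) f (B : R) : (forall n, measurable_fun D (F n)) ->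
  measurable_fun D f -> (forall n x, D x -> `|F n x| <= B) ->
  {ae mu, forall x, D x -> F ^~ x @ \oo --> f x} ->
  Rintegral mu D (F n) @[n --> \oo] --> Rintegral mu D f.
Proof.
move=> mF mf FB Ff.
have [|||||i _ h] := @dominated_convergence _ _ _ mu D mD (fun n x => (F n x)%:E)
  (fun x => (f x)%:E) (fun=> B%:E) _ _ _ _ _.
- by move=> n; exact/measurable_EFinP.
- exact/measurable_EFinP.
- by apply: filterS Ff => x h Dx; apply: cvg_EFin; [near=> n|exact: h].
- by apply: bmf_integrable; exact: bmf_cst.
- by apply: aeW => x n Dx; rewrite lee_fin; exact: FB.
have fin : (\int[mu]_(x in D) (f x)%:E)%E \is a fin_num by exact: integrable_fin_num.
by move: h; rewrite -(fineK fin) => /fine_cvgP[].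
Unshelve. all: by end_near. Qed.

End BoundedIntegral.

Section UlimAlgebra.
Context {R : realType} (U : set_system nat) {UU : UltraFilter U}.
Implicit Types u v : nat -> R.

Definition ubd u := exists B : R, \forall n \near U, `|u n| <= B.

Lemma ubdW u (B : R) : (forall n, `|u n| <= B) -> ubd u.
Proof. by move=> uB; exists B; apply: nearW. Qed.

Lemma ubd_cvg u : ubd u -> u @ U --> ulim U u.
Proof. by move=> [B]; exact: ulim_cvg. Qed.

Lemma ubdD u v : ubd u -> ubd v -> ubd (fun n => u n + v n).
Proof.
move=> [B uB] [C vC]; exists (B + C); near=> n.
by rewrite (le_trans (ler_normD _ _))// lerD//; near: n.
Unshelve. all: by end_near. Qed.

Lemma ubdN u : ubd u -> ubd (fun n => - u n).
Proof. by move=> [B uB]; exists B; near=> n; rewrite normrN; near: n. Unshelve. all: by end_near. Qed.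

Lemma ubdM u v : ubd u -> ubd v -> ubd (fun n => u n * v n).
Proof.
move=> [B uB] [C vC]; exists (B * C); near=> n.
by rewrite normrM ler_pM//; near: n.
Unshelve. all: by end_near. Qed.

Lemma ubd_cst (r : R) : ubd (fun=> r).
Proof. exact: (@ubdW _ `|r|). Qed.

Lemma ulimD u v : ubd u -> ubd v -> ulim U (fun n => u n + v n) = ulim U u + ulim U v.
Proof. by move=> bu bv; apply: ulimP; apply: cvgD; exact: ubd_cvg. Qed.

Lemma ulimB u v : ubd u -> ubd v -> ulim U (fun n => u n - v n) = ulim U u - ulim U v.
Proof. by move=> bu bv; apply: ulimP; apply: cvgB; exact: ubd_cvg. Qed.

Lemma ulimM u v : ubd u -> ubd v -> ulim U (fun n => u n * v n) = ulim U u * ulim U v.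
Proof. by move=> bu bv; apply: ulimP; apply: cvgM; exact: ubd_cvg. Qed.

Lemma ulimZ r u : ubd u -> ulim U (fun n => r * u n) = r * ulim U u.
Proof. by move=> bu; rewrite ulimM ?ulim_cst//; exact: ubd_cst. Qed.

Lemma ulim_norm u : ubd u -> ulim U (fun n => `|u n|) = `|ulim U u|.
Proof. by move=> bu; apply: ulimP; apply: cvg_norm; exact: ubd_cvg. Qed.

Lemma ubd_sum I (s : seq I) (F : I -> nat -> R) :
  (forall i, ubd (F i)) -> ubd (fun n => \sum_(i <- s) F i n).
Proof.
move=> bF; elim: s => [|i s IH].
  by under eq_fun do rewrite big_nil; exact: ubd_cst.
by under eq_fun do rewrite big_cons; exact: ubdD.
Qed.

Lemma ulim_sum I (s : seq I) (F : I -> nat -> R) : (forall i, ubd (F i)) ->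
  ulim U (fun n => \sum_(i <- s) F i n) = \sum_(i <- s) ulim U (F i).
Proof.
move=> bF; elim: s => [|i s IH].
  by under eq_fun do rewrite big_nil; rewrite ulim_cst big_nil.
under eq_fun do rewrite big_cons.
by rewrite ulimD ?IH ?big_cons//; exact: ubd_sum.
Qed.

Lemma ulim_mono u v : ubd u -> ubd v -> (\forall n \near U, u n <= v n) ->
  ulim U u <= ulim U v.
Proof. by move=> bu bv; apply: ler_cvg_to; exact: ubd_cvg. Qed.

Lemma ulim_le_cst u (r : R) : ubd u -> (\forall n \near U, u n <= r) -> ulim U u <= r.
Proof.
by move=> bu ur; rewrite -(ulim_cst (U := U) r); apply: ulim_mono => //; exact: ubd_cst.
Qed.

Lemma ulim_ge_cst u (r : R) : ubd u -> (\forall n \near U, r <= u n) -> r <= ulim U u.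
Proof.
by move=> bu ur; rewrite -(ulim_cst (U := U) r); apply: ulim_mono => //; exact: ubd_cst.
Qed.

Lemma ulim_dist u v (e : R) : ubd u -> ubd v -> (\forall n \near U, `|u n - v n| <= e) ->
  `|ulim U u - ulim U v| <= e.
Proof.
move=> bu bv uv; rewrite -ulimB// -ulim_norm; last by apply: ubdD => //; exact: ubdN.
by apply: ulim_le_cst => //; exists e; near=> n; rewrite normr_id; near: n.
Unshelve. all: by end_near. Qed.

Lemma ulim_continuous (f : R -> R) u : continuous f -> ubd u ->
  ulim U (fun n => f (u n)) = f (ulim U u).
Proof.
by move=> cf bu; apply: ulimP; apply: continuous_cvg; [exact: cf|exact: ubd_cvg].
Qed.

End UlimAlgebra.

(** The sum counts the integers from 1 to [y], so it is the integer part of [y]. It serves to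
    approximate functions by sums of indicators of superlevel sets. *)
Lemma stair_bound {R : realType} (J : nat) (y : R) : 0 <= y -> y <= J%:R ->
  y - 1 <= \sum_(j < J) (j.+1%:R <= y :> R)%:R /\
  \sum_(j < J) (j.+1%:R <= y :> R)%:R <= y.
Proof.
move=> y0; elim: J => [|J IH] yJ.
  by rewrite big_ord0; split=> //; lra.
rewrite big_ord_recr/=; have [yJ'|Jy] := leP y J%:R.
  have -> : (J.+1%:R <= y :> R) = false.
    by apply/negP => Jy; have := le_trans Jy yJ'; rewrite ler_nat ltnn.
  by rewrite addr0; exact: IH.
have -> : \sum_(i < J) (i.+1%:R <= y :> R)%:R = J%:R :> R.
  rewrite -[in RHS](card_ord J) -sum1_card natr_sum; apply: eq_bigr => i _.
  by rewrite (le_trans _ (ltW Jy))// ler_nat.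
rewrite -natr1 in yJ *; have [h|h] := leP (J%:R + 1) y => /=; split; lra.
Qed.

(** * Standard parts of internal functions and their integrals *)

Section StandardPart.
Context {R : realType} {U : set_system nat} {UU : UltraFilter U}.
Context {W : Type} {E : nat -> (W -> R) -> R}.
Hypothesis HE : forall n, is_mean (E n).
Context {d : measure_display} {T : measurableType d} {P : probability T R}.
Context {t : T -> nat -> W}.

Definition internal_event (A : nat -> set W) : set T := [set w | \forall n \near U, A n (t w n)].

Hypothesis HI : forall A : nat -> set W,
    measurable (internal_event A) /\ P (internal_event A) = (ulim U (fun n => E n (\1_(A n))))%:E.

Definition std_part (f : nat -> W -> R) (w : T) : R := ulim U (fun n => f n (t w n)).

Lemma P_lty : (P [set: T] < +oo)%E.
Proof. by rewrite probability_setT ltry. Qed.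

Lemma P_cst (r : R) : Rintegral P setT (fun=> r) = r.
Proof.
by rewrite Rintegral_cst// -[RHS]mulr1; congr (_ * _); exact: (congr1 fine (@probability_setT _ _ _ P)).
Qed.

Lemma ubd_E (f : nat -> W -> R) (B : R) : (forall n w, `|f n w| <= B) ->
  ubd U (fun n => E n (f n)).
Proof.
move=> fB; apply: (@ubdW _ _ _ _ B) => n; rewrite (le_trans (mean_norm (HE n) _))//.
by rewrite -[leRHS](mean_cst (HE n)); apply: (le_mean (HE n)).
Qed.

Lemma ulim_intl A w : ulim U (fun n => \1_(A n) (t w n)) = \1_(internal_event A) w :> R.
Proof.
rewrite indicE; case: (boolP (w \in internal_event A)).
  rewrite inE => Aw; rewrite -[RHS](ulim_cst (U := U) 1); apply: ulim_eq.
  have UA : U [set n | A n (t w n)] by exact: Aw.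
  by apply: filterS UA => n /= An; rewrite indicE mem_set.
rewrite notin_setE => nA; rewrite -[RHS](ulim_cst (U := U) 0); apply: ulim_eq.
have [//|NU] := in_ultra_setVsetC [set n | A n (t w n)] UU.
by apply: filterS NU => n /= An; rewrite indicE memNset.
Qed.

Let indic_bd (A : set W) w : `|\1_A w : R| <= 1.
Proof. by rewrite indicE; case: (_ \in _); rewrite ?normr1 ?normr0. Qed.

(** Layer-cake approximation: up to [m.+1%:R^-1], [f] is a combination of indicators of superlevel
    sets. These define internal events, whose measurability and mass are given by [HI]; the error is
    uniform in [n] and in the point, so it survives both limits. *)
Let st_approx (f : nat -> W -> R) (B : R) (m : nat) : (forall n w, 0 <= f n w <= B) ->
  exists g, [/\ bmf setT g, forall w, `|g w - std_part f w| <= m.+1%:R^-1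
    & `|Rintegral P setT g - ulim U (fun n => E n (f n))| <= m.+1%:R^-1].
Proof.
move=> fB; have m0 : 0 < m.+1%:R :> R by rewrite ltr0n.
have fB' n w : `|f n w| <= B by have /andP[f0 ?] := fB n w; rewrite ger0_norm.
have [J hJ] : exists J : nat, m.+1%:R * B <= J%:R.
  by exists (Num.truncn `|m.+1%:R * B|).+1; rewrite (le_trans (ler_norm _))// ltW// truncnS_gt.
pose A (j : nat) n : set W := [set w | j.+1%:R <= m.+1%:R * f n w].
pose q n w : R := m.+1%:R^-1 * \sum_(j < J) \1_(A j n) w.
have qE n w : \sum_(j < J) \1_(A j n) w = \sum_(j < J) (j.+1%:R <= m.+1%:R * f n w :> R)%:R :> R.
  by apply: eq_bigr => j _; rewrite indicE /A; congr (nat_of_bool _)%:R;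
    apply/idP/idP; rewrite inE.
have qf n w : `|q n w - f n w| <= m.+1%:R^-1.
  have /andP[f0 f1] := fB n w.
  have y0 : 0 <= m.+1%:R * f n w by rewrite mulr_ge0.
  have yJ : m.+1%:R * f n w <= J%:R by apply: le_trans hJ; rewrite ler_pM2l.
  have [h1 h2] := stair_bound y0 yJ.
  have -> : q n w - f n w = m.+1%:R^-1 * (\sum_(j < J) \1_(A j n) w - m.+1%:R * f n w).
    by rewrite mulrBr mulKf ?gt_eqF.
  rewrite normrM gtr0_norm ?invr_gt0// -[leRHS]mulr1 ler_pM2l ?invr_gt0//.
  by rewrite qE ler_norml; apply/andP; split; lra.
have qB n w : `|q n w| <= B + m.+1%:R^-1.
  have := qf n w; have := fB' n w => h1 h2.
  by rewrite -[q n w](subrK (f n w)) addrC (le_trans (ler_normD _ _))// lerD.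
pose g w : R := m.+1%:R^-1 * \sum_(j < J) \1_(internal_event (A j)) w.
have bi j : bmf [set: T] (\1_(internal_event (A j)) : T -> R).
  by apply: bmf_indic => //; case: (HI (A j)).
exists g; split.
- by apply: bmfM; [exact: bmf_cst|exact: bmf_sum].
- move=> w; have -> : g w = std_part q w.
    rewrite /std_part /q ulimZ; last by apply: ubd_sum => j; exact: ubdW.
    by rewrite ulim_sum => [|j]; [|exact: ubdW]; under eq_bigr do rewrite ulim_intl.
  by apply: ulim_dist; [exact: ubdW|exact: ubdW|exact: nearW].
- rewrite bintZ//; [|exact: P_lty|exact: bmf_sum].
  rewrite bint_sum//; last exact: P_lty.
  have -> : \sum_(i < J) Rintegral P setT (\1_(internal_event (A i))) =
     \sum_(i < J) ulim U (fun n => E n (\1_(A i n))).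
    apply: eq_bigr => i _; rewrite bint_indic//; last by case: (HI (A i)).
    by rewrite setIT; exact: (congr1 fine (HI (A i)).2).
  have bE i : ubd U (fun n => E n (\1_(A i n))) by apply: ubd_E.
  rewrite -ulim_sum// -ulimZ; last exact: ubd_sum.
  apply: ulim_dist.
  + by apply: ubdM; [exact: ubd_cst|exact: ubd_sum].
  + exact: ubd_E.
  + apply: nearW => n; rewrite -(mean_sum (HE n)) -(meanZ (HE n)) -(meanB (HE n)).
    rewrite (le_trans (mean_norm (HE n) _))// -[leRHS](mean_cst (HE n)).
    by apply: (le_mean (HE n)) => w; exact: qf.
Qed.

Let inv_cvg0 : (fun m : nat => m.+1%:R^-1 : R) @ \oo --> (0 : R).
Proof. exact: cvg_harmonic. Qed.

Let st_nonneg (f : nat -> W -> R) (B : R) : (forall n w, 0 <= f n w <= B) ->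
  bmf setT (std_part f) /\ Rintegral P setT (std_part f) = ulim U (fun n => E n (f n)).
Proof.
move=> fB; have /choice[g hg] := fun m => st_approx m fB.
have fB' n w : `|f n w| <= B by have /andP[f0 ?] := fB n w; rewrite ger0_norm.
have bst : bmf setT (std_part f).
  split; last first.
    exists B => w _; rewrite -ulim_norm; last exact: ubdW.
    by apply: ulim_le_cst; [apply: ubdW => n; rewrite normr_id|exact: nearW].
  apply: (@measurable_fun_cvg _ _ _ setT g) => [m|w _]; first by have [[]] := hg m.
  apply/cvgrPdist_le => e e0; near=> m.
  rewrite distrC; have [_ h _] := hg m; apply: (le_trans (h w)).
  near: m; have /cvgrPdist_le/(_ e e0) := inv_cvg0.
  by apply: filterS => m; rewrite sub0r normrN ger0_norm.
split=> //; apply/eqP; rewrite -subr_eq0 -normr_le0; apply/ler_addgt0Pr => e e0.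
rewrite add0r.
have e2 : 0 < e / 2 by rewrite divr_gt0.
have [m hm] : exists m : nat, m.+1%:R^-1 <= e / 2.
  have /cvgrPdist_le/(_ _ e2)[m _ h] := inv_cvg0.
  by exists m; have := h m (leqnn _); rewrite sub0r normrN ger0_norm.
have [bg h1 h2] := hg m.
rewrite -[_ - _](subrKA (Rintegral P setT (g m))) (le_trans (ler_normD _ _))//.
rewrite [e]splitr lerD//; last exact: le_trans hm.
rewrite -bintB//; last exact: P_lty.
apply: (le_trans (bint_bound measurableT P_lty (bmfB bst bg) (B := m.+1%:R^-1) _)).
  by move=> w _; rewrite distrC.
by rewrite -Rintegral_cst// P_cst.
Unshelve. all: by end_near. Qed.

(** Signed functions are reduced to nonnegative ones by adding their bound. *)
Let shift (f : nat -> W -> R) (B : R) : (forall n w, `|f n w| <= B) ->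
  forall n w, 0 <= f n w + B <= B + B.
Proof. by move=> fB n w; have := fB n w; rewrite ler_norml => /andP[h1 h2]; lra. Qed.

Let stD (f : nat -> W -> R) (B : R) : (forall n w, `|f n w| <= B) ->
  std_part f = fun w => std_part (fun n w => f n w + B) w - B.
Proof.
move=> fB; apply/funext => w; rewrite /std_part ulimD; [|exact: ubdW|exact: ubd_cst].
by rewrite ulim_cst addrK.
Qed.

Lemma st_bmf (f : nat -> W -> R) (B : R) : (forall n w, `|f n w| <= B) -> bmf setT (std_part f).
Proof.
move=> fB; rewrite (stD fB); apply: bmfB; last exact: bmf_cst.
exact: (st_nonneg (shift fB)).1.
Qed.

Lemma st_int (f : nat -> W -> R) (B : R) : (forall n w, `|f n w| <= B) ->
  Rintegral P setT (std_part f) = ulim U (fun n => E n (f n)).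
Proof.
move=> fB; have [h1 h2] := st_nonneg (shift fB).
rewrite (stD fB) bintB//; [|exact: P_lty|exact: bmf_cst].
rewrite h2 P_cst.
under eq_fun do rewrite (meanD (HE _)) (mean_cst (HE _)).
by rewrite ulimD ?ulim_cst ?addrK//; [exact: ubd_E|exact: ubd_cst].
Qed.

End StandardPart.

(** * Trigonometric sums *)

Section Trig.
Context {R : realType}.
Implicit Types x y z : R.

Lemma sin_le_id x : 0 <= x -> sin x <= x.
Proof.
rewrite le_eqVlt => /predU1P[<-|x0]; first by rewrite sin0.
have [c _] := @MVT R sin cos 0 x x0 (fun y _ => is_derive_sin y)
  (continuous_subspaceT (@continuous_sin R)).
by rewrite sin0 !subr0 => ->; rewrite ler_piMl ?cos_le1// ltW.
Qed.

Lemma norm_sin_le x : `|sin x| <= `|x|.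
Proof.
wlog x0 : x / 0 <= x.
  move=> h; have [/h//|x0] := leP 0 x.
  by rewrite -(normrN x) -(normrN (sin x)) -sinN; apply: h; rewrite oppr_ge0 ltW.
rewrite (ger0_norm x0) ler_norml sin_le_id// andbT lerNl -sinN.
have [x1|x1] := leP x 1; last by rewrite (le_trans (sin_le1 _))// ltW.
rewrite sinN lerNl; apply: (@le_trans _ _ 0); first by rewrite oppr_le0.
by apply: sin_ge0_pi; rewrite x0 (le_trans x1)// (le_trans _ (pi_ge2 R))// ler1n.
Qed.

Lemma one_sub_cos x : 1 - cos x = 2 * sin (x / 2) ^+ 2.
Proof.
have {1}-> : x = (x / 2) *+ 2 by rewrite -mulr_natr divfK.
by rewrite cos_mulr2n sin2cos2 -mulr_natr; lra.
Qed.

Lemma one_sub_cos_le x : 0 <= 1 - cos x <= x ^+ 2 / 2.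
Proof.
rewrite subr_ge0 cos_le1/= one_sub_cos.
have : sin (x / 2) ^+ 2 <= (x / 2) ^+ 2.
  by rewrite -(ger0_norm (sqr_ge0 (sin _))) -(ger0_norm (sqr_ge0 (_ / _)))
     !normrX lerXn2r ?nnegrE// norm_sin_le.
by lra.
Qed.

Lemma norm_cosB_le x y : `|cos x - cos y| <= `|x - y|.
Proof.
wlog xy : x y / y < x.
  move=> h; have [/h//|/h|->] := ltgtP y x; last by rewrite !subrr.
  by rewrite distrC (distrC x).
have [c _ ->] := @MVT R cos (fun x => - sin x) y x xy (fun y _ => is_derive_cos y)
  (continuous_subspaceT (@continuous_cos R)).
by rewrite normrM ler_piMl// normrN sin_max.
Qed.

Lemma norm_sinB_le x y : `|sin x - sin y| <= `|x - y|.
Proof.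
rewrite -(cosBpihalf x) -(cosBpihalf y) (le_trans (norm_cosB_le _ _))//.
by have -> : x - pi / 2 - (y - pi / 2) = x - y by ring.
Qed.

Lemma norm_sin_sub_id x : `|sin x - x| <= x ^+ 2.
Proof.
wlog x0 : x / 0 < x.
  move=> h; have [/h//|/ltW x0|<-] := ltgtP 0 x; last first.
    by rewrite sin0 subr0 normr0 sqr_ge0.
  move: x0; rewrite le_eqVlt => /predU1P[->|x0].
    by rewrite sin0 subr0 normr0 sqr_ge0.
  by rewrite -normrN opprD -sinN -sqrrN; apply: h; rewrite oppr_gt0.
have [c cx] := @MVT R sin cos 0 x x0 (fun y _ => is_derive_sin y)
  (continuous_subspaceT (@continuous_sin R)).
rewrite sin0 !subr0 => ->; rewrite -{2}[x]mul1r -mulrBl normrM (gtr0_norm x0) expr2.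
rewrite ler_wpM2r ?(ltW x0)// -cos0 (le_trans (norm_cosB_le _ _))// subr0.
by move: cx; rewrite in_itv/= => /andP[c0 /ltW cx]; rewrite gtr0_norm.
Qed.

Lemma cos_taylor x z : `|cos (x + z) - cos x + z * sin x| <= 2 * z ^+ 2.
Proof.
have -> : cos (x + z) - cos x + z * sin x =
    - cos x * (1 - cos z) - sin x * (sin z - z) by rewrite cosD; ring.
apply: (le_trans (ler_normB _ _)); rewrite !normrM normrN.
have /andP[h0 h1] := one_sub_cos_le z; have h2 := norm_sin_sub_id z.
rewrite [X in _ * X + _]ger0_norm//.
have h3 : `|cos x| * (1 - cos z) <= 1 * (1 - cos z) by rewrite ler_wpM2r// cos_max.
have h4 : `|sin x| * `|sin z - z| <= 1 * `|sin z - z| by rewrite ler_wpM2r// sin_max.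
by have := sqr_ge0 z; lra.
Qed.

Lemma sin_taylor x z : `|sin (x + z) - sin x - z * cos x| <= 2 * z ^+ 2.
Proof.
have := cos_taylor (x - pi / 2) z.
have -> : x - pi / 2 + z = x + z - pi / 2 by ring.
by rewrite sinBpihalf !cosBpihalf mulrN.
Qed.

(** With y = |x| / 2 in [0, pi/2], the bound sin y >= y / 8 gives 2 (x / 16)^2. Up to 1/2 even sin y
    >= y / 2 holds by the quadratic estimate; beyond, monotonicity gives sin y >= sin (1/2) >= 1/4,
    and y < 2. *)
Lemma one_sub_cos_ge x : `|x| <= pi -> x ^+ 2 / 128 <= 1 - cos x.
Proof.
wlog x0 : x / 0 <= x.
  move=> h; have [/h//|x0] := leP 0 x.
  by move=> xpi; rewrite -cosN -sqrrN; apply: h; rewrite ?oppr_ge0 ?(ltW x0)// normrN.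
rewrite ger0_norm// => xpi; rewrite one_sub_cos.
set y := x / 2; have y0 : 0 <= y by rewrite divr_ge0.
have ypi : y <= pi / 2 by rewrite ler_pM2r// invr_gt0.
have pi4 := pihalf_lt2 R; have pi1 := pihalf_ge1 R.
have small z : 0 <= z -> z <= 1/2 -> z / 2 <= sin z.
  move=> z0 z1; have := norm_sin_sub_id z; rewrite ler_norml => /andP[h _].
  have : z ^+ 2 <= z / 2 by rewrite expr2; nra.
  by lra.
have hs : y / 8 <= sin y.
  have [yh|yh] := leP y (1/2); first by have := small y y0 yh; lra.
  have : sin (1/2) <= sin y.
    rewrite leNgt ltr_sin ?in_itv/=; [by rewrite -leNgt ltW|by apply/andP; split; lra|].
    by apply/andP; split; lra.
  have := small (1/2); lra.
have : (y / 8) ^+ 2 <= sin y ^+ 2 by rewrite lerXn2r ?nnegrE//; lra.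
have -> : x = 2 * y by rewrite /y mulrC divfK.
by rewrite !expr2; nra.
Qed.

Lemma sin_mulz_pi (m : int) : sin (pi * m%:~R) = 0 :> R.
Proof.
have nat n : sin (pi * n%:R) = 0 :> R.
  elim: n => [|n IH]; first by rewrite mulr0 sin0.
  by rewrite -natr1 mulrDr mulr1 sinDpi IH oppr0.
by case: m => n; rewrite ?NegzE ?mulrNz ?mulrN ?sinN -pmulrn nat ?oppr0.
Qed.

End Trig.

(** * Fourier sums on a finite cyclic group *)

Section SymmetricRange.
Context {R : realType}.

(** Representatives of the integers modulo [B.*2.+1], chosen symmetric so that the dual frequencies
    stay in [-pi, pi]. *)
Definition srange (B : nat) : seq int := [seq i%:Z - B%:Z | i <- iota 0 B.*2.+1].

Lemma mem_srange B x : (x \in srange B) = (`|x| <= B%:Z).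
Proof.
apply/mapP/idP => [[i]|xB]; first by rewrite mem_iota => /= /[swap] ->; lia.
by exists (absz (x + B%:Z)); rewrite ?mem_iota; lia.
Qed.

Lemma srange_uniq B : uniq (srange B).
Proof. by rewrite map_inj_uniq ?iota_uniq// => i j; lia. Qed.

Lemma size_srange B : size (srange B) = B.*2.+1.
Proof. by rewrite size_map size_iota. Qed.

Lemma sum_srange B (g : int -> R) :
  \sum_(x <- srange B) g x = \sum_(0 <= i < B.*2.+1) g (i%:Z - B%:Z).
Proof. by rewrite big_map /index_iota subn0. Qed.

Lemma sum_srangeE B (g : int -> R) :
  \sum_(x <- srange B) g x = g 0 + \sum_(i < B) (g (i.+1)%:Z + g (- (i.+1)%:Z)).
Proof.
elim: B => [|B IH].
  by rewrite big_ord0 addr0 /srange/= big_cons big_nil addr0.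
rewrite big_ord_recr/= addrA -IH !sum_srange doubleS big_nat_recl// big_nat_recr//=.
have -> : \sum_(0 <= i < (B.*2).+1) g (Posz i.+1 - Posz B.+1) =
   \sum_(0 <= i < (B.*2).+1) g (Posz i - Posz B).
  by apply: eq_bigr => i _; congr g; lia.
have -> : Posz 0 - Posz B.+1 = - Posz B.+1 by lia.
have -> : Posz (B.*2).+2 - Posz B.+1 = Posz B.+1 by lia.
by ring.
Qed.

(** Dirichlet kernel: after multiplication by [sin phi], with phi = pi m / (2B+1), the sum
    telescopes to multiples of sin (pi m) = 0. The bound on [m] keeps phi away from the multiples of
    pi. *)
Lemma srange_orth B (m : int) : `|m| < (B.*2.+1)%:Z -> m != 0 ->
  \sum_(l <- srange B) cos (2 * pi * l%:~R / B.*2.+1%:R * m%:~R) = 0 :> R.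
Proof.
move=> mB m0; set M : R := B.*2.+1%:R.
have M0 : 0 < M by rewrite ltr0n.
pose phi : R := pi * m%:~R / M.
have sphi : sin phi != 0.
  wlog m1 : m @phi mB m0 / 0 < m.
    move=> h; have [m1|m1] := leP m 0; last exact: h.
    have : sin (pi * (- m)%:~R / M) != 0 by apply: h; lia.
    by rewrite mulrNz mulrN mulNr sinN oppr_eq0.
  rewrite gt_eqF// sin_gt0_pi// divr_gt0//= ?mulr_gt0 ?pi_gt0 ?ltr0z//.
  rewrite ltr_pdivrMr// ltr_pM2l ?pi_gt0// /M -[_%:R]/((B.*2.+1)%:Z%:~R).
  by rewrite ltr_int; lia.
apply: (mulfI sphi); rewrite mulr0 sum_srange mulr_sumr.
pose u (i : nat) : R := sin ((2 * (i%:Z - B%:Z)%:~R - 1) * phi) / 2.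
rewrite (eq_bigr (fun i => u i.+1 - u i)); last first.
  move=> i _; rewrite /u -mulrBl.
  have -> : 2 * pi * (Posz i - Posz B)%:~R / M * m%:~R = 2 * (Posz i - Posz B)%:~R * phi.
    by rewrite /phi; ring.
  have -> : (2 * (Posz i.+1 - Posz B)%:~R - 1) * phi =
     2 * (Posz i - Posz B)%:~R * phi + phi.
    have -> : Posz i.+1 - Posz B = (Posz i - Posz B) + 1 by lia.
    by rewrite rmorphD/=; ring.
  have -> : (2 * (Posz i - Posz B)%:~R - 1) * phi = 2 * (Posz i - Posz B)%:~R * phi - phi by ring.
  by rewrite sinD sinB; field.
rewrite telescope_sumr// /u.
have -> : (2 * (Posz (B.*2).+1 - Posz B)%:~R - 1) * phi = pi * m%:~R.
  have -> : Posz (B.*2).+1 - Posz B = Posz B.+1 by lia.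
  rewrite /phi -mulrA mulrCA; congr (_ * _); rewrite [LHS]mulrA -[RHS]mul1r.
  have -> : 2 * (Posz B.+1)%:~R - 1 = M.
    by rewrite -[(Posz B.+1)%:~R]/(B.+1%:R) /M -addnn -!natr1 natrD; ring.
  by field; rewrite gt_eqF.
have -> : (2 * (Posz 0 - Posz B)%:~R - 1) * phi = - (pi * m%:~R).
  have -> : 2 * (Posz 0 - Posz B)%:~R - 1 = - M.
    by rewrite /M sub0r mulrNz -addn1 -addnn !natrD; ring.
  by rewrite /phi; field; rewrite gt_eqF.
by rewrite sinN sin_mulz_pi; ring.
Qed.

(* Plancherel on Z/(2B+1), in real form. *)
Lemma plancherel B (b : int -> R) :
  \sum_(l <- srange B) (
    (\sum_(x <- srange B) b x * cos (2 * pi * l%:~R / B.*2.+1%:R * x%:~R)) ^+ 2 +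
    (\sum_(x <- srange B) b x * sin (2 * pi * l%:~R / B.*2.+1%:R * x%:~R)) ^+ 2) =
  B.*2.+1%:R * \sum_(x <- srange B) b x ^+ 2.
Proof.
rewrite (eq_bigr (fun l => \sum_(x <- srange B) \sum_(y <- srange B)
   b x * b y * cos (2 * pi * l%:~R / B.*2.+1%:R * (x - y)%:~R))); last first.
  move=> l _; rewrite !expr2 !mulr_suml -big_split/=; apply: eq_bigr => x _.
  rewrite !mulr_sumr -big_split/=; apply: eq_bigr => y _.
  by rewrite rmorphB/= mulrBr cosB; ring.
rewrite exchange_big/= mulr_sumr; apply: eq_big_seq => x xB.
rewrite exchange_big/= (bigD1_seq x xB (srange_uniq B))/= [X in _ + X]big1_seq ?addr0.
  rewrite (eq_bigr (fun=> b x ^+ 2)).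
    by rewrite big_const_seq count_predT size_srange iter_addr_0 mulr_natl.
  by move=> i _; rewrite subrr mulr0z mulr0 cos0 mulr1 expr2.
move=> y /andP[yx yB]; rewrite -mulr_sumr srange_orth ?mulr0//.
  by move: xB yB; rewrite !mem_srange; lia.
by rewrite subr_eq0 eq_sym.
Qed.

(** The terms for [l] and [- l] together are compared with a telescoping sum: since (1 + y)^2 <= 2
    (1 + y^2), one has 2 / (1 + y^2) <= 4 / ((1 + y) (1 + y - D)). *)
Lemma sum_lorentz B (D : R) : 0 < D ->
  \sum_(l <- srange B) (1 + (l%:~R * D) ^+ 2)^-1 <= 1 + 4 / D.
Proof.
move=> D0; rewrite sum_srangeE mul0r expr0n addr0 invr1 lerD2l.
pose u (i : nat) : R := - (4 / (D * (1 + i%:R * D))).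
have pos (i : nat) : 0 < 1 + i%:R * D by rewrite ltr_pwDl// mulr_ge0// ltW.
apply: (@le_trans _ _ (\sum_(i < B) (u i.+1 - u i))).
  apply: ler_sum => i _; rewrite mulrNz mulNr sqrrN -mulr2n -mulr_natl /u.
  set y := (i.+1)%:R * D; have y0 : 0 < y by rewrite mulr_gt0// ltr0n.
  have -> : 1 + i%:R * D = 1 + y - D by rewrite /y -natr1; ring.
  have yD : 0 < 1 + y - D by rewrite /y -natr1 mulrDl mul1r addrA addrK.
  have -> : - (4 / (D * (1 + y))) - - (4 / (D * (1 + y - D))) =
     4 / ((1 + y) * (1 + y - D)).
    by field; rewrite !gt_eqF// ltr_pwDl// ltW.
  rewrite ler_pdivlMr; last by rewrite mulr_gt0// ltr_pwDl// ltW.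
  rewrite mulrAC ler_pdivrMr; last by rewrite ltr_pwDl// sqr_ge0.
  have : (1 + y) * (1 + y - D) <= (1 + y) * (1 + y).
    by rewrite ler_wpM2l ?gerBl ?(ltW D0)// addr_ge0// ltW.
  have := sqr_ge0 (1 - y); rewrite !expr2; lra.
rewrite -(big_mkord xpredT (fun i => u i.+1 - u i)) telescope_sumr// /u.
rewrite mul0r addr0 mulr1 opprK addrC gerDl oppr_le0 divr_ge0//.
by rewrite mulr_ge0// ltW.
Qed.

End SymmetricRange.

(** * Lattice Markov chains and the Krylov estimate *)

(* Jumps in lattice units with their rates, mesh, time step, variance of the
   nearest-neighbour noise, its drift, and drift coefficient.  A path is recorded
   by the sequence [s] of its increments, so that [pos (take k s)] is the
   displacement after [k] steps. *)
Record chain (R : realType) := Chain {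
  ch_jumps : seq int;
  ch_w : int -> R;
  ch_h : R;
  ch_d : R;
  ch_s : R;
  ch_dr : R;
  ch_a : nat -> int -> R }.

Definition pos (s : seq int) : int := \sum_(z <- s) z.

Lemma pos_takeS k s : pos (take k.+1 s) = pos (take k s) + nth 0 s k.
Proof.
rewrite /pos; elim: s k => [|z s IH] [|k].
- by rewrite !big_nil.
- by rewrite !big_nil.
- by rewrite /= take0 big_cons !big_nil addr0 add0r.
- by rewrite /= !big_cons IH addrA.
Qed.

Lemma pos_bound Z k s : all (fun z : int => `|z| <= Z%:Z) s ->
  `|pos (take k s)| <= (size s * Z)%:Z.
Proof.
move=> sZ; have : all (fun z : int => `|z| <= Z%:Z) (take k s).
  by rewrite -(cat_take_drop k s) all_cat in sZ; case/andP: sZ.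
have : (size (take k s) <= size s)%N by rewrite size_take; case: ifP => //; lia.
move: (size s) (take k s) => n; rewrite /pos; elim: n {s sZ} => [|n IH] [|z s]//=.
- by rewrite big_nil.
- by rewrite big_nil.
- rewrite ltnS big_cons => sn /andP[zZ sZ].
  rewrite mulSn PoszD (le_trans (ler_normD _ _))// lerD//; exact: IH.
Qed.

Section Chain.
Context {R : realType} (c : chain R).

Local Notation h := (ch_h c).
Local Notation dt := (ch_d c).
Local Notation sig := (ch_s c).
Local Notation dr := (ch_dr c).
Local Notation a := (ch_a c).

Definition jumpsum (G : int -> R) : R := \sum_(z <- ch_jumps c) ch_w c z * G z.

(* [ok_dr] and [ok_rate] make the weights in [step] nonnegative. *)
Record chain_ok (K : R) : Prop := ChainOk {
  ok_w : forall z, 0 <= ch_w c z;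
  ok_h : 0 < h;
  ok_d : 0 < dt;
  ok_s : 0 < sig;
  ok_dr : h * (`|dr| + K) <= sig;
  ok_rate : dt * (jumpsum (fun=> 1) + sig / h ^+ 2) <= 1;
  ok_a : forall k x, `|a k x| <= K }.

Definition step (k : nat) (x : int) (G : int -> R) : R :=
  dt * jumpsum G + dt * ((sig / h ^+ 2 + (dr + a k x) / h) / 2) * G 1
  + dt * ((sig / h ^+ 2 - (dr + a k x) / h) / 2) * G (-1)
  + (1 - dt * (jumpsum (fun=> 1) + sig / h ^+ 2)) * G 0.

(** Generator of the chain per unit of time: the noise is a centred second difference with factor
    [sig / 2], the drift [dr + b] a centred first difference. *)
Definition gen (b : R) (G : int -> R) : R :=
  jumpsum (fun z => G z - G 0) + sig / h ^+ 2 / 2 * (G 1 + G (-1) - 2 * G 0)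
  + (dr + b) / h / 2 * (G 1 - G (-1)).

Lemma jumpsum_lin x y G1 G2 :
  jumpsum (fun z => x * G1 z + y * G2 z) = x * jumpsum G1 + y * jumpsum G2.
Proof.
rewrite /jumpsum !mulr_sumr -big_split/=; apply: eq_bigr => z _; ring.
Qed.

Lemma jumpsumB G1 G2 : jumpsum (fun z => G1 z - G2 z) = jumpsum G1 - jumpsum G2.
Proof.
have := jumpsum_lin 1 (-1) G1 G2; rewrite mul1r mulN1r => <-.
by congr jumpsum; apply/funext => z; rewrite mul1r mulN1r.
Qed.

Lemma jumpsumZ x G : jumpsum (fun z => x * G z) = x * jumpsum G.
Proof.
have := jumpsum_lin x 0 G G; rewrite mul0r addr0 => <-.
by congr jumpsum; apply/funext => z; rewrite mul0r addr0.
Qed.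

Lemma jumpsum_cst x : jumpsum (fun=> x) = x * jumpsum (fun=> 1).
Proof. by rewrite -jumpsumZ; congr jumpsum; apply/funext => z; rewrite mulr1. Qed.

Lemma stepE k x G : step k x G = G 0 + dt * gen (a k x) G.
Proof.
rewrite /step /gen jumpsumB (jumpsum_cst (G 0)).
by set A := sig / h ^+ 2; set B := (dr + a k x) / h; field.
Qed.

Variables (K : R) (ok : chain_ok K).

Let h0 := ok_h ok.

Lemma jumpsum_ge0 G : (forall z, 0 <= G z) -> 0 <= jumpsum G.
Proof. by move=> G0; apply: sumr_ge0 => z _; rewrite mulr_ge0// (ok_w ok). Qed.

Lemma step_mean k x : is_mean (step k x).
Proof.
have ha : `|(dr + a k x) / h| <= sig / h ^+ 2.
  rewrite normrM normfV (gtr0_norm h0) ler_pdivrMr// expr2 invfM -mulrA.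
  rewrite divfK ?gt_eqF// ler_pdivlMr// mulrC (le_trans _ (ok_dr ok))//.
  rewrite ler_pM2l// (le_trans (ler_normD _ _))// lerD2l; exact: (ok_a ok).
move: ha; rewrite ler_norml => /andP[ha1 ha2].
split.
- by move=> r s F G; rewrite /step jumpsum_lin; ring.
- move=> F F0; rewrite /step !addr_ge0// ?mulr_ge0 ?jumpsum_ge0//.
  + exact: ltW (ok_d ok).
  + exact: ltW (ok_d ok).
  + by lra.
  + exact: ltW (ok_d ok).
  + by lra.
  + by rewrite subr_ge0 (ok_rate ok).
- by rewrite /step; field; rewrite gt_eqF.
Qed.

(** The state is the whole history, so one operator, iterated, gives the mean of any functional of
    the path. *)
Definition Qop (F : seq int -> R) (s : seq int) : R :=
  step (size s) (pos s) (fun z => F (rcons s z)).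

Lemma iterQ_mean N s : is_mean (fun F => iter N Qop F s).
Proof.
elim: N s => [|N IH] s; first by split.
split => [r t F G|F F0|]; rewrite !iterS /Qop.
- rewrite -(mean_lin (step_mean _ _)); congr step; apply/funext => z.
  by rewrite (mean_lin (IH _)).
- by apply: (mean_ge0 (step_mean _ _)) => z; apply: (mean_ge0 (IH _)).
- rewrite -[RHS](mean1 (step_mean (size s) (pos s))); congr step; apply/funext => z.
  by rewrite (mean1 (IH _)).
Qed.

Definition Ech N (F : seq int -> R) : R := iter N Qop F [::].

Lemma Ech_mean N : is_mean (Ech N).
Proof. exact: iterQ_mean. Qed.

Lemma iterQ_triv r m (F : seq int -> R) s : (forall s', F s' = F (take m s')) ->
  (m <= size s)%N -> iter r Qop F s = F s.
Proof.
move=> Fm; elim: r s => // r IH s ms; rewrite iterS /Qop.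
have -> : (fun z => iter r Qop F (rcons s z)) = fun=> F s.
  apply/funext => z; rewrite IH ?size_rcons ?(leqW ms)// Fm [RHS]Fm.
  by rewrite -cats1 takel_cat.
exact: (mean_cst (step_mean _ _)).
Qed.

(** Markov property: [j] steps lead from [s] to length [k], one more draws the increment that is
    averaged out, and the last [r] steps do not affect either side. *)
Lemma iterQ_markov j k r s (Phi : seq int -> int -> R) : (size s + j = k)%N ->
  iter (j + r).+1 Qop (fun s => Phi (take k s) (nth 0 s k)) s =
  iter (j + r).+1 Qop (fun s => step k (pos (take k s)) (Phi (take k s))) s.
Proof.
elim: j s => [|j IH] s.
  rewrite addn0 add0n => <-.
  rewrite [RHS](@iterQ_triv _ (size s))//; last by move=> s'; rewrite /= take_taker.
  rewrite iterS /Qop take_size; congr step; apply/funext => z.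
  rewrite (@iterQ_triv _ (size s).+1) ?size_rcons//.
    by rewrite -cats1 take_size_cat// nth_cat ltnn subnn.
  move=> s' /=; congr Phi; first by rewrite take_takel.
  by rewrite nth_take.
move=> sk; rewrite addSn [in LHS]iterS [in RHS]iterS.
rewrite [LHS]/Qop [RHS]/Qop; congr step; apply/funext => z.
by apply: IH; rewrite size_rcons addSnnS.
Qed.

Lemma markov_step N k (Phi : seq int -> int -> R) : (k < N)%N ->
  Ech N (fun s => Phi (take k s) (nth 0 s k)) =
  Ech N (fun s => Phi (take k s) 0 + dt * gen (a k (pos (take k s))) (Phi (take k s))).
Proof.
move=> kN; rewrite /Ech.
have -> : N = (k + (N - k.+1)).+1 by lia.
rewrite iterQ_markov ?add0n//; congr (iter _ _ _ _); apply/funext => s.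
exact: stepE.
Qed.

(** Only paths with increments at most [Z] carry mass. This confines the chain to finitely many
    sites, where the finite Plancherel identity applies. *)
Lemma Ech_ext N Z (F G : seq int -> R) :
  (forall z, z \in ch_jumps c -> `|z| <= Z%:Z) -> (0 < Z)%N ->
  (forall s, size s = N -> all (fun z : int => `|z| <= Z%:Z) s -> F s = G s) ->
  Ech N F = Ech N G.
Proof.
move=> hZ Z0 FG; rewrite /Ech.
have : all (fun z : int => `|z| <= Z%:Z) [::] by [].
have : (size ([::] : seq int) + N = N)%N by [].
move: [::] => s; elim: {1 3 4}N s => [|n IH] s sn sall /=.
  by apply: FG => //; rewrite -sn addn0.
have e z : `|z| <= Z%:Z -> iter n Qop F (rcons s z) = iter n Qop G (rcons s z).
  by move=> zZ; apply: IH; rewrite ?size_rcons ?addSnnS// all_rcons zZ.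
rewrite /Qop /step; rewrite !e//; [|lia..].
congr (_ * _ + _ + _ + _); apply: eq_big_seq => z zJ; rewrite e//; exact: hZ.
Qed.

End Chain.

(** The hypothesis on squares, equivalent to dt (r^2 + i0^2) <= r, says that a free step multiplies
    the energy by at most 1 - dt r = 1 - 2s. Young's inequality with weights 1 - s and s leaves a
    decay 1 - s, because (1 - 2s) / (1 - s) <= 1 - s, and a forcing factor 2 dt / r; dividing by [s]
    gives 4 / r^2. *)
Lemma energy_sum {R : realType} (dt r i0 : R) (C S p q : nat -> R) (n : nat) :
  0 < dt -> 0 < r -> dt * r <= 1 -> (1 - dt * r) ^+ 2 + (dt * i0) ^+ 2 <= 1 - dt * r ->
  C 0%N = 0 -> S 0%N = 0 ->
  (forall k, (k < n)%N -> C k.+1 = (1 - dt * r) * C k - dt * i0 * S k + dt * p k) ->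
  (forall k, (k < n)%N -> S k.+1 = (1 - dt * r) * S k + dt * i0 * C k + dt * q k) ->
  \sum_(k < n) (C k ^+ 2 + S k ^+ 2) <= 4 / r ^+ 2 * \sum_(k < n) (p k ^+ 2 + q k ^+ 2).
Proof.
move=> dt0 r0 dtr phi C0 S0 CS SS.
pose s := dt * r / 2; have s0 : 0 < s by rewrite divr_gt0// mulr_gt0.
have s1 : 0 < 1 - s by rewrite /s; lra.
have young (A B : R) : (A + B) ^+ 2 <= A ^+ 2 / (1 - s) + B ^+ 2 / s.
  rewrite -subr_ge0.
  have -> : A ^+ 2 / (1 - s) + B ^+ 2 / s - (A + B) ^+ 2 =
     (s * A - (1 - s) * B) ^+ 2 / (s * (1 - s)) by field; rewrite !gt_eqF.
  by rewrite divr_ge0 ?sqr_ge0// ltW// mulr_gt0.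
have stepineq k : (k < n)%N -> C k.+1 ^+ 2 + S k.+1 ^+ 2 <=
    (1 - s) * (C k ^+ 2 + S k ^+ 2) + 2 * dt / r * (p k ^+ 2 + q k ^+ 2).
  move=> kn; rewrite CS// SS//.
  set A1 := (1 - dt * r) * C k - _; set A2 := (1 - dt * r) * S k + _.
  apply: (le_trans (lerD (young A1 _) (young A2 _))).
  have -> : A1 ^+ 2 / (1 - s) + (dt * p k) ^+ 2 / s + (A2 ^+ 2 / (1 - s) + (dt * q k) ^+ 2 / s)
     = (A1 ^+ 2 + A2 ^+ 2) / (1 - s) + 2 * dt / r * (p k ^+ 2 + q k ^+ 2).
    by rewrite /s; field; rewrite gt_eqF//=; apply/andP; split; rewrite gt_eqF//; lra.
  rewrite lerD2r ler_pdivrMr//.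
  have -> : A1 ^+ 2 + A2 ^+ 2 =
      ((1 - dt * r) ^+ 2 + (dt * i0) ^+ 2) * (C k ^+ 2 + S k ^+ 2) by rewrite /A1 /A2; ring.
  rewrite mulrAC ler_wpM2r ?addr_ge0 ?sqr_ge0//.
  apply: (le_trans phi); have := sqr_ge0 s; rewrite /s expr2; lra.
have tot m : (m <= n)%N -> s * \sum_(k < m) (C k ^+ 2 + S k ^+ 2) +
    (C m ^+ 2 + S m ^+ 2) <= 2 * dt / r * \sum_(k < m) (p k ^+ 2 + q k ^+ 2).
  elim: m => [|m IH] mn; first by rewrite !big_ord0 C0 S0 !mulr0 expr0n !addr0.
  have := IH (ltnW mn); have := stepineq m mn; rewrite !big_ord_recr/= !mulrDr; lra.
have := tot n (leqnn _).
rewrite [4 / r ^+ 2](_ : _ = s^-1 * (2 * dt / r)); last first.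
  by rewrite /s; field; rewrite !gt_eqF.
set S1 := \sum_(k < n) _; set S2 := \sum_(k < n) _ => hn.
rewrite -(ler_pM2l s0) [leRHS](_ : _ = 2 * dt / r * S2); last by field; rewrite !gt_eqF.
by apply: le_trans hn; rewrite lerDl addr_ge0 ?sqr_ge0.
Qed.

Lemma double_norm_le (l : int) (B : nat) : `|l| <= B%:Z -> 2 * `|l| <= (B.*2.+1)%:Z.
Proof. lia. Qed.

(** * Energy estimate and occupation density of one chain *)

Section Krylov.
Context {R : realType} (c : chain R) (K : R).
Hypothesis (ok : chain_ok c K).

Local Notation h := (ch_h c).
Local Notation dt := (ch_d c).
Local Notation sig := (ch_s c).
Local Notation dr := (ch_dr c).
Local Notation a := (ch_a c).
Local Notation E := (Ech c).

(** Without the state-dependent drift, the generator multiplies the exponential of i th z by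
    [- sym_re + i sym_im]. These are the lattice analogues of Re psi and - Im psi at the frequency
    [th / h]. *)
Definition sym_re (th : R) : R :=
  jumpsum c (fun z => 1 - cos (th * z%:~R)) + sig / h ^+ 2 * (1 - cos th).
Definition sym_im (th : R) : R :=
  jumpsum c (fun z => sin (th * z%:~R)) + dr / h * sin th.

Lemma gen_cos b al th : gen c b (fun z => cos (al + th * z%:~R)) =
  - (cos al * sym_re th) - sin al * (sym_im th + b / h * sin th).
Proof.
rewrite /gen mulr0 mulr1 mulrN1 addr0 !cosD cosN sinN.
have -> : (fun z : int => cos (al + th * z%:~R) - cos al) = fun z : int =>
    (- cos al) * (1 - cos (th * z%:~R)) + (- sin al) * sin (th * z%:~R).
  by apply/funext => z; rewrite cosD; ring.
rewrite jumpsum_lin /sym_re /sym_im.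
by set A := sig / h ^+ 2; rewrite !mulrDl; set B := dr / h; set D := b / h; field.
Qed.

Lemma gen_sin b al th : gen c b (fun z => sin (al + th * z%:~R)) =
  - (sin al * sym_re th) + cos al * (sym_im th + b / h * sin th).
Proof.
have := gen_cos b (al - pi / 2) th; rewrite cosBpihalf sinBpihalf mulNr opprK => <-.
by congr gen; apply/funext => z; rewrite addrAC cosBpihalf.
Qed.

Variable N : nat.
Implicit Types (k : nat) (th : R).

Local Notation J k s := (pos (take k s)).

Let EN := Ech_mean ok N.

(** The first pair is the Fourier transform of the law at step [k]; the pair [acs], [asn], the
    transform of that law times the drift coefficient, is the forcing in its recursion. *)
Definition cs th k : R := E N (fun s => cos (th * (J k s)%:~R)).
Definition sn th k : R := E N (fun s => sin (th * (J k s)%:~R)).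
Definition acs th k : R := E N (fun s => a k (J k s) * cos (th * (J k s)%:~R)).
Definition asn th k : R := E N (fun s => a k (J k s) * sin (th * (J k s)%:~R)).

Lemma cs_rec th k : (k < N)%N -> cs th k.+1 = (1 - dt * sym_re th) * cs th k
  - dt * sym_im th * sn th k - dt * (sin th / h) * asn th k.
Proof.
move=> kN; rewrite /cs /sn /asn -!(meanZ EN) -!(meanB EN).
transitivity (E N (fun s => cos (th * (J k s)%:~R + th * (nth 0 s k)%:~R))).
  by congr (E N _); apply/funext => s; rewrite pos_takeS rmorphD/= mulrDr.
rewrite (markov_step ok (fun s z => cos (th * (pos s)%:~R + th * z%:~R)) kN).
congr (E N _); apply/funext => s; rewrite mulr0 addr0 gen_cos; ring.
Qed.

Lemma sn_rec th k : (k < N)%N -> sn th k.+1 = (1 - dt * sym_re th) * sn th k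
  + dt * sym_im th * cs th k + dt * (sin th / h) * acs th k.
Proof.
move=> kN; rewrite /cs /sn /acs -!(meanZ EN) -!(meanD EN).
transitivity (E N (fun s => sin (th * (J k s)%:~R + th * (nth 0 s k)%:~R))).
  by congr (E N _); apply/funext => s; rewrite pos_takeS rmorphD/= mulrDr.
rewrite (markov_step ok (fun s z => sin (th * (pos s)%:~R + th * z%:~R)) kN).
congr (E N _); apply/funext => s; rewrite mulr0 addr0 gen_sin; ring.
Qed.

Let le1 (F : seq int -> R) : (forall s, `|F s| <= 1) -> (E N F) ^+ 2 <= 1.
Proof.
move=> F1; rewrite -real_normK ?num_real// expr_le1//.
rewrite (le_trans (mean_norm EN _))// -[leRHS](mean1 EN).
exact: (le_mean EN).
Qed.

Lemma cs_le1 th k : cs th k ^+ 2 <= 1. Proof. by apply: le1 => s; exact: cos_max. Qed.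
Lemma sn_le1 th k : sn th k ^+ 2 <= 1. Proof. by apply: le1 => s; exact: sin_max. Qed.

Local Notation tm k := (k%:R * dt).

(** Discrete product rule: the time weight makes the energy vanish at step 0 and adds [cs th k.+1]
    and [sn th k.+1] to the forcing. Both are bounded by 1, which accounts for the term
    [4 * n%:R]. *)
Lemma freq_bound th n : (n <= N)%N -> 0 < sym_re th ->
  dt * (sym_re th ^+ 2 + sym_im th ^+ 2) <= sym_re th ->
  \sum_(k < n) ((tm k * cs th k) ^+ 2 + (tm k * sn th k) ^+ 2) <=
  4 / sym_re th ^+ 2 * (2 * (th / h) ^+ 2 *
    \sum_(k < n) ((tm k * acs th k) ^+ 2 + (tm k * asn th k) ^+ 2) + 4 * n%:R).
Proof.
move=> nN r0 hr; set r := sym_re th in r0 hr *; set i0 := sym_im th in hr *.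
have dt0 := ok_d ok; have h0 := ok_h ok.
have dtr : dt * r <= 1.
  rewrite -(ler_pM2r r0) mul1r (le_trans _ hr)// -mulrA ler_pM2l// -expr2 lerDl sqr_ge0.
  by [].
pose kp := sin th / h.
pose p k := - kp * (tm k * asn th k) + cs th k.+1.
pose q k := kp * (tm k * acs th k) + sn th k.+1.
apply: (@le_trans _ _ (4 / r ^+ 2 * \sum_(k < n) (p k ^+ 2 + q k ^+ 2))).
  apply: (@energy_sum _ dt r i0 (fun k => tm k * cs th k) (fun k => tm k * sn th k) p q) => //; rewrite ?mul0r//.
  - by have := hr; rewrite -(ler_pM2l dt0) !expr2; lra.
  - by move=> k kn; rewrite /p -natr1 cs_rec ?(leq_trans kn)// -/r -/i0 /kp; ring.
  - by move=> k kn; rewrite /q -natr1 sn_rec ?(leq_trans kn)// -/r -/i0 /kp; ring.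
rewrite ler_pM2l; last by rewrite divr_gt0// exprn_gt0.
rewrite mulr_sumr.
have -> : 4 * n%:R = \sum_(k < n) (4 : R) by rewrite sumr_const card_ord mulr_natr.
rewrite -big_split/=; apply: ler_sum => k _.
have kph : kp ^+ 2 <= (th / h) ^+ 2.
  rewrite /kp !expr_div_n ler_pM2r ?invr_gt0 ?exprn_gt0//.
  by rewrite -(real_normK (num_real (sin _))) -(real_normK (num_real th)) lerXn2r ?nnegrE// norm_sin_le.
have h1 := cs_le1 th k.+1; have h2 := sn_le1 th k.+1.
set u := tm k * acs th k; set v := tm k * asn th k.
have sq (x y : R) : (x + y) ^+ 2 <= 2 * x ^+ 2 + 2 * y ^+ 2.
  by have := sqr_ge0 (x - y); rewrite !expr2; lra.
apply: (le_trans (lerD (sq _ _) (sq _ _))).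
rewrite mulNr sqrrN -/u -/v ![(kp * _) ^+ 2]exprMn.
have : kp ^+ 2 * (v ^+ 2 + u ^+ 2) <= (th / h) ^+ 2 * (v ^+ 2 + u ^+ 2).
  by rewrite ler_wpM2r// addr_ge0// sqr_ge0.
lra.
Qed.

Variables (B Z : nat).
Hypothesis (hZ : forall z, z \in ch_jumps c -> `|z| <= Z%:Z) (Z0 : (0 < Z)%N).
Hypothesis (NZB : (N * Z <= B)%N).

Definition pmass k x : R := E N (fun s => (J k s == x)%:R).

Lemma E_pos k (F : int -> R) :
  E N (fun s => F (J k s)) = \sum_(x <- srange B) pmass k x * F x.
Proof.
transitivity (E N (fun s => \sum_(x <- srange B) F x * (J k s == x)%:R)).
  apply: (Ech_ext hZ Z0) => s sN sZ.
  have JB : J k s \in srange B.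
    rewrite mem_srange (le_trans (pos_bound k sZ))// sN; lia.
  rewrite (bigD1_seq _ JB (srange_uniq B))/= eqxx mulr1 big1 ?addr0// => x.
  by rewrite eq_sym => /negbTE ->; rewrite mulr0.
rewrite (mean_sum EN); apply: eq_bigr => x _.
by rewrite (meanZ EN) mulrC.
Qed.

Variables (M0 C0 : R).
Hypotheses (K0 : 0 < K) (M01 : 1 <= M0) (C00 : 0 < C0) (CK : 16 * K ^+ 2 <= C0 ^+ 2).
Hypothesis (Mh : 1 <= B.*2.+1%:R * h).
Hypothesis Hfreq : forall th, `|th| <= pi -> M0 <= `|th / h| ->
  C0 * `|th / h| <= sym_re th /\ dt * (sym_re th ^+ 2 + sym_im th ^+ 2) <= sym_re th.

(** The first term serves the frequencies below [M0], where the transforms are bounded by 1 and the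
    weights by [T0]; the second serves the others. *)
Definition krylov_cst (T0 : R) : R := 2 * T0 ^+ 2 * (1 + M0 ^+ 2) + 32 / C0 ^+ 2.

(** At high frequencies the forcing enters with the factor 8 / C0^2, and [CK] bounds it by 1 / (2
    K^2). Since multiplication by [a] costs at most K^2 in energy, only half of the energy comes
    back. The last factor is summable over the frequencies. *)
Lemma freq_bound_unif th n : (n <= N)%N -> `|th| <= pi ->
  \sum_(k < n) ((tm k * cs th k) ^+ 2 + (tm k * sn th k) ^+ 2) <=
  (2 * K ^+ 2)^-1 * \sum_(k < n) ((tm k * acs th k) ^+ 2 + (tm k * asn th k) ^+ 2)
  + n%:R * krylov_cst (tm n) * (1 + (th / h) ^+ 2)^-1.
Proof.
move=> nN thpi; have dt0 := ok_d ok; have h0 := ok_h ok.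
have A1 : 2 * tm n ^+ 2 * (1 + M0 ^+ 2) <= krylov_cst (tm n).
  by rewrite lerDl divr_ge0// sqr_ge0.
have A2 : 32 / C0 ^+ 2 <= krylov_cst (tm n).
  rewrite /krylov_cst lerDr; apply: mulr_ge0; last by rewrite addr_ge0// sqr_ge0.
  by apply: mulr_ge0 => //; exact: sqr_ge0.
have v0 : 0 <= \sum_(k < n) ((tm k * acs th k) ^+ 2 + (tm k * asn th k) ^+ 2).
  by apply: sumr_ge0 => k _; rewrite addr_ge0 ?sqr_ge0.
have x1 : 0 < 1 + (th / h) ^+ 2 by rewrite ltr_pwDl// sqr_ge0.
have [lowf|highf] := ltP `|th / h| M0.
  apply: ler_wpDl; first by rewrite mulr_ge0// invr_ge0 mulr_ge0// sqr_ge0.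
  set A := krylov_cst (tm n) in A1 *.
  rewrite -mulrA mulr_natl -[n in leRHS]card_ord -sumr_const; apply: ler_sum => k _.
  rewrite ler_pdivlMr// (le_trans _ A1)//.
  have -> : (tm k * cs th k) ^+ 2 + (tm k * sn th k) ^+ 2 =
      tm k ^+ 2 * (cs th k ^+ 2 + sn th k ^+ 2) by ring.
  have : (th / h) ^+ 2 <= M0 ^+ 2.
    have M00 : 0 <= M0 by exact: le_trans ler01 M01.
    by rewrite -(real_normK (num_real (_ / _))) lerXn2r ?nnegrE// ltW.
  have := cs_le1 th k; have := sn_le1 th k => c1 s1 hm.
  have tk : 0 <= tm k ^+ 2 <= tm n ^+ 2.
    rewrite sqr_ge0 lerXn2r ?nnegrE ?mulr_ge0 ?(ltW dt0)//.
    by rewrite ler_pM2r// ler_nat ltnW.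
  have /andP[tk0 tk1] := tk.
  apply: (@le_trans _ _ (2 * tm n ^+ 2 * (1 + (th / h) ^+ 2))); last first.
    apply: ler_wpM2l; last by rewrite lerD2l.
    by apply: mulr_ge0 => //; exact: sqr_ge0.
  apply: ler_wpM2r; first exact: ltW.
  rewrite [leRHS]mulrC; apply: ler_pM => //; first by rewrite addr_ge0// sqr_ge0.
  exact: (lerD s1 c1).
have [hr1 hr2] := Hfreq thpi highf.
set x : R := `|th / h| in highf hr1.
have x0 : 0 < x by apply: lt_le_trans highf; rewrite (lt_le_trans _ M01).
have x2 : (th / h) ^+ 2 = x ^+ 2 by rewrite /x real_normK// num_real.
have r0 : 0 < sym_re th by apply: lt_le_trans hr1; rewrite mulr_gt0.
apply: (le_trans (freq_bound nN r0 hr2)).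
have rr : (C0 * x) ^+ 2 <= sym_re th ^+ 2 by rewrite lerXn2r ?nnegrE ?(ltW r0)// mulr_ge0 ?(ltW C00) ?(ltW x0).
have Cx : 0 < (C0 * x) ^+ 2 by rewrite exprn_gt0// mulr_gt0.
set V := \sum_(k < n) _ in v0 *.
apply: (@le_trans _ _ (4 / (C0 * x) ^+ 2 * (2 * (th / h) ^+ 2 * V + 4 * n%:R))).
  rewrite ler_wpM2r//.
    apply: addr_ge0; apply: mulr_ge0 => //; apply: mulr_ge0 => //; exact: sqr_ge0.
  by rewrite ler_pM2l// lef_pV2// posrE exprn_gt0.
rewrite mulrDr; apply: lerD.
  rewrite mulrA ler_wpM2r// x2 exprMn.
  have -> : 4 / (C0 ^+ 2 * x ^+ 2) * (2 * x ^+ 2) = 8 / C0 ^+ 2.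
    by field; rewrite !gt_eqF.
  have C2 : 0 < C0 ^+ 2 by rewrite exprn_gt0.
  have K2 : 0 < 2 * K ^+ 2 by rewrite mulr_gt0// exprn_gt0.
  rewrite ler_pdivrMr// ler_pdivlMl//.
  by have -> : 2 * K ^+ 2 * 8 = 16 * K ^+ 2 by ring.
have xx : 1 <= x ^+ 2 by apply: exprn_ege1; exact: le_trans M01 highf.
rewrite [leLHS](_ : _ = n%:R * (16 / C0 ^+ 2 / x ^+ 2)); last first.
  by rewrite exprMn; field; rewrite !gt_eqF.
rewrite -[leRHS]mulrA ler_wpM2l//.
apply: (@le_trans _ _ (32 / C0 ^+ 2 / (1 + (th / h) ^+ 2))); last first.
  by rewrite ler_wpM2r// invr_ge0 ltW.
rewrite x2 (_ : 32 / C0 ^+ 2 = 16 / C0 ^+ 2 * 2); last by ring.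
rewrite -[leRHS]mulrA; apply: ler_wpM2l; first by rewrite divr_ge0// sqr_ge0.
rewrite ler_pdivlMr; last by rewrite -x2.
rewrite mulrC ler_pdivrMr; last by rewrite exprn_gt0.
by rewrite mulr2n mulrDl mul1r lerD2r.
Qed.

(** Plancherel is applied to the law, and to the law times [a], whose square norm is at most K^2
    times larger. Summing the frequency bounds gives M S <= M S / 2 plus a remainder, and the first
    term is absorbed. *)
Lemma density_l2 n : (n <= N)%N ->
  \sum_(k < n) \sum_(x <- srange B) (tm k * pmass k x) ^+ 2 <=
  4 * n%:R * krylov_cst (tm n) * h.
Proof.
move=> nN; have dt0 := ok_d ok; have h0 := ok_h ok.
set M : R := B.*2.+1%:R; have M00 : 0 < M by rewrite ltr0n.
set S := \sum_(k < n) _.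
pose theta (l : int) : R := 2 * pi * l%:~R / M.
have S_eq : M * S = \sum_(l <- srange B) \sum_(k < n)
    ((tm k * cs (theta l) k) ^+ 2 + (tm k * sn (theta l) k) ^+ 2).
  rewrite /S mulr_sumr exchange_big/=; apply: eq_bigr => k _.
  rewrite -plancherel; apply: eq_bigr => l _.
  congr (_ ^+ 2 + _ ^+ 2).
    by rewrite /cs (E_pos k (fun x => cos (theta l * x%:~R))) mulr_sumr;
      apply: eq_bigr => x _; rewrite mulrA.
  by rewrite /sn (E_pos k (fun x => sin (theta l * x%:~R))) mulr_sumr;
    apply: eq_bigr => x _; rewrite mulrA.
have V_le : \sum_(l <- srange B) \sum_(k < n)
    ((tm k * acs (theta l) k) ^+ 2 + (tm k * asn (theta l) k) ^+ 2) <= M * (K ^+ 2 * S).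
  rewrite /S !mulr_sumr exchange_big/=; apply: ler_sum => k _.
  have -> : \sum_(l <- srange B) ((tm k * acs (theta l) k) ^+ 2
      + (tm k * asn (theta l) k) ^+ 2) =
      M * \sum_(x <- srange B) (tm k * (pmass k x * a k x)) ^+ 2.
    rewrite -plancherel; apply: eq_bigr => l _.
    congr (_ ^+ 2 + _ ^+ 2).
      rewrite /acs (E_pos k (fun x => a k x * cos (theta l * x%:~R))) mulr_sumr.
      by apply: eq_bigr => x _; rewrite !mulrA.
    rewrite /asn (E_pos k (fun x => a k x * sin (theta l * x%:~R))) mulr_sumr.
    by apply: eq_bigr => x _; rewrite !mulrA.
  rewrite ler_pM2l// mulr_sumr; apply: ler_sum => x _.
  rewrite mulrA exprMn mulrC ler_wpM2r ?sqr_ge0//.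
  rewrite -(real_normK (num_real (a _ _))) lerXn2r ?nnegrE ?(ltW K0)//.
  exact: (ok_a ok).
set A := krylov_cst (tm n).
have A0 : 0 <= A.
  rewrite /A /krylov_cst addr_ge0//; last by rewrite divr_ge0// sqr_ge0.
  apply: mulr_ge0; last by rewrite addr_ge0// sqr_ge0.
  by apply: mulr_ge0 => //; exact: sqr_ge0.
have MS : M * S <= (2 * K ^+ 2)^-1 * (M * (K ^+ 2 * S)) +
    n%:R * A * (1 + 4 / (2 * pi / (M * h))).
  rewrite S_eq; apply: (@le_trans _ _ (\sum_(l <- srange B) (
    (2 * K ^+ 2)^-1 * \sum_(k < n) ((tm k * acs (theta l) k) ^+ 2
      + (tm k * asn (theta l) k) ^+ 2)
    + n%:R * A * (1 + (theta l / h) ^+ 2)^-1))).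
    rewrite big_seq [leRHS]big_seq; apply: ler_sum => l; rewrite mem_srange => lB.
    apply: freq_bound_unif => //.
    rewrite /theta normrM normfV (gtr0_norm M00) ler_pdivrMr// normrM.
    rewrite gtr0_norm ?mulr_gt0 ?pi_gt0// mulrAC [leRHS]mulrC ler_pM2r ?pi_gt0//.
    have : (2 * `|l|)%:~R <= (B.*2.+1)%:Z%:~R :> R.
      by rewrite ler_int; exact: double_norm_le.
    by rewrite intrM intr_norm.
  rewrite big_split/= -!mulr_sumr lerD//.
    by rewrite ler_wpM2l// invr_ge0 mulr_ge0// sqr_ge0.
  rewrite ler_wpM2l ?mulr_ge0//.
  have D0 : 0 < 2 * pi / (M * h) by rewrite divr_gt0 ?mulr_gt0 ?pi_gt0.
  apply: le_trans (sum_lorentz B D0).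
  rewrite le_eqVlt; apply/orP; left; apply/eqP; apply: eq_bigr => l _.
  by rewrite /theta; congr ((1 + _ ^+ 2)^-1); field; rewrite !gt_eqF.
have K2 : K ^+ 2 != 0 by rewrite expf_neq0// gt_eqF.
have : (2 * K ^+ 2)^-1 * (M * (K ^+ 2 * S)) = M * S / 2.
  by field; rewrite gt_eqF.
move: MS => /[swap] ->.
have -> : 4 / (2 * pi / (M * h)) = M * h * (2 / pi).
  have inv4 (p x : R) : p != 0 -> 4 / (2 * p / x) = x * (2 / p).
    by move=> p0; rewrite invf_div; field.
  by apply: inv4; rewrite gt_eqF// pi_gt0.
have p1 : 2 / pi <= 1 :> R by rewrite ler_pdivrMr ?pi_gt0// mul1r pi_ge2.
move=> MS.
(* The frequency spacing is 2 pi / (M h); as the period M h is at least 1, the isolated 1 is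
   absorbed and the bound becomes proportional to M h. *)
have e1 : 1 + M * h * (2 / pi) <= 2 * (M * h).
  have : M * h * (2 / pi) <= M * h * 1 by rewrite ler_wpM2l// mulr_ge0 ?ltW.
  by move: Mh; rewrite -/M; lra.
have e2 : n%:R * A * (1 + M * h * (2 / pi)) <= n%:R * A * (2 * (M * h)).
  by rewrite ler_wpM2l// mulr_ge0.
rewrite -(ler_pM2l M00).
have -> : M * (4 * n%:R * A * h) = 2 * (n%:R * A * (2 * (M * h))) by ring.
by lra.
Qed.

(* The weight [tm k] keeps the energy finite although the chain starts from a
   Dirac mass. *)
Lemma krylov n (f : nat -> int -> R) (eta : R) : (n <= N)%N -> 0 < eta ->
  \sum_(k < n) dt * (tm k * E N (fun s => f k (J k s))) <=
  2 * tm n * krylov_cst (tm n) * eta +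
  dt * h / (2 * eta) * \sum_(k < n) \sum_(x <- srange B) f k x ^+ 2.
Proof.
move=> nN eta0; have dt0 := ok_d ok; have h0 := ok_h ok.
have -> : \sum_(k < n) dt * (tm k * E N (fun s => f k (J k s))) =
    dt * \sum_(k < n) \sum_(x <- srange B) (tm k * pmass k x) * f k x.
  rewrite mulr_sumr; apply: eq_bigr => k _; rewrite E_pos mulr_sumr.
  by congr (_ * _); apply: eq_bigr => x _; rewrite mulrA.
(* The mass of a site is [h] times a density, hence the opposite powers of [h] in the two
   weights. *)
have amgm (x y : R) : x * y <= eta / (2 * h) * x ^+ 2 + h / (2 * eta) * y ^+ 2.
  rewrite -subr_ge0.
  have -> : eta / (2 * h) * x ^+ 2 + h / (2 * eta) * y ^+ 2 - x * y =
     (eta * x - h * y) ^+ 2 / (2 * h * eta) by field; rewrite !gt_eqF.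
  by rewrite divr_ge0 ?sqr_ge0// ltW// !mulr_gt0.
apply: (@le_trans _ _ (dt * (eta / (2 * h) * (4 * n%:R * krylov_cst (tm n) * h) +
    h / (2 * eta) * \sum_(k < n) \sum_(x <- srange B) f k x ^+ 2))); last first.
  rewrite le_eqVlt; apply/orP; left; apply/eqP.
  by field; rewrite !gt_eqF.
rewrite ler_pM2l//.
apply: (@le_trans _ _ (eta / (2 * h) * (\sum_(k < n) \sum_(x <- srange B) (tm k * pmass k x) ^+ 2)
   + h / (2 * eta) * \sum_(k < n) \sum_(x <- srange B) f k x ^+ 2)).
  rewrite !mulr_sumr -big_split/=; apply: ler_sum => k _.
  by rewrite !mulr_sumr -big_split/=; apply: ler_sum => x _; exact: amgm.
by rewrite lerD2r ler_pM2l ?divr_gt0 ?mulr_gt0//; exact: density_l2.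
Qed.

End Krylov.

(** * Approximation of the Levy measure *)

Section TestFunctions.
Context {R : realType}.

(** The Taylor bound stands for two bounded derivatives. One constant serves all clauses, so that
    generator errors are simply proportional to [L]. *)
Record tfun (L : R) (f f' : R -> R) : Prop := TFun {
  tf_bd : forall y, `|f y| <= L;
  tf_lip : forall y z, `|f y - f z| <= L * `|y - z|;
  tf_der : forall y, `|f' y| <= L;
  tf_taylor : forall y z, `|f (y + z) - f y - z * f' y| <= L * z ^+ 2 }.

Lemma tfun_ge0 L f f' : tfun L f f' -> 0 <= L.
Proof. by move=> /tf_bd/(_ 0); apply: le_trans. Qed.

Lemma lip_continuous (L : R) (f : R -> R) : (forall y z, `|f y - f z| <= L * `|y - z|) ->
  continuous f.
Proof.
move=> fL x; apply/cvgrPdist_lt => e e0.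
have L1 : 0 < `|L| + 1 by rewrite ltr_wpDl.
near=> y; apply: (le_lt_trans (fL x y)).
apply: (@le_lt_trans _ _ ((`|L| + 1) * `|x - y|)).
  by rewrite ler_wpM2r// (le_trans (ler_norm _))// lerDl.
rewrite -ltr_pdivlMl// mulrC; near: y.
by apply: (@cvgr_dist_lt _ _ _ (nbhs x) _ id x) => //; rewrite divr_gt0.
Unshelve. all: by end_near. Qed.

Lemma tfun_measurable L f f' : tfun L f f' -> measurable_fun setT f.
Proof. by move=> /tf_lip/lip_continuous/continuous_measurable_fun. Qed.

Lemma tfun_cos (xi : R) : tfun (1 + 2 * xi ^+ 2) (fun y => cos (xi * y))
  (fun y => - (xi * sin (xi * y))).
Proof.
have x1 : `|xi| <= 1 + 2 * xi ^+ 2.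
  have := sqr_ge0 `|xi|; have := sqr_ge0 (`|xi| - 1); rewrite -[xi ^+ 2]real_normK ?num_real// sqrrB; lra.
have x2 := sqr_ge0 xi.
split => [y|y z|y|y z].
- by rewrite (le_trans (cos_max _))//; lra.
- by rewrite (le_trans (norm_cosB_le _ _))// -mulrBr normrM ler_wpM2r.
- rewrite normrN normrM (le_trans _ x1)//.
  by rewrite -[leRHS]mulr1 ler_wpM2l// sin_max.
- have := cos_taylor (xi * y) (xi * z).
  move=> h; rewrite mulrDr mulrN opprK [z * _]mulrCA mulrA; apply: (le_trans h).
  by rewrite exprMn mulrA; apply: ler_wpM2r; rewrite ?sqr_ge0//; lra.
Qed.

Lemma tfun_sin (xi : R) : tfun (1 + 2 * xi ^+ 2) (fun y => sin (xi * y))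
  (fun y => xi * cos (xi * y)).
Proof.
have x1 : `|xi| <= 1 + 2 * xi ^+ 2.
  have := sqr_ge0 `|xi|; have := sqr_ge0 (`|xi| - 1); rewrite -[xi ^+ 2]real_normK ?num_real// sqrrB; lra.
have x2 := sqr_ge0 xi.
split => [y|y z|y|y z].
- by rewrite (le_trans (sin_max _))//; lra.
- by rewrite (le_trans (norm_sinB_le _ _))// -mulrBr normrM ler_wpM2r.
- rewrite normrM (le_trans _ x1)//.
  by rewrite -[leRHS]mulr1 ler_wpM2l// cos_max.
- have := sin_taylor (xi * y) (xi * z).
  move=> h; rewrite mulrDr [z * _]mulrCA mulrA; apply: (le_trans h).
  by rewrite exprMn mulrA; apply: ler_wpM2r; rewrite ?sqr_ge0//; lra.
Qed.

(** A smooth bounded substitute for the square: it vanishes only at 0, is comparable to the minimum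
    of 1 and y^2, and the generators act on it without any moment condition on the jumps. *)
Definition gfun (y : R) : R := y ^+ 2 / (1 + y ^+ 2).
Definition gfun' (y : R) : R := 2 * y / (1 + y ^+ 2) ^+ 2.

Let den_gt0 (y : R) : 0 < 1 + y ^+ 2. Proof. by rewrite ltr_pwDl// sqr_ge0. Qed.

Lemma gfun_ge0 y : 0 <= gfun y.
Proof. by rewrite divr_ge0 ?sqr_ge0// ltW. Qed.

Lemma gfun_le1 y : gfun y <= 1.
Proof. by rewrite ler_pdivrMr// mul1r lerDr. Qed.

Lemma gfun0 : gfun 0 = 0.
Proof. by rewrite /gfun expr0n mul0r. Qed.

Lemma gfun_lb (l y : R) : 0 <= l -> l <= 1 -> l <= `|y| -> l ^+ 2 / 2 <= gfun y.
Proof.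
move=> l0 l1 ly; rewrite /gfun ler_pdivlMr//.
have : l ^+ 2 <= y ^+ 2.
  by rewrite -[y ^+ 2]real_normK ?num_real// lerXn2r ?nnegrE// (le_trans l0).
have : l ^+ 2 <= 1 by rewrite expr_le1.
have := sqr_ge0 y; have := sqr_ge0 l; set A := l ^+ 2; set B := y ^+ 2; nra.
Qed.

Lemma gfun_lip y z : `|gfun y - gfun z| <= `|y - z|.
Proof.
have -> : gfun y - gfun z = (y - z) * ((y + z) / ((1 + y ^+ 2) * (1 + z ^+ 2))).
  by rewrite /gfun; field; rewrite !gt_eqF.
rewrite normrM ler_piMr// normrM normfV [X in _ / X]gtr0_norm ?mulr_gt0// ler_pdivrMr ?mulr_gt0// mul1r.
rewrite ler_norml; have := sqr_ge0 (1 + y); have := sqr_ge0 (1 - y); have := sqr_ge0 (1 + z).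
have := sqr_ge0 (1 - z); have := sqr_ge0 (y * z); have := sqr_ge0 y; have := sqr_ge0 z; rewrite !expr2 => *; apply/andP; split; lra.
Qed.

Lemma gfun'_le1 y : `|gfun' y| <= 1.
Proof.
rewrite /gfun' normrM normfV [X in _ / X]gtr0_norm ?exprn_gt0// ler_pdivrMr ?exprn_gt0// mul1r.
rewrite ler_norml; have := sqr_ge0 (1 + y); have := sqr_ge0 (1 - y).
have := sqr_ge0 (y * y); have := sqr_ge0 y; rewrite !expr2 => *; apply/andP; split; lra.
Qed.

Lemma gfun_taylor y z : `|gfun (y + z) - gfun y - z * gfun' y| <= 4 * z ^+ 2.
Proof.
set A := 1 + y ^+ 2; set B := 1 + (y + z) ^+ 2.
have A0 : 0 < A by exact: den_gt0. have B0 : 0 < B by exact: den_gt0.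
have -> : gfun (y + z) - gfun y - z * gfun' y =
    z ^+ 2 * ((A - 2 * y * y - 2 * y * (y + z)) / (A ^+ 2 * B)).
  by rewrite /gfun /gfun' -/A -/B /A /B; field; rewrite !gt_eqF.
rewrite normrM ger0_norm ?sqr_ge0// mulrC ler_wpM2r ?sqr_ge0//.
rewrite normrM normfV [X in _ / X]gtr0_norm ?mulr_gt0 ?exprn_gt0// ler_pdivrMr ?mulr_gt0 ?exprn_gt0//.
have A1 : 1 <= A by rewrite lerDl sqr_ge0.
have B1 : 1 <= B by rewrite lerDl sqr_ge0.
have hA : `|A - 2 * y * y| <= A.
  by rewrite ler_norml /A expr2; have := sqr_ge0 y; rewrite expr2 => *; apply/andP; split; lra.
have hy : `|2 * y| <= A.
  rewrite ler_norml /A; have := sqr_ge0 (1 + y); have := sqr_ge0 (1 - y).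
  by rewrite !expr2 => *; apply/andP; split; lra.
have hyz : `|y + z| <= B.
  rewrite ler_norml /B; have := sqr_ge0 (1 + (y + z)); have := sqr_ge0 (1 - (y + z)).
  by have := sqr_ge0 (y + z); rewrite !expr2 => *; apply/andP; split; lra.
apply: (le_trans (ler_normB _ _)); rewrite [X in _ + X]normrM.
apply: (le_trans (lerD hA (ler_pM _ _ hy hyz))) => //.
have AB : A <= A * B by rewrite -[leLHS]mulr1 ler_pM2l.
have AAB : A * B <= A ^+ 2 * B by rewrite ler_pM2r// expr2 -[leLHS]mulr1 ler_pM2l.
by lra.
Qed.

Lemma tfun_gfun (r : R) : 1 <= r ->
  tfun 4 (fun y => gfun (y / r)) (fun y => gfun' (y / r) / r).
Proof.
move=> r1; have r0 : 0 < r by exact: lt_le_trans r1.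
have ri : r^-1 <= 1 by rewrite invf_le1.
split => [y|y z|y|y z].
- by rewrite ger0_norm ?gfun_ge0// (le_trans (gfun_le1 _))// ler1n.
- rewrite (le_trans (gfun_lip _ _))// -mulrBl normrM mulrC.
  by rewrite ler_wpM2r// ger0_norm ?invr_ge0 ?(ltW r0)// (le_trans ri)// ler1n.
- rewrite normrM [`|r^-1|]ger0_norm ?invr_ge0 ?(ltW r0)//.
  apply: (@le_trans _ _ 1); last by rewrite ler1n.
  rewrite -[leRHS]mulr1; apply: ler_pM => //; first by rewrite invr_ge0 ltW.
  exact: gfun'_le1.
- have := gfun_taylor (y / r) (z / r); rewrite -mulrDl mulrAC -mulrA => /le_trans; apply.
  rewrite ler_wpM2l// expr_div_n -[leRHS]mulr1 ler_wpM2l ?sqr_ge0//.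
  by rewrite -exprVn expr_le1// invr_ge0 ltW.
Qed.

End TestFunctions.

Section LevyApprox.
Context {R : realType} (nu : {measure set R -> \bar R}).
Hypothesis Hnu : levy_measure nu.

(** Jump part of the Levy generator, with compensated small jumps. On cosines and sines at 0 it
    produces the exponent. *)
Definition levy_int (f f' : R -> R) (x : R) : R :=
  Rintegral nu setT (fun z => f (x + z) - f x - z * f' x * (`|z| < 1 :> R)%:R).

Definition qfun (z : R) : R := Num.min 1 (z ^+ 2).

Lemma qfun_ge0 z : 0 <= qfun z.
Proof. by rewrite le_min ler01 sqr_ge0. Qed.

Lemma qfun_small z : `|z| < 1 -> qfun z = z ^+ 2.
Proof.
move=> z1; apply/min_idPr; rewrite -[z ^+ 2]real_normK ?num_real//.
by rewrite expr_le1// ltW.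
Qed.

Lemma qfun_big z : 1 <= `|z| -> qfun z = 1.
Proof.
by move=> z1; apply/min_idPl; rewrite -[z ^+ 2]real_normK ?num_real// exprn_ege1.
Qed.

Let mq : measurable_fun setT qfun.
Proof.
by apply: measurable_minr; [exact: measurable_cst|exact: measurable_funX].
Qed.

Lemma qfun_integrable : nu.-integrable setT (EFin \o qfun).
Proof.
apply/integrableP; split; first exact/measurable_EFinP.
under eq_integral do rewrite /= ger0_norm ?qfun_ge0//.
exact: Hnu.2.
Qed.

Lemma measurable_small : measurable [set z : R | `|z| < 1].
Proof.
have -> : [set z : R | `|z| < 1] = `](-1), 1[%classic.
  by apply/seteqP; split => z /=; rewrite in_itv/= ltr_norml.
exact: measurable_itv.
Qed.

Lemma measurable_trunc : measurable_fun setT (fun z : R => (`|z| < 1 :> R)%:R : R).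
Proof.
have -> : (fun z : R => (`|z| < 1 :> R)%:R : R) = \1_[set z : R | `|z| < 1].
  apply/funext => z; rewrite indicE; congr (nat_of_bool _)%:R.
  by apply/idP/idP; rewrite inE.
by apply: measurable_indic; exact: measurable_small.
Qed.

Section OneFunction.
Variables (L : R) (f f' : R -> R) (x : R).
Hypothesis tf : tfun L f f'.

Let F z := f (x + z) - f x - z * f' x * (`|z| < 1 :> R)%:R.

Lemma levy_meas : measurable_fun setT F.
Proof.
apply: measurable_funB; last first.
  apply: measurable_funM; last exact: measurable_trunc.
  by apply: measurable_funM; [exact: measurable_id|exact: measurable_cst].
apply: measurable_funB; last exact: measurable_cst.
apply: (measurableT_comp (tfun_measurable tf)).
by apply: measurable_funD; [exact: measurable_cst|exact: measurable_id].
Qed.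

Lemma levy_dom z : `|F z| <= 2 * L * qfun z.
Proof.
have L0 := tfun_ge0 tf; rewrite /F; have [z1|z1] := ltP `|z| 1.
  rewrite mulr1 (le_trans (tf_taylor tf _ _))// qfun_small//.
  by rewrite ler_wpM2r ?sqr_ge0//; lra.
rewrite mulr0 subr0 qfun_big// mulr1 (le_trans (ler_normB _ _))//.
by have := tf_bd tf (x + z); have := tf_bd tf x; lra.
Qed.

Lemma levy_integrable : nu.-integrable setT (EFin \o F).
Proof.
apply: (@le_integrable _ _ _ _ _ measurableT _ (EFin \o (fun z => 2 * L * qfun z))).
- by apply/measurable_EFinP; exact: levy_meas.
- move=> z _; rewrite /= lee_fin [leRHS]ger0_norm; first exact: levy_dom.
  by rewrite mulr_ge0 ?qfun_ge0// mulr_ge0// (tfun_ge0 tf).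
- have := integrableZl measurableT (2 * L) qfun_integrable.
  by apply: eq_integrable => // z _ /=; rewrite EFinM.
Qed.

Lemma levy_int_le (b : R -> R) : nu.-integrable setT (EFin \o b) ->
  (forall z, `|F z| <= b z) -> `|levy_int f f' x| <= Rintegral nu setT b.
Proof.
move=> ib Fb; apply: (le_trans (le_normr_Rintegral measurableT levy_integrable)).
apply: le_Rintegral => //; exact: (integrable_norm levy_integrable).
Qed.

Lemma levy_int_bound : `|levy_int f f' x| <= 2 * L * Rintegral nu setT qfun.
Proof.
rewrite -RintegralZl//; last exact: qfun_integrable.
apply: levy_int_le; last exact: levy_dom.
have := integrableZl measurableT (2 * L) qfun_integrable.
by apply: eq_integrable => // z _ /=; rewrite EFinM.
Qed.

End OneFunction.

(** Away from 0 and infinity [qfun] is bounded below, so [nu] is finite there; the region grows to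
    the complement of 0. *)
Let Dn (n : nat) : set R := [set z | n.+1%:R^-1 < `|z| /\ `|z| <= n.+1%:R].

Let mDn n : measurable (Dn n).
Proof.
have -> : Dn n = [set z | `|z| <= n.+1%:R] `\` [set z | `|z| <= n.+1%:R^-1].
  apply/seteqP; split => z /=; rewrite /Dn /= ltNge; first by move=> [/negP h1 h2].
  by move=> [h1 /negP h2].
have mle (r : R) : measurable [set z : R | `|z| <= r].
  have -> : [set z : R | `|z| <= r] = `[- r, r]%classic.
    by apply/seteqP; split => z /=; rewrite in_itv/= ler_norml.
  exact: measurable_itv.
exact: measurableD.
Qed.

Let Dlow n z : Dn n z -> (n.+1%:R^-1) ^+ 2 <= qfun z.
Proof.
move=> [h1 _]; have i0 : 0 <= n.+1%:R^-1 :> R by rewrite invr_ge0.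
have i1 : n.+1%:R^-1 <= 1 :> R by rewrite invf_le1 ?ltr0n// ler1n.
rewrite le_min expr_le1// i1/= -[z ^+ 2]real_normK ?num_real//.
by rewrite lerXn2r ?nnegrE// ltW.
Qed.

Let Dn_lty n : (nu (Dn n) < +oo)%E.
Proof.
have c0 : 0 < (n.+1%:R^-1 : R) ^+ 2 by rewrite exprn_gt0// invr_gt0.
rewrite -(@lte_pmul2l _ ((n.+1%:R^-1 : R) ^+ 2)%:E) ?lte_fin// ?ltey//.
rewrite gt0_muley ?lte_fin//.
rewrite -integral_cst//; apply: (le_lt_trans _ Hnu.2).
apply: (@le_trans _ _ (\int[nu]_(z in Dn n) (qfun z)%:E)%E).
  apply: ge0_le_integral => //.
  - by move=> z _; rewrite lee_fin sqr_ge0.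
  - by apply/measurable_EFinP; exact: measurable_funTS.
  - by move=> z Dz; rewrite lee_fin; exact: Dlow.
apply: ge0_subset_integral => //.
- by apply/measurable_EFinP.
- by move=> z _; rewrite lee_fin qfun_ge0.
Qed.

Let tail_cvg : Rintegral nu setT (fun z => qfun z * \1_(~` Dn n) z) @[n --> \oo] --> (0 : R).
Proof.
have [|||||_ _ h] := @dominated_convergence _ _ _ nu setT measurableT
  (fun n z => (qfun z * \1_(~` Dn n) z)%:E) (fun=> 0%:E) (EFin \o qfun) _ _ _ _ _.
- move=> n; apply/measurable_EFinP; apply: measurable_funM => //.
  by apply: measurable_indic; exact: measurableC.
- exact: measurable_cst.
- apply: aeW => z _; apply: cvg_EFin; first by near=> n.
  have [->|z0] := eqVneq z 0.
    rewrite (_ : _ \o _ = fun=> 0); first exact: cvg_cst.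
    by apply/funext => n /=; rewrite qfun_small ?normr0// expr0n mul0r.
  have z1 : 0 < `|z| by rewrite normr_gt0.
  apply: cvg_near_cst; near=> n; rewrite /= indicE memNset ?mulr0// /Dn/= => hn.
  apply: hn; split.
    rewrite invf_plt ?posrE// (lt_le_trans (truncnS_gt _))// ler_nat ltnS.
    by near: n; exact: nbhs_infty_ge.
  rewrite (le_trans (ltW (truncnS_gt _)))// ler_nat ltnS.
  by near: n; exact: nbhs_infty_ge.
- exact: qfun_integrable.
- apply: aeW => z n _; rewrite /= lee_fin normrM ger0_norm ?qfun_ge0//.
  by rewrite ler_piMr ?qfun_ge0// indicE; case: (_ \in _); rewrite ?normr1 ?normr0.
rewrite integral0 in h; move: h => /fine_cvgP[_]; exact.
Unshelve. all: by end_near. Qed.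

(* [m] accounts for the compensation of the small jumps, which the approximating
   jumps do not have. *)
Lemma levy_approx (e : R) : 0 < e -> exists m h0 : R, 0 < h0 /\
  forall h : R, 0 < h -> h < h0 -> exists (jumps : seq int) (w : int -> R),
    (forall z, 0 <= w z) /\
    forall L f f' x, tfun L f f' ->
      `|\sum_(z <- jumps) w z * (f (x + h * z%:~R) - f x) - m * f' x
        - levy_int f f' x| <= e * L.
Proof.
move=> e0; have e4 : 0 < e / 4 by rewrite divr_gt0.
have [n hn] : exists n, Rintegral nu setT (fun z => qfun z * \1_(~` Dn n) z) <= e / 4.
  have /cvgrPdist_le/(_ _ e4)[n _ h] := tail_cvg.
  by exists n; have := h n (leqnn _); rewrite sub0r normrN; apply: le_trans; exact: ler_norm.
pose D := Dn n; have mD : measurable D by exact: mDn.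
have D_lty : (nu D < +oo)%E by exact: Dn_lty.
pose V : R := fine (nu D); have V0 : 0 <= V by rewrite fine_ge0.
pose m := Rintegral nu D (fun z => z * (`|z| < 1 :> R)%:R).
have V1 : 0 < 2 * (V + 1) by rewrite mulr_gt0// ltr_wpDl.
(* Rounding moves a jump by at most [h] and costs at most L h V; half of the error is spent there,
   and the tail e / 4 times the domination constant 2 L is the other half. *)
exists m, (e / (2 * (V + 1))); split; first by rewrite divr_gt0.
move=> h h0 hlt.
have hV : h * V <= e / 2.
  move: hlt; rewrite ltr_pdivlMr// => hlt.
  have : h * V <= h * (V + 1) by rewrite ler_pM2l// lerDl.
  by move: hlt; rewrite mulrCA; lra.
(* The successor of the truncation bounds |z / h|, and the floor may exceed that by 1 in absolute
   value, hence [.+2]. *)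
pose J := (Num.truncn (n.+1%:R / h : R)).+2.
pose C (j : int) : set R := `[j%:~R * h, (j + 1)%:~R * h[%classic.
have mC j : measurable (C j) by exact: measurable_itv.
pose w j : R := fine (nu (C j `&` D)).
exists (srange J), w; split; first by move=> z; rewrite fine_ge0.
move=> L f f' x tf; have L0 := tfun_ge0 tf.
have mf := tfun_measurable tf.
pose F1 z := f (x + z) - f x.
have bF1 : bmf D F1.
  split.
    apply: measurable_funB; last exact: measurable_cst.
    apply: (measurableT_comp mf); apply: measurable_funTS.
    by apply: measurable_funD; [exact: measurable_cst|exact: measurable_id].
  exists (L + L) => z _; rewrite (le_trans (ler_normB _ _))// lerD//; exact: (tf_bd tf).
pose G z : R := \sum_(j <- srange J) (f (x + h * j%:~R) - f x) * \1_(C j) z.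
have bG1 j : bmf D (fun z => (f (x + h * j%:~R) - f x) * \1_(C j) z).
  by apply: bmfM; [exact: bmf_cst|exact: bmf_indic].
have bG : bmf D G by exact: bmf_sum.
have SE : \sum_(z <- srange J) w z * (f (x + h * z%:~R) - f x) = Rintegral nu D G.
  rewrite bint_sum//; apply: eq_bigr => j _.
  have -> := bintZ mD D_lty (f (x + h * j%:~R) - f x) (bmf_indic mD (mC j)).
  by rewrite [LHS]mulrC; congr (_ * _); symmetry; exact: bint_indic.
have Gle z : D z -> `|G z - F1 z| <= L * h.
  move=> [_ zn]; pose j := Num.floor (z / h).
  have j1 : j%:~R * h <= z by rewrite -ler_pdivlMr// floor_le.
  have j2 : z < (j + 1)%:~R * h by rewrite -ltr_pdivrMr// floorD1_gt.
  have jJ : j \in srange J.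
    rewrite mem_srange -(ler_int R) intr_norm /J.
    have zh : `|z / h| <= n.+1%:R / h.
      by rewrite normrM normfV (gtr0_norm h0) ler_pM2r ?invr_gt0.
    have tr : n.+1%:R / h <= (Num.truncn (n.+1%:R / h : R)).+1%:R by rewrite ltW// truncnS_gt.
    have jl : j%:~R <= z / h by rewrite floor_le.
    have jr : z / h < j%:~R + 1 by have := floorD1_gt (z / h); rewrite intrD.
    rewrite -[(Posz _)%:~R]/(_.+2%:R) -natr1; move: zh; rewrite ler_norml => /andP[z1 z2].
    by rewrite ler_norml; apply/andP; split; lra.
  rewrite /G (bigD1_seq _ jJ (srange_uniq J))/= big1 ?addr0; last first.
    move=> i ij; rewrite indicE memNset ?mulr0// /C/= in_itv/= => /andP[i1 i2].
    move/eqP: ij; apply; apply/eqP; rewrite eq_le; apply/andP; split.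
      have : i%:~R * h < (j + 1)%:~R * h by exact: le_lt_trans j2.
      by rewrite ltr_pM2r// ltr_int ltzD1.
    have : j%:~R * h < (i + 1)%:~R * h by exact: le_lt_trans i2.
    by rewrite ltr_pM2r// ltr_int ltzD1.
  rewrite indicE mem_set ?mulr1; last by rewrite /C/= in_itv/= j1 j2.
  rewrite /F1 opprB addrA subrK (le_trans (tf_lip tf _ _))// ler_wpM2l//.
  rewrite opprD addrACA subrr add0r ler_norml.
  move: j1 j2; rewrite intrD mulrDl mul1r mulrC => j1 j2.
  by apply/andP; split; lra.
have iF := levy_integrable x tf; have dF := levy_dom x tf; have mF := levy_meas x tf.
rewrite /levy_int; set F := (fun z => f (x + z) - f x - _) in iF dF mF *.
have -> : Rintegral nu setT F = Rintegral nu D F + Rintegral nu (~` D) F.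
  rewrite -{1}(setUv D) Rintegral_setU//; first exact: measurableC.
    by rewrite setUv.
  by rewrite /disj_set setICr.
have bt : bmf D (fun z => z * (`|z| < 1 :> R)%:R).
  split.
    apply: measurable_funTS; apply: measurable_funM; last exact: measurable_trunc.
    exact: measurable_id.
  exists 1 => z _; have [z1|z1] := ltP `|z| 1; rewrite ?mulr1 ?mulr0 ?normr0//.
  exact: ltW.
have -> : Rintegral nu D F = Rintegral nu D F1 - f' x * m.
  rewrite -bintZ// -bintB//; last by apply: bmfM; [exact: bmf_cst|].
  by apply: eq_Rintegral => z _; rewrite /F /F1; ring.
rewrite SE.
have -> : Rintegral nu D G - m * f' x - (Rintegral nu D F1 - f' x * m + Rintegral nu (~` D) F)
  = Rintegral nu D (fun z => G z - F1 z) - Rintegral nu (~` D) F by rewrite bintB//; ring.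
apply: (le_trans (ler_normB _ _)).
have e1 : `|Rintegral nu D (fun z => G z - F1 z)| <= e / 2 * L.
  apply: (le_trans (bint_bound mD D_lty (bmfB bG bF1) Gle)).
  by rewrite -mulrA mulrC ler_wpM2r.
have mDc : measurable (~` D) by exact: measurableC.
have iFc : nu.-integrable (~` D) (EFin \o F).
  exact: (integrableS measurableT).
have iqc : nu.-integrable (~` D) (EFin \o qfun).
  exact: (integrableS measurableT _ _ qfun_integrable).
have e2 : `|Rintegral nu (~` D) F| <= e / 2 * L.
  apply: (le_trans (le_normr_Rintegral mDc iFc)).
  apply: (@le_trans _ _ (Rintegral nu (~` D) (fun z => 2 * L * qfun z))).
    apply: le_Rintegral => //; first exact: integrable_norm.
      have := integrableZl mDc (2 * L) iqc.
      by apply: eq_integrable => // z _ /=; rewrite EFinM.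
    by move=> z _; exact: dF.
  rewrite RintegralZl// Rintegral_mkcond.
  have -> : Rintegral nu setT (qfun \_ (~` D)) =
      Rintegral nu setT (fun z => qfun z * \1_(~` Dn n) z).
    apply: eq_Rintegral => z _; rewrite indicE -/D /patch.
    by case: ifPn; rewrite ?mulr1 ?mulr0.
  have : 2 * L * Rintegral nu setT (fun z => qfun z * \1_(~` Dn n) z) <= 2 * L * (e / 4).
    by rewrite ler_wpM2l// mulr_ge0.
  by lra.
by have := lerD e1 e2; lra.
Qed.

(** Source of tightness: at a large scale [r] the jump part acts weakly on the rescaled [gfun],
    uniformly in the starting point. Small jumps are bounded by the Taylor estimate, large ones by
    the Lipschitz estimate or by 1; dominated convergence with [qfun] concludes. *)
Lemma levy_int_tail (e : R) : 0 < e -> exists r : R, [/\ 1 <= r, r^-1 <= e &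
  forall x, `|levy_int (fun y => gfun (y / r)) (fun y => gfun' (y / r) / r) x| <= e].
Proof.
move=> e0; pose r (n : nat) : R := n.+1%:R.
have r1 n : 1 <= r n by rewrite ler1n.
have r0 n : 0 < r n by rewrite ltr0n.
have ri n : (r n)^-1 <= 1 by rewrite invf_le1.
pose k (n : nat) (z : R) : R := Num.min 1 (`|z| / r n + (r n)^-1 ^+ 2).
have k0 n z : 0 <= k n z.
  by rewrite le_min ler01/= addr_ge0 ?sqr_ge0// divr_ge0// ltW.
have k1 n z : k n z <= 1 by rewrite ge_min lexx.
pose b (n : nat) (z : R) : R := 4 * (qfun z * k n z).
have mk n : measurable_fun setT (k n).
  apply: measurable_minr; first exact: measurable_cst.
  apply: measurable_funD; last exact: measurable_cst.
  apply: measurable_funM; last exact: measurable_cst.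
  exact: normr_measurable.
have mqk n : measurable_fun setT (fun z => qfun z * k n z) by exact: measurable_funM.
have iqk n : nu.-integrable setT (EFin \o (fun z => qfun z * k n z)).
  apply: (@le_integrable _ _ _ _ _ measurableT _ (EFin \o qfun)).
  - exact/measurable_EFinP.
  - move=> z _; rewrite /= lee_fin !ger0_norm ?mulr_ge0 ?qfun_ge0//.
    by rewrite ler_piMr ?qfun_ge0.
  - exact: qfun_integrable.
have ib n : nu.-integrable setT (EFin \o b n).
  have := integrableZl measurableT 4 (iqk n).
  by apply: eq_integrable => // z _ /=; rewrite EFinM.
have inv_cvg0 : (fun m : nat => m.+1%:R^-1 : R) @ \oo --> (0 : R) by exact: cvg_harmonic.
have kcvg z : k n z @[n --> \oo] --> (0 : R).
  have h : (`|z| / r n + (r n)^-1 ^+ 2) @[n --> \oo] --> (0 : R).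
    rewrite [X in _ --> X](_ : _ = `|z| * 0 + 0 ^+ 2); last by rewrite mulr0 expr0n addr0.
    apply: cvgD; first by apply: cvgM; [exact: cvg_cst|exact: inv_cvg0].
    under eq_fun do rewrite expr2; rewrite expr2.
    by apply: cvgM; exact: inv_cvg0.
  apply: (squeeze_cvgr _ (cvg_cst 0) h).
  by near=> n; rewrite k0/= ge_min lexx orbT.
have cvg0 : Rintegral nu setT (b n) @[n --> \oo] --> (0 : R).
  have [|||||_ _ h] := @dominated_convergence _ _ _ nu setT measurableT
    (fun n z => (qfun z * k n z)%:E) (fun=> 0%:E) (EFin \o qfun) _ _ _ _ _.
  - by move=> n; exact/measurable_EFinP.
  - exact: measurable_cst.
  - apply: aeW => z _; apply: cvg_EFin; first by near=> n.
    rewrite -[X in _ --> X](mulr0 (qfun z)).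
    by apply: cvgM; [exact: cvg_cst|exact: kcvg].
  - exact: qfun_integrable.
  - apply: aeW => z n _; rewrite /= lee_fin ger0_norm ?mulr_ge0 ?qfun_ge0//.
    by rewrite ler_piMr ?qfun_ge0.
  rewrite integral0 in h; move: h => /fine_cvgP[_ h].
  rewrite -[X in _ --> X](mulr0 4) /b.
  under eq_fun do rewrite RintegralZl//.
  by apply: cvgM; [exact: cvg_cst|exact: h].
have [n [hn1 hn2]] : exists n, (r n)^-1 <= e /\ Rintegral nu setT (b n) <= e.
  have /cvgrPdist_le/(_ _ e0) [N1 _ h1] := cvg0.
  have /cvgrPdist_le/(_ _ e0) [N2 _ h2] := inv_cvg0.
  exists (maxn N1 N2); split.
    have := h2 (maxn N1 N2) (leq_maxr _ _); rewrite sub0r normrN; apply: le_trans.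
    exact: ler_norm.
  have := h1 (maxn N1 N2) (leq_maxl _ _); rewrite sub0r normrN; apply: le_trans.
  exact: ler_norm.
exists (r n); split => // x; apply: le_trans hn2.
apply: (levy_int_le (tfun_gfun (r1 n)) (ib n)) => z.
have [z1|z1] := ltP `|z| 1.
  rewrite mulr1 /b qfun_small//.
  have := gfun_taylor (x / r n) (z / r n); rewrite -mulrDl [z / r n * _]mulrAC -mulrA.
  move/le_trans; apply; rewrite ler_wpM2l// expr_div_n -exprVn ler_wpM2l ?sqr_ge0//.
  have h1 : 0 <= (r n)^-1 by rewrite invr_ge0 ltW.
  by rewrite le_min expr_le1// ri/= lerDr divr_ge0// ltW.
rewrite mulr0 subr0 /b qfun_big// mul1r.
apply: (@le_trans _ _ (k n z)); last by rewrite -[leLHS]mul1r ler_wpM2r// ler1n.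
rewrite le_min; apply/andP; split.
  have := gfun_ge0 ((x + z) / r n); have := gfun_ge0 (x / r n).
  have := gfun_le1 ((x + z) / r n); have := gfun_le1 (x / r n).
  by rewrite ler_norml => *; apply/andP; split; lra.
apply: (le_trans (gfun_lip _ _)); rewrite -mulrBl addrAC subrr add0r normrM normfV.
by rewrite (gtr0_norm (r0 n)) lerDl sqr_ge0.
Unshelve. all: by end_near. Qed.

Lemma levy_int_cos (xi : R) :
  levy_int (fun y => cos (xi * y)) (fun y => - (xi * sin (xi * y))) 0 = - psi_re nu xi.
Proof.
have h (z : R) : cos (xi * (0 + z)) - cos (xi * 0)
    - z * - (xi * sin (xi * 0)) * (`|z| < 1 :> R)%:R = - 1 * (1 - cos (xi * z)).
  by rewrite !mulr0 sin0 cos0 add0r mulr0 oppr0; ring.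
rewrite /psi_re -[RHS]mulN1r -RintegralZl//.
  by apply: eq_Rintegral => z _; rewrite h.
have := levy_integrable 0 (tfun_cos xi).
move=> /(integrableZl measurableT (-1)); apply: eq_integrable => // z _ /=.
by rewrite h -!EFinM; congr EFin; ring.
Qed.

Lemma levy_int_sin (c xi : R) :
  levy_int (fun y => sin (xi * y)) (fun y => xi * cos (xi * y)) 0 - c * xi =
  - psi_im c nu xi.
Proof.
have h (z : R) : sin (xi * (0 + z)) - sin (xi * 0)
    - z * (xi * cos (xi * 0)) * (`|z| < 1 :> R)%:R =
   - 1 * (- sin (xi * z) + xi * z * (`|z| < 1 :> R)%:R).
  by rewrite !mulr0 sin0 cos0 add0r mulr1; ring.
rewrite /psi_im opprD addrC; congr (_ + _).
rewrite -[RHS]mulN1r -RintegralZl//.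
  by apply: eq_Rintegral => z _; rewrite h.
have := levy_integrable 0 (tfun_sin xi).
move=> /(integrableZl measurableT (-1)); apply: eq_integrable => // z _ /=.
by rewrite h -!EFinM; congr EFin; ring.
Qed.

End LevyApprox.

(** * The approximating chains *)

Section Cells.
Context {R : realType}.

(* Lebesgue measure, transported to the canonical measurable structure of [R] *)
Definition leb : set R -> \bar R := @lebesgue_measure R.
Let leb0 : leb set0 = 0%E.
Proof. exact: (@measure0 _ _ _ (@lebesgue_measure R)). Qed.
Let leb_ge0 A : (0 <= leb A)%E.
Proof. exact: (@measure_ge0 _ _ _ (@lebesgue_measure R)). Qed.
Let leb_sa : semi_sigma_additive leb.
Proof. exact: (@measure_semi_sigma_additive _ _ _ (@lebesgue_measure R)). Qed.
HB.instance Definition _ := isMeasure.Build _ _ _ leb leb0 leb_ge0 leb_sa.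
Let leb_sf : sigma_finite setT leb.
Proof. exact: (@sigma_finiteT _ _ _ (@lebesgue_measure R)). Qed.
HB.instance Definition _ := Measure_isSigmaFinite.Build _ _ _ leb leb_sf.

Definition lam2 : {measure set (R * R) -> \bar R} := (leb \x leb)%E.

Lemma lam2_itv (a b c d : R) : a < b -> c < d ->
  lam2 (`[a, b[%classic `*` `[c, d[%classic) = ((b - a) * (d - c))%:E.
Proof.
move=> ab cd.
transitivity (leb `[a, b[%classic * leb `[c, d[%classic)%E.
  exact: product_measure1E.
rewrite /leb.
by rewrite !lebesgue_measure_itv/= !lte_fin ab cd -!EFinD -EFinM.
Qed.

Variables (x0 h dt : R).
Hypotheses (h0 : 0 < h) (dt0 : 0 < dt).

Definition cell (k : nat) (j : int) : set (R * R) :=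
  `[k%:R * dt, k.+1%:R * dt[%classic `*` `[x0 + h * j%:~R, x0 + h * (j + 1)%:~R[%classic.

Definition avg (f : R * R -> R) (k : nat) (j : int) : R :=
  (dt * h)^-1 * Rintegral lam2 (cell k j) f.

Lemma measurable_cell k j : measurable (cell k j).
Proof. by apply: measurableX; exact: measurable_itv. Qed.

Lemma lam2_cell k j : lam2 (cell k j) = (dt * h)%:E.
Proof.
rewrite /cell lam2_itv.
- by congr EFin; rewrite -natr1 intrD; ring.
- by rewrite ltr_pM2r// ltr_nat ltnSn.
- by rewrite ltrD2l ltr_pM2l// ltr_int ltzD1 lexx.
Qed.

Let cell_lty k j : (lam2 (cell k j) < +oo)%E.
Proof. by rewrite lam2_cell ltry. Qed.

Let dh0 : 0 < dt * h. Proof. by rewrite mulr_gt0. Qed.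

Lemma avgD f g k j : bmf (cell k j) f -> bmf (cell k j) g ->
  avg (fun p => f p + g p) k j = avg f k j + avg g k j.
Proof.
by move=> bf bg; rewrite /avg bintD// ?mulrDr//; exact: measurable_cell.
Qed.

Lemma avgB f g k j : bmf (cell k j) f -> bmf (cell k j) g ->
  avg (fun p => f p - g p) k j = avg f k j - avg g k j.
Proof.
by move=> bf bg; rewrite /avg bintB// ?mulrBr//; exact: measurable_cell.
Qed.

Lemma avgZ r f k j : bmf (cell k j) f -> avg (fun p => r * f p) k j = r * avg f k j.
Proof.
by move=> bf; rewrite /avg bintZ// 1?mulrCA//; exact: measurable_cell.
Qed.

Lemma avg_le f g k j : bmf (cell k j) f -> bmf (cell k j) g ->
  (forall p, cell k j p -> f p <= g p) -> avg f k j <= avg g k j.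
Proof.
move=> bf bg fg; rewrite /avg ler_pM2l ?invr_gt0//.
by apply: bint_le => //; exact: measurable_cell.
Qed.

Lemma avg_cst r k j : avg (fun=> r) k j = r.
Proof.
rewrite /avg Rintegral_cst; last exact: measurable_cell.
have -> : fine (lam2 (cell k j)) = dt * h by rewrite lam2_cell.
by rewrite mulrCA mulVf ?mulr1// gt_eqF.
Qed.

Lemma avg_dist f g (e : R) k j : bmf (cell k j) f -> bmf (cell k j) g ->
  (forall p, cell k j p -> `|f p - g p| <= e) -> `|avg f k j - avg g k j| <= e.
Proof.
move=> bf bg fg; rewrite -avgB// ler_norml -{1}(avg_cst (- e) k j) -{2}(avg_cst e k j).
have bc r : bmf (cell k j) (fun=> r) by exact: bmf_cst.
have b := bmfB bf bg.
by apply/andP; split; apply: avg_le => // p /fg; rewrite ler_norml => /andP[].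
Qed.

Lemma avg_norm_le f (e : R) k j : bmf (cell k j) f ->
  (forall p, cell k j p -> `|f p| <= e) -> `|avg f k j| <= e.
Proof.
move=> bf fe; rewrite -[avg f k j]subr0 -(avg_cst 0 k j).
by apply: avg_dist => //; [exact: bmf_cst|move=> p /fe; rewrite subr0].
Qed.

Lemma avg_indic A k j : measurable A ->
  avg (\1_A) k j = (dt * h)^-1 * fine (lam2 (A `&` cell k j)).
Proof. by move=> mA; rewrite /avg bint_indic//; exact: measurable_cell. Qed.

Lemma avg_indic_itv A k j : measurable A -> 0 <= avg (\1_A) k j <= 1.
Proof.
move=> mA; have bA : bmf (cell k j) (\1_A : R * R -> R).
  by apply: bmf_indic => //; exact: measurable_cell.
apply/andP; split.
  rewrite -[leLHS](avg_cst 0 k j); apply: avg_le => //; exact: bmf_cst.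
by rewrite -[leRHS](avg_cst 1 k j); apply: avg_le => //; exact: bmf_cst.
Qed.

Lemma cell_inj k j k' j' p : cell k j p -> cell k' j' p -> k = k' /\ j = j'.
Proof.
rewrite /cell /= !in_itv/= => -[/andP[a1 a2] /andP[b1 b2]] [/andP[c1 c2] /andP[d1 d2]].
have e (u v : nat) (h1 : u%:R * dt <= p.1) (h2 : p.1 < v.+1%:R * dt) : (u <= v)%N.
  by move: (le_lt_trans h1 h2); rewrite ltr_pM2r// ltr_nat ltnS.
have f (u v : int) (h1 : x0 + h * u%:~R <= p.2) (h2 : p.2 < x0 + h * (v + 1)%:~R) : u <= v.
  by move: (le_lt_trans h1 h2); rewrite ltrD2l ltr_pM2l// ltr_int ltzD1.
split; apply/eqP; first by rewrite eqn_leq !e.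
by rewrite eq_le !f.
Qed.

(** Each average times [dt * h] is the measure of the part of [A] inside one cell, and the cells are
    disjoint. *)
Lemma sum_avg_indic (A : set (R * R)) n (s : seq int) : measurable A -> (lam2 A < +oo)%E ->
  uniq s -> dt * h * \sum_(k < n) \sum_(j <- s) avg (\1_A) k j <= fine (lam2 A).
Proof.
move=> mA Alty us.
have bc k j : bmf A (\1_(cell k j) : R * R -> R).
  by apply: bmf_indic => //; exact: measurable_cell.
have -> : dt * h * \sum_(k < n) \sum_(j <- s) avg (\1_A) k j =
   Rintegral lam2 A (fun p => \sum_(k < n) \sum_(j <- s) \1_(cell k j) p).
  rewrite bint_sum//; last by move=> k; exact: bmf_sum.
  rewrite mulr_sumr; apply: eq_bigr => k _; rewrite bint_sum// mulr_sumr.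
  apply: eq_bigr => j _; rewrite avg_indic// mulrA divff ?mul1r ?gt_eqF//.
  by rewrite bint_indic ?[A `&` _]setIC//; exact: measurable_cell.
rewrite -[leRHS]mul1r -Rintegral_cst//; apply: bint_le => //.
- by apply: bmf_sum => k; exact: bmf_sum.
- exact: bmf_cst.
move=> p _; have [[k0 [j0 c0]]|nc] := pselect (exists k j, cell k j p); last first.
  rewrite big1 ?ler01// => k _; rewrite big1// => j _; rewrite indicE memNset// => ckj.
  by apply: nc; exists k, j.
have zero k j : (k, j) != (k0, j0) -> \1_(cell k j) p = 0 :> R.
  move=> kj; rewrite indicE memNset// => /cell_inj/(_ c0)[e1 e2].
  by move: kj; rewrite e1 e2 eqxx.
have row (k : nat) : \sum_(j <- s) \1_(cell k j) p <= (k == k0)%:R :> R.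
  have [->|kk] := eqVneq k k0; last first.
    by rewrite big1// => j _; apply: zero; rewrite xpair_eqE (negbTE kk).
  have [js|js] := boolP (j0 \in s); last first.
    rewrite big1_seq ?ler01// => j /andP[_ jin]; apply: zero.
    rewrite xpair_eqE eqxx/=; apply: contraNneq js => <-; exact: jin.
  rewrite (bigD1_seq _ js us)/= big1 ?addr0; last first.
    by move=> j jj; apply: zero; rewrite xpair_eqE eqxx.
  by rewrite indicE mem_set.
apply: (@le_trans _ _ (\sum_(k < n) (k == k0 :> nat)%:R)).
  by apply: ler_sum => k _; exact: row.
have [kn|kn] := ltnP k0 n.
  rewrite (bigD1 (Ordinal kn))//= eqxx big1 ?addr0// => k.
  by rewrite -val_eqE/= => /negbTE ->.
by rewrite big1 ?ler01// => k _; rewrite ltn_eqF// (leq_trans (ltn_ord k)).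
Qed.

End Cells.

(** Three errors of size e L: the jumps by assumption, the noise because its variance is at most
    [e], and the centred difference because it misses the derivative by at most h L. The compensator
    [m] is cancelled by the choice of [ch_dr]. *)
Lemma gen_error {R : realType} (c : chain R) (K e m cc b L x I : R) (f f' : R -> R) :
  chain_ok c K -> `|b| <= K -> ch_dr c = - cc - m -> 0 <= e ->
  ch_s c <= e -> ch_h c * (`|ch_dr c| + K) <= e -> tfun L f f' ->
  `|\sum_(z <- ch_jumps c) ch_w c z * (f (x + ch_h c * z%:~R) - f x) - m * f' x - I| <= e * L ->
  `|gen c b (fun z => f (x + ch_h c * z%:~R)) - ((b - cc) * f' x + I)| <= 3 * e * L.
Proof.
move=> ok bK drE e0 se he tf jumpe.
have h0 := ok_h ok; have L0 := tfun_ge0 tf; have s0 := ok_s ok.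
set h := ch_h c in he jumpe h0 *; set sig := ch_s c in se s0 *.
have t1 := tf_taylor tf x h; have t2 := tf_taylor tf x (- h).
rewrite sqrrN in t2.
set A := f (x + h) in t1; set B := f (x + - h) in t2.
rewrite /gen /jumpsum -/h -/sig !mulr0 mulr1 mulrN1 !addr0 -/A -/B.
set S := \sum_(z <- _) _ in jumpe *.
set dr := ch_dr c in drE he *.
have -> : S + sig / h ^+ 2 / 2 * (A + B - 2 * f x) + (dr + b) / h / 2 * (A - B)
   - ((b - cc) * f' x + I) =
   (S - m * f' x - I) + sig / h ^+ 2 / 2 * (A + B - 2 * f x)
   + (dr + b) * ((A - B) / h / 2 - f' x).
  by rewrite [in RHS]mulrBr drE; ring.
have e2 : `|sig / h ^+ 2 / 2 * (A + B - 2 * f x)| <= e * L.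
  have ab : `|A + B - 2 * f x| <= 2 * (L * h ^+ 2).
    have -> : A + B - 2 * f x = (A - f x - h * f' x) + (B - f x - - h * f' x) by ring.
    by rewrite (le_trans (ler_normD _ _))//; lra.
  rewrite normrM ger0_norm; last by rewrite !divr_ge0 ?sqr_ge0 ?ltW.
  apply: (@le_trans _ _ (sig / h ^+ 2 / 2 * (2 * (L * h ^+ 2)))).
    by rewrite ler_wpM2l// !divr_ge0 ?sqr_ge0 ?ltW.
  rewrite [leLHS](_ : _ = sig * L); last by field; rewrite gt_eqF.
  by rewrite ler_wpM2r.
have e3 : `|(dr + b) * ((A - B) / h / 2 - f' x)| <= e * L.
  have ab : `|(A - B) / h / 2 - f' x| <= h * L.
    have -> : (A - B) / h / 2 - f' x =
      ((A - f x - h * f' x) - (B - f x - - h * f' x)) / (2 * h) by field; rewrite gt_eqF.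
    rewrite normrM normfV [X in _ / X]gtr0_norm ?mulr_gt0// ler_pdivrMr ?mulr_gt0//.
    rewrite (le_trans (ler_normB _ _))//.
    have -> : h * L * (2 * h) = L * h ^+ 2 + L * h ^+ 2 by ring.
    exact: lerD.
  rewrite normrM; apply: (@le_trans _ _ ((`|dr| + K) * (h * L))).
    apply: ler_pM => //; rewrite (le_trans (ler_normD _ _))//.
    by rewrite lerD2l.
  rewrite mulrA ler_wpM2r//; by rewrite mulrC.
apply: (le_trans (ler_normD _ _)).
apply: (le_trans (lerD (ler_normD _ _) (lexx _))).
by lra.
Qed.

Section ChainSeq.
Context {R : realType} (c : R) (nu : {measure set R -> \bar R}) (a : R -> R -> R).
Variables (K x0 : R).
Hypothesis Hnu : levy_measure nu.
Hypothesis Hpsi : forall e : R, 0 < e -> exists M : R, forall xi : R, M < `|xi| ->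
      0 < psi_re nu xi /\ `|xi| <= e * psi_re nu xi.
Hypothesis ma : measurable_fun [set p : R * R | 0 <= p.1] (fun p : R * R => a p.1 p.2).
Hypothesis K0 : 0 < K.
Hypothesis aK : forall t x, 0 <= t -> `|a t x| <= K.

Lemma bmf_a_cell h dt k j : 0 < dt ->
  bmf (cell x0 h dt k j) (fun p => a p.1 p.2).
Proof.
move=> dt0.
have cell_pos p : cell x0 h dt k j p -> 0 <= p.1.
  rewrite /cell /= in_itv/= => -[/andP[+ _] _]; apply: le_trans.
  by rewrite mulr_ge0// ltW.
split; last by exists K => p /cell_pos; exact: aK.
apply: measurable_funS ma => //.
have -> : [set p : R * R | 0 <= p.1] = `[0, +oo[%classic `*` setT.
  by apply/seteqP; split => p /=; rewrite in_itv/= andbT; tauto.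
by apply: measurableX => //; exact: measurable_itv.
Qed.

(** The least value compatible with [CK], that is 16 K^2 <= C0^2. *)
Let C0 : R := 4 * K.

(** The factor 2 leaves room for the approximation of [nu]: the symbol of the jumps may fall short
    of [psi_re] by 1, and [1 <= C0 * M0] makes this loss at most half of the lower bound. *)
Definition M0_spec (M0 : R) := 1 <= M0 /\ 1 <= C0 * M0 /\
  forall xi, M0 <= `|xi| -> 2 * C0 * `|xi| <= psi_re nu xi.

Let C00 : 0 < C0. Proof. by rewrite mulr_gt0. Qed.

Lemma M0_exists : exists M0, M0_spec M0.
Proof.
have [|M hM] := Hpsi (e := (2 * C0)^-1); first by rewrite invr_gt0 mulr_gt0.
exists (1 + C0^-1 + `|M|); have i0 : 0 < C0^-1 by rewrite invr_gt0.
have m0 := normr_ge0 M; have Ml := ler_norm M.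
split; first lra; split.
  rewrite 2!mulrDr mulr1 divff ?gt_eqF//.
  by have := mulr_ge0 (ltW C00) m0; have := ltW C00; lra.
move=> xi hxi; have [|p0 p1] := hM xi; first by lra.
by rewrite -ler_pdivlMl// mulr_gt0.
Qed.

(** All that is used later about the [n]-th chain. Its horizon of [n.+1 * 2 ^ l] steps is the time n
    + 1, so every fixed time is eventually covered; steps are dyadic so that dyadic times become
    exact step indices. *)
Record good_level (M0 : R) (n : nat) (ch : chain R) (l : nat) : Prop := GoodLevel {
  gl_ok : chain_ok ch K;
  gl_d : ch_d ch = 2 ^- l;
  gl_l : (n <= l)%N;
  gl_a : ch_a ch = avg x0 (ch_h ch) (ch_d ch) (fun p => a p.1 p.2);
  gl_h : ch_h ch <= n.+1%:R^-1;
  gl_gen : forall b L f f' x, `|b| <= K -> tfun L f f' ->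
    `|gen ch b (fun z => f (x + ch_h ch * z%:~R)) -
      ((b - c) * f' x + levy_int nu f f' x)| <= 3 * n.+1%:R^-1 * L;
  gl_krylov : exists B, forall k (f : nat -> int -> R) (eta : R), (k <= n.+1 * 2 ^ l)%N ->
    0 < eta ->
    \sum_(i < k) ch_d ch * (i%:R * ch_d ch *
        Ech ch (n.+1 * 2 ^ l) (fun s => f i (pos (take i s)))) <=
    2 * (k%:R * ch_d ch) * krylov_cst M0 C0 (k%:R * ch_d ch) * eta +
    ch_d ch * ch_h ch / (2 * eta) * \sum_(i < k) \sum_(x <- srange B) f i x ^+ 2 }.

Lemma jumps_bound (s : seq int) : exists Z : nat, (0 < Z)%N /\ forall z, z \in s -> `|z| <= Z%:Z.
Proof.
elim: s => [|z s [Z [Z0 hZ]]]; first by exists 1%N.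
exists (Z + absz z)%N; split; first lia.
by move=> y; rewrite inE => /predU1P[->|/hZ]; lia.
Qed.

(** The order of the choices matters: the variance [sig], the frequency [Xi] beyond which the noise
    alone suffices, the accuracy [e'] of the jumps below [Xi], then the mesh, and finally the time
    step. *)
Lemma chain_level (M0 : R) n : M0_spec M0 -> exists ch l, good_level M0 n ch l.
Proof.
move=> [M01 [CM0 hM0]].
pose e : R := n.+1%:R^-1; have e0 : 0 < e by rewrite invr_gt0.
have e1 : e <= 1 by rewrite invf_le1 ?ltr0n// ler1n.
pose sig := e.
(* Solves (sig / 128) x^2 = C0 x: by [one_sub_cos_ge] the noise contributes at least the left
   side. *)
pose Xi : R := 128 * C0 / sig.
have Xi0 : 0 < Xi by rewrite divr_gt0// mulr_gt0.
pose e' : R := e / (1 + 2 * Xi ^+ 2).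
have Xi2 : 0 < 1 + 2 * Xi ^+ 2 by rewrite ltr_pwDl// mulr_ge0// sqr_ge0.
have e'0 : 0 < e' by rewrite divr_gt0.
have e'e : e' <= e by rewrite ler_pdivrMr// ler_peMr ?(ltW e0)// lerDl mulr_ge0// sqr_ge0.
have [m [h1 [h10 happ]]] := levy_approx Hnu e'0.
pose dr := - c - m.
have drK : 0 < `|dr| + K by rewrite ltr_wpDl.
pose h := Num.min (h1 / 2) (Num.min e (sig / (`|dr| + K))).
have h0 : 0 < h by rewrite /h !lt_min e0 !divr_gt0.
have hh1 : h < h1 by rewrite (@le_lt_trans _ _ (h1 / 2)) ?ge_min ?lexx//; lra.
have he : h <= e by rewrite !ge_min lexx orbT.
have hdr : h * (`|dr| + K) <= sig.
  by rewrite -ler_pdivlMr// !ge_min lexx !orbT.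
have [jumps [w [w0 hw]]] := happ h h0 hh1.
pose Lam := \sum_(z <- jumps) w z * 1.
have Lam0 : 0 <= Lam by apply: sumr_ge0 => z _; rewrite mulr_ge0.
pose b1 := 2 * Lam + 2 * (sig / h ^+ 2).
pose b2 := Lam + `|dr| / h.
have s2 : 0 < sig / h ^+ 2 by rewrite divr_gt0 ?exprn_gt0.
have b10 : 0 <= b1 by rewrite /b1; lra.
have b20 : 0 <= b2 by rewrite /b2 addr_ge0// divr_ge0// ltW.
(* Bounds both the total rate and the squared modulus of the symbol. It does not involve the time
   step, which is chosen afterwards. *)
pose Q := b1 ^+ 2 + b2 ^+ 2 + (Lam + sig / h ^+ 2) + 1.
have Q0 : 0 < Q by rewrite /Q; have := sqr_ge0 b1; have := sqr_ge0 b2; lra.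
pose l := (n + Num.truncn Q)%N.+1.
have lQ : 2 ^- l * Q <= 1.
  rewrite mulrC ler_pdivrMr ?exprn_gt0// mul1r.
  apply: (le_trans (ltW (truncnS_gt Q))).
  apply: (@le_trans _ _ l%:R); first by rewrite ler_nat ltnS leq_addl.
  by rewrite -natrX ler_nat ltnW// ltn_expl.
have l0 : 0 < 2 ^- l :> R by rewrite invr_gt0 exprn_gt0.
pose ch := Chain jumps w h (2 ^- l) sig dr (avg x0 h (2 ^- l) (fun p => a p.1 p.2)).
have part (u : R) : 0 <= u -> u <= Q -> 2 ^- l * u <= 1.
  by move=> u0 uQ; apply: le_trans lQ; rewrite ler_pM2l.
have ok : chain_ok ch K.
  split => //=.
    by apply: part; rewrite /Q /jumpsum/= -/Lam; have := sqr_ge0 b1; have := sqr_ge0 b2; lra.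
  move=> k x; apply: avg_norm_le => //; first exact: bmf_a_cell.
  move=> p; rewrite /cell /= in_itv/= => -[/andP[+ _] _] => hp; apply: aK.
  by apply: le_trans hp; rewrite mulr_ge0// ltW.
exists ch, l; split => //=.
- by rewrite /l ltnW// ltnS leq_addr.
- move=> b L f f' x bK tf; apply: (gen_error ok bK (m := m)) => //=.
  apply: (le_trans (hw _ _ _ x tf)); rewrite ler_wpM2r//; exact: tfun_ge0 tf.
- have [Z [Z0 hZ]] := jumps_bound jumps.
  set N := (n.+1 * 2 ^ l)%N.
  pose B := (N * Z + Num.truncn (h^-1))%N.+1.
  exists B => k f eta kN eta0.
  apply: (@krylov _ ch K ok N B Z) => //.
  + by rewrite /B ltnW// ltnS leq_addr.
  + by rewrite /C0 exprMn -natrX.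
  + rewrite /=; have := truncnS_gt (h^-1) => hi.
    have : h^-1 <= B.*2.+1%:R.
      apply: (le_trans (ltW hi)); rewrite ler_nat ltnS.
      by rewrite -addnn (leq_trans _ (leq_addr _ _))// /B leqW// leq_addl.
    by rewrite -ler_pdivrMr// mul1r.
  + move=> th thpi; rewrite /= => hth.
    set x := `|th / h| in hth *.
    have jre : jumpsum ch (fun z => 1 - cos (th * z%:~R)) =
       - \sum_(z <- jumps) w z * (cos (th / h * (0 + h * z%:~R)) - cos (th / h * 0)).
      rewrite /jumpsum -sumrN; apply: eq_bigr => z _.
      by rewrite add0r mulr0 cos0 mulrA divfK ?gt_eqF// -mulrN opprB.
    have jlow : psi_re nu (th / h) - e' * (1 + 2 * (th / h) ^+ 2)
        <= jumpsum ch (fun z => 1 - cos (th * z%:~R)).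
      have := hw _ _ _ 0 (tfun_cos (th / h)).
      rewrite levy_int_cos// !mulr0 sin0 mulr0 oppr0 mulr0 subr0 opprK.
      rewrite jre ler_norml => /andP[_]; rewrite mulr0; lra.
    have j0 : 0 <= jumpsum ch (fun z => 1 - cos (th * z%:~R)).
      by apply: (jumpsum_ge0 ok) => z; rewrite subr_ge0 cos_le1.
    have s0 : 0 <= sig / h ^+ 2 * (1 - cos th).
      by rewrite mulr_ge0 ?(ltW s2)// subr_ge0 cos_le1.
    have x0' : 0 < x by apply: lt_le_trans hth; exact: lt_le_trans M01.
    have xE : (th / h) ^+ 2 = x ^+ 2 by rewrite /x real_normK// num_real.
    have low : C0 * x <= sym_re ch th.
      (* Up to [Xi] the jumps reproduce [psi_re] up to an error at most 1; beyond, the noise takes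
         over. *)
      rewrite /sym_re /=; have [xX|xX] := leP x Xi.
        apply: (@le_trans _ _ (jumpsum ch (fun z => 1 - cos (th * z%:~R)))); last by rewrite lerDl.
        apply: le_trans jlow; have := hM0 _ hth; rewrite -/x xE => hp.
        have C1 : 1 <= C0 * x by apply: (le_trans CM0); rewrite ler_pM2l.
        have : e' * (1 + 2 * x ^+ 2) <= 1.
          rewrite /e' mulrAC ler_pdivrMr// mul1r.
          have : x ^+ 2 <= Xi ^+ 2 by rewrite lerXn2r ?nnegrE ?(ltW x0') ?(ltW Xi0).
          move=> xX2; apply: (@le_trans _ _ (1 * (1 + 2 * x ^+ 2))).
            by rewrite ler_wpM2r// addr_ge0// mulr_ge0// sqr_ge0.
          by lra.
        by lra.
      apply: (@le_trans _ _ (sig / h ^+ 2 * (1 - cos th))); last by rewrite lerDr.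
      apply: (@le_trans _ _ (sig / h ^+ 2 * (th ^+ 2 / 128))); last first.
        by rewrite ler_pM2l//; exact: one_sub_cos_ge.
      have -> : sig / h ^+ 2 * (th ^+ 2 / 128) = sig / 128 * x ^+ 2.
        by rewrite -xE; field; rewrite gt_eqF.
      rewrite expr2 mulrA ler_pM2r//.
      have : sig / 128 * Xi <= sig / 128 * x by rewrite ler_pM2l ?divr_gt0// ltW.
      by rewrite [sig / 128 * Xi](_ : _ = C0)// /Xi; field; rewrite gt_eqF.
    split => //.
    (* Since the real part is at least 1, it is enough that the time step bounds the left side by
       1. *)
    have re1 : 1 <= sym_re ch th.
      apply: le_trans low; apply: (le_trans CM0); rewrite ler_pM2l//.
    have re0 : 0 <= sym_re ch th by exact: le_trans ler01 re1.
    apply: le_trans re1; apply: part; first by rewrite addr_ge0 ?sqr_ge0.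
    have hre : sym_re ch th <= b1.
      rewrite /sym_re /b1 /=; apply: lerD.
        rewrite /jumpsum /Lam mulr_sumr; apply: ler_sum => z _.
        rewrite mulr1 mulrC ler_wpM2r// => //=.
        by have := cos_geN1 (th * z%:~R); lra.
      by rewrite mulrC ler_pM2r//; have := cos_geN1 th; lra.
    have him : `|sym_im ch th| <= b2.
      rewrite /sym_im /b2 /= (le_trans (ler_normD _ _))//; apply: lerD.
        rewrite /jumpsum /Lam (le_trans (ler_norm_sum _ _ _))//; apply: ler_sum => z _.
        by rewrite normrM ger0_norm// ler_wpM2l// sin_max.
      rewrite normrM normrM normfV (gtr0_norm h0) -[leRHS]mulr1 ler_wpM2l ?sin_max//.
      by rewrite divr_ge0// ltW.
    have q1 : sym_re ch th ^+ 2 <= b1 ^+ 2.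
      by rewrite lerXn2r ?nnegrE.
    have q2 : sym_im ch th ^+ 2 <= b2 ^+ 2.
      by rewrite -[sym_im ch th ^+ 2]real_normK ?num_real// lerXn2r ?nnegrE.
    by rewrite /Q; lra.
Qed.

Lemma chain_seq : exists M0, M0_spec M0 /\ exists (ch : nat -> chain R) (l : nat -> nat),
  forall n, good_level M0 n (ch n) (l n).
Proof.
have [M0 h] := M0_exists; exists M0; split => //.
have /choice[f hf] : forall n, exists p : chain R * nat, good_level M0 n p.1 p.2.
  by move=> n; have [ch [l hl]] := chain_level n h; exists (ch, l).
by exists (fun n => (f n).1), (fun n => (f n).2).
Qed.

End ChainSeq.

Lemma expR_sub1 {R : realType} (x : R) : 0 <= x -> x <= 1 -> `|expR x * (1 - x) - 1| <= x ^+ 2.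
Proof.
move=> x0 x1; have h1 := expR_ge1Dx (- x); have h2 := expR_ge1Dx x.
have e0 := expR_gt0 x.
have h3 : expR x * (1 - x) <= 1.
  by rewrite -[leRHS](expRxMexpNx_1 x) ler_pM2l.
have h4 : (1 + x) * (1 - x) <= expR x * (1 - x) by rewrite ler_wpM2r ?subr_ge0.
by rewrite ler_norml expr2; apply/andP; split; lra.
Qed.

Lemma genZ {R : realType} (ch : chain R) b x (G : int -> R) :
  gen ch b (fun z => x * G z) = x * gen ch b G.
Proof.
rewrite /gen.
have -> : (fun z => x * G z - x * G 0) = (fun z => x * (G z - G 0)).
  by apply/funext => z; rewrite mulrBr.
by rewrite jumpsumZ; ring.
Qed.

(** * Increments and characteristic functions of one chain *)

Section Level.
Context {R : realType} (ch : chain R) (K x0 : R) (N : nat).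
Hypothesis ok : chain_ok ch K.

Local Notation h := (ch_h ch).
Local Notation dt := (ch_d ch).
Local Notation a := (ch_a ch).
Local Notation E := (Ech ch N).

Let EN := Ech_mean ok N.

Definition adapted_at (k : nat) (A : Type) (F : seq int -> A) := forall s, F s = F (take k s).

Lemma adapted_atW k k' (A : Type) (F : seq int -> A) : (k <= k')%N ->
  adapted_at k F -> adapted_at k' F.
Proof. by move=> kk aF s; rewrite aF [RHS]aF take_takel. Qed.

Definition Xch (k : nat) (s : seq int) : R := x0 + h * (pos (take k s))%:~R.

Definition Ach (k : nat) (s : seq int) : R := \sum_(i < k) dt * a i (pos (take i s)).

Lemma Xch_adapted k : adapted_at k (Xch k).
Proof. by move=> s; rewrite /Xch take_takel. Qed.

Lemma Ach_adapted k : adapted_at k (Ach k).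
Proof.
move=> s; rewrite /Ach; apply: eq_bigr => i _.
by rewrite take_takel// ltnW.
Qed.

Lemma XchS k s : Xch k.+1 s = Xch k s + h * (nth 0 s k)%:~R.
Proof. by rewrite /Xch pos_takeS rmorphD/= mulrDr addrA. Qed.

Lemma AchS k s : Ach k.+1 s = Ach k s + dt * a k (pos (take k s)).
Proof. by rewrite /Ach big_ord_recr. Qed.

Lemma Ach_bound k k' s : (k <= k')%N -> `|Ach k' s - Ach k s| <= (k' - k)%:R * dt * K.
Proof.
move=> kk; rewrite -(subnKC kk) addKn; elim: (k' - k)%N => [|j IH].
  by rewrite addn0 subrr normr0 !mul0r.
rewrite addnS AchS addrAC (le_trans (ler_normD _ _))// -natr1 !mulrDl mul1r lerD//.
rewrite normrM gtr0_norm ?(ok_d ok)// ler_pM2l ?(ok_d ok)//; exact: (ok_a ok).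
Qed.

Lemma step_mean_eq k (F : seq int -> R) (f : seq int -> R -> R) : (k < N)%N ->
  adapted_at k F -> adapted_at k f ->
  E (fun s => F s * f s (h * (nth 0 s k)%:~R)) =
  E (fun s => F s * (f s 0 + dt * gen ch (a k (pos (take k s))) (fun z => f s (h * z%:~R)))).
Proof.
move=> kN aF af.
transitivity (E (fun s => (fun s' z => F s' * f s' (h * z%:~R)) (take k s) (nth 0 s k))).
  by congr (E _); apply/funext => s /=; rewrite -aF -(af s).
rewrite (markov_step ok (fun s' z => F s' * f s' (h * z%:~R)) kN).
congr (E _); apply/funext => s /=; rewrite [in RHS]aF [in RHS]af mulr0 genZ; ring.
Qed.

(** Discrete Dynkin formula with a uniform bound on the generator. The weight [F], known at step
    [k], makes it conditional; later [F] is itself a function of an earlier increment. *)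
Lemma mean_increment k j (F : seq int -> R) (f : R -> R) (G : R) : (k + j <= N)%N ->
  adapted_at k F -> (forall s, 0 <= F s) ->
  (forall y b, `|b| <= K -> gen ch b (fun z => f (y + h * z%:~R)) <= G) ->
  E (fun s => F s * f (Xch (k + j) s - Xch k s)) <= E F * (f 0 + j%:R * dt * G).
Proof.
move=> + aF F0 fG; elim: j => [|j IH] kN.
  rewrite addn0 !mul0r addr0; under eq_fun do rewrite subrr mulrC.
  by rewrite (meanZ EN) mulrC.
have kN' : (k + j < N)%N by rewrite -addnS.
have := step_mean_eq (f := fun s y => f (Xch (k + j) s - Xch k s + y)) kN'
  (adapted_atW (leq_addr j k) aF) _.
have af : adapted_at (k + j) (fun s y => f (Xch (k + j) s - Xch k s + y)).
  by move=> s; rewrite /Xch take_takel// take_takel// leq_addr.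
move=> /(_ af).
under eq_fun do rewrite -addrAC -XchS -addnS.
move=> ->; rewrite -natr1 !mulrDl mul1r addrA mulrDr.
apply: (@le_trans _ _ (E (fun s => F s * f (Xch (k + j) s - Xch k s) + dt * G * F s))).
  apply: (le_mean EN) => s; rewrite addr0 mulrDr lerD2l mulrC ler_wpM2r//.
  by rewrite ler_pM2l ?(ok_d ok)//; apply: fG; exact: (ok_a ok).
rewrite (meanD EN) (meanZ EN) [dt * G * _]mulrC lerD2r.
exact: IH (ltnW kN').
Qed.

Definition Sch (k : nat) (s : seq int) : R := Xch k s - x0 - Ach k s.

Variables rho et e xi : R.
Hypotheses (rho0 : 0 <= rho) (e0 : 0 <= e).
Hypothesis Hre : `|sym_re ch (xi * h) - rho| <= e.
Hypothesis Him : forall b : R, `|b| <= K ->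
  `|sym_im ch (xi * h) + b / h * sin (xi * h) - (xi * b - et)| <= e.
Hypotheses (e1 : e <= 1) (dt1 : dt * (1 + rho) <= 1).

Definition char_cst : R := 2 + 8 * (2 + rho + `|xi| * K + `|et|) ^+ 2.

(** The phase shift combines the accumulated drift, which [Sch] subtracts, with the compensating
    imaginary part [et]; it cancels the imaginary part of the symbol to first order. The exponential
    factor cancels the real part, so a step costs only dt (e + dt). *)
Lemma one_step_char (al b : R) : `|b| <= K ->
  `|expR (rho * dt) * (cos (al + dt * (et - xi * b)) * (1 - dt * sym_re ch (xi * h))
     - dt * sin (al + dt * (et - xi * b)) * (sym_im ch (xi * h) + b / h * sin (xi * h)))
   - cos al| <= expR (rho * dt) * (dt * (char_cst * (e + dt))).
Proof.
move=> bK; have d0 := ok_d ok.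
have Hr := Hre; set r := sym_re ch (xi * h) in Hr *.
have := Him bK; set i := sym_im ch (xi * h) + _ => Hi.
set D := et - xi * b; set be := dt * D.
set Q := 2 + rho + `|xi| * K + `|et|.
have xk : `|xi * b| <= `|xi| * K by rewrite normrM ler_wpM2l.
have DQ : `|D| <= Q.
  apply: (le_trans (ler_normB _ _)); apply: (le_trans (lerD (lexx _) xk)).
  by rewrite /Q addrC lerD2r lerDr addr_ge0.
have iQ : `|i| <= Q.
  have -> : i = (i - (xi * b - et)) + (xi * b - et) by ring.
  have hD : `|xi * b - et| <= `|xi| * K + `|et|.
    by apply: (le_trans (ler_normB _ _)); rewrite lerD2r.
  apply: (le_trans (ler_normD _ _)); apply: (le_trans (lerD Hi hD)).
  by rewrite /Q addrA lerD2r lerD2r (le_trans e1)// (le_trans (ler1n _ 2))// lerDl.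
have Qrho : 2 + rho <= Q.
  by rewrite /Q -[leRHS]addrA lerDl addr_ge0//; exact: le_trans xk.
have rQ : `|r| <= Q.
  have -> : r = (r - rho) + rho by ring.
  rewrite (le_trans (ler_normD _ _))// (ger0_norm rho0) (le_trans _ Qrho)// lerD2r.
  by rewrite (le_trans Hr)// (le_trans e1)// ler1n.
have Q2 : 2 <= Q by rewrite (le_trans _ Qrho)// lerDl.
have beQ : `|be| <= dt * Q by rewrite /be normrM (gtr0_norm d0) ler_pM2l.
have Q0 : 0 <= Q by exact: le_trans Q2.
have t1 : `|cos (al + be) - cos al + be * sin al| <= 2 * (dt * Q) ^+ 2.
  apply: (le_trans (cos_taylor _ _)); rewrite ler_pM2l// -[be ^+ 2]real_normK ?num_real//.
  by rewrite lerXn2r ?nnegrE// mulr_ge0// ltW.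
have t2 : `|cos (al + be) - cos al| <= dt * Q.
  by rewrite (le_trans (norm_cosB_le _ _))// addrAC subrr add0r.
have t3 : `|sin (al + be) - sin al| <= dt * Q.
  by rewrite (le_trans (norm_sinB_le _ _))// addrAC subrr add0r.
set B := cos (al + be) * (1 - dt * r) - dt * sin (al + be) * i.
have BE : `|B - cos al * (1 - dt * rho)| <= dt * (2 * e) + 4 * (dt * Q) ^+ 2.
  (* In order: a Taylor remainder, two products of second order in [dt], and the two consistency
     errors of the symbol. *)
  have -> : B - cos al * (1 - dt * rho) =
      (cos (al + be) - cos al + be * sin al)
      - dt * r * (cos (al + be) - cos al)
      - dt * i * (sin (al + be) - sin al)
      - dt * cos al * (r - rho)
      - dt * sin al * (i - (xi * b - et)).
    by rewrite /B /be /D; ring.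
  have u1 : `|dt * r * (cos (al + be) - cos al)| <= dt * Q * (dt * Q).
    by rewrite normrM ler_pM// normrM (gtr0_norm d0) ler_pM2l.
  have u2 : `|dt * i * (sin (al + be) - sin al)| <= dt * Q * (dt * Q).
    by rewrite normrM ler_pM// normrM (gtr0_norm d0) ler_pM2l.
  have u3 : `|dt * cos al * (r - rho)| <= dt * e.
    rewrite normrM ler_pM// normrM (gtr0_norm d0) -[leRHS]mulr1 ler_pM2l//; exact: cos_max.
  have u4 : `|dt * sin al * (i - (xi * b - et))| <= dt * e.
    rewrite normrM ler_pM// normrM (gtr0_norm d0) -[leRHS]mulr1 ler_pM2l//; exact: sin_max.
  have -> : dt * (2 * e) + 4 * (dt * Q) ^+ 2 =
     2 * (dt * Q) ^+ 2 + dt * Q * (dt * Q) + dt * Q * (dt * Q) + dt * e + dt * e by ring.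
  do 4 (rewrite (le_trans (ler_normB _ _))// lerD//).
have ex := expR_gt0 (rho * dt).
have -> : expR (rho * dt) * B - cos al = expR (rho * dt) * (B - cos al * (1 - dt * rho))
    + cos al * (expR (rho * dt) * (1 - rho * dt) - 1) by ring.
apply: (le_trans (ler_normD _ _)).
have rd0 : 0 <= rho * dt by rewrite mulr_ge0// ltW.
have rd1 : rho * dt <= 1 by have := dt1; rewrite mulrDr mulr1 mulrC; lra.
have v1 : `|cos al * (expR (rho * dt) * (1 - rho * dt) - 1)| <= expR (rho * dt) * (dt * Q) ^+ 2.
  rewrite normrM -[leRHS]mul1r; apply: ler_pM => //; first exact: cos_max.
  apply: (le_trans (expR_sub1 rd0 rd1)).
  have q1 : (rho * dt) ^+ 2 <= (dt * Q) ^+ 2.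
    rewrite lerXn2r ?nnegrE ?mulr_ge0 ?(ltW d0)// mulrC ler_pM2l//.
    by rewrite (le_trans _ Qrho)// lerDr.
  apply: (le_trans q1); rewrite -[leLHS]mul1r ler_wpM2r ?sqr_ge0//.
  by have := expR_ge1Dx (rho * dt); lra.
have v2 : `|expR (rho * dt) * (B - cos al * (1 - dt * rho))| <=
    expR (rho * dt) * (dt * (2 * e) + 4 * (dt * Q) ^+ 2).
  by rewrite normrM gtr0_norm// ler_pM2l.
apply: (le_trans (lerD v2 v1)); rewrite -mulrDr ler_pM2l//.
rewrite /char_cst -/Q.
have := mulr_ge0 (sqr_ge0 Q) e0; have := mulr_ge0 (sqr_ge0 Q) (ltW d0) => q1 q2.
have -> : dt * (2 * e) + 4 * (dt * Q) ^+ 2 + (dt * Q) ^+ 2 = dt * (2 * e + 5 * (Q ^+ 2 * dt)).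
  by ring.
by rewrite ler_pM2l//; lra.
Qed.

(** The errors of the single steps add up. As [F] is determined by the first [k] increments, this is
    an estimate of a conditional characteristic function. *)
Lemma mean_char k j (F : seq int -> R) (al : R) : (k + j <= N)%N ->
  adapted_at k F -> (forall s, `|F s| <= 1) ->
  `|expR (rho * (j%:R * dt)) *
      E (fun s => F s * cos (al + xi * (Sch (k + j) s - Sch k s) + et * (j%:R * dt)))
    - E F * cos al| <= j%:R * dt * (expR (rho * (j%:R * dt)) * (char_cst * (e + dt))).
Proof.
move=> + aF F1; have d0 := ok_d ok; elim: j => [|j IH] kN.
  rewrite addn0 !mul0r mulr0 expR0 mul1r mulr0.
  under eq_fun do rewrite subrr mulr0 !addr0 mulrC.
  by rewrite (meanZ EN) mulrC subrr normr0.
have kN' : (k + j < N)%N by rewrite -addnS.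
have {}IH := IH (ltnW kN').
pose ph s : R := al + xi * (Sch (k + j) s - Sch k s) + et * (j%:R * dt).
pose b s := a (k + j)%N (pos (take (k + j) s)).
have aph : adapted_at (k + j) ph.
  move=> s; rewrite /ph /Sch [Xch (k + j) s]Xch_adapted [Ach (k + j) s]Ach_adapted.
  by rewrite (adapted_atW (leq_addr j k) (@Xch_adapted k) s)
    (adapted_atW (leq_addr j k) (@Ach_adapted k) s).
have ab : adapted_at (k + j) b by move=> s; rewrite /b take_takel.
pose f s y := cos (ph s + dt * (et - xi * b s) + xi * y).
have af : adapted_at (k + j) f.
  by move=> s; rewrite /f [in LHS]aph [in LHS]ab.
have := step_mean_eq kN' (adapted_atW (leq_addr j k) aF) af.
have -> : (fun s => F s * f s (h * (nth 0 s (k + j))%:~R)) =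
    (fun s => F s * cos (al + xi * (Sch (k + j.+1) s - Sch k s) + et * (j.+1%:R * dt))).
  apply/funext => s; rewrite /f /ph; congr (_ * cos _).
  by rewrite addnS /Sch XchS AchS -/(b s) -natr1; ring.
move=> ->.
set C := char_cst * (e + dt).
have C0 : 0 <= C.
  apply: mulr_ge0; last by rewrite addr_ge0// ltW.
  by rewrite /char_cst addr_ge0// mulr_ge0// sqr_ge0.
rewrite -!natr1 !mulrDl !mul1r mulrDr expRD.
set X := expR (rho * (j%:R * dt)) in IH *; set Y := expR (rho * dt).
have X0 : 0 < X by exact: expR_gt0. have Y0 : 0 < Y by exact: expR_gt0.
set Z := E _; set Z' := E _ in IH.
have main : `|Y * Z - Z'| <= Y * (dt * C).
  rewrite /Z /Z' -(meanZ EN) -(meanB EN) (le_trans (mean_norm EN _))//.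
  rewrite -[leRHS](mean_cst EN); apply: (le_mean EN) => s.
  have -> : f s 0 + dt * gen ch (a (k + j)%N (pos (take (k + j) s)))
       (fun z => f s (h * z%:~R)) =
     cos (ph s + dt * (et - xi * b s)) * (1 - dt * sym_re ch (xi * h))
     - dt * sin (ph s + dt * (et - xi * b s)) * (sym_im ch (xi * h) + b s / h * sin (xi * h)).
    rewrite /f mulr0 addr0.
    have -> : (fun z : int => cos (ph s + dt * (et - xi * b s) + xi * (h * z%:~R))) =
       fun z : int => cos (ph s + dt * (et - xi * b s) + xi * h * z%:~R).
      by apply/funext => z; rewrite mulrA.
    by rewrite gen_cos -/(b s); ring.
  rewrite mulrCA -mulrBr normrM -[leRHS]mul1r; apply: ler_pM => //.
  by apply: one_step_char; exact: (ok_a ok).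
have -> : X * Y * Z - E F * cos al = X * (Y * Z - Z') + (X * Z' - E F * cos al) by ring.
apply: (le_trans (ler_normD _ _)).
have m1 : `|X * (Y * Z - Z')| <= X * (Y * (dt * C)).
  by rewrite normrM (gtr0_norm X0) ler_pM2l.
apply: (le_trans (lerD m1 IH)).
have Y1 : 1 <= Y by have := expR_ge1Dx (rho * dt); have := mulr_ge0 rho0 (ltW d0); rewrite -/Y; lra.
have XY : X <= X * Y by rewrite ler_peMr// ltW.
have q1 : j%:R * dt * (X * C) <= j%:R * dt * (X * Y * C).
  by rewrite ler_wpM2l ?ler_wpM2r// mulr_ge0// ltW.
have -> : X * (Y * (dt * C)) = dt * (X * Y * C) by ring.
by rewrite addrC lerD2r.
Qed.

End Level.

(** * Cadlag paths from dyadic values *)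

Section DyadicPaths.
Context {R : realType}.
Implicit Types (y : R -> R) (t : R).

Definition dy (p i : nat) : R := i%:R / 2 ^+ p.

Definition isdy (r : R) := exists p i, r = dy p i.

(** The ratio q = 9/10 is below 1, so chained increments are summable, and 2 q^4 > 11/10, so the
    exceptional probabilities in [chained_ae] are summable as well. *)
Definition lam (p : nat) : R := (9 / 10) ^+ p.

(* Chentsov's condition: of two consecutive increments at most one is large. *)
Definition chained y := exists p0, forall p i, (p0 <= p)%N -> (i.+2 <= p * 2 ^ p)%N ->
  `|y (dy p i.+1) - y (dy p i)| <= lam p \/ `|y (dy p i.+2) - y (dy p i.+1)| <= lam p.

Lemma pow2_gt0 p : 0 < 2 ^+ p :> R. Proof. exact: exprn_gt0. Qed.

Lemma dy_shift p r i : dy (p + r) (i * 2 ^ r)%N = dy p i.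
Proof.
by rewrite /dy natrM natrX exprD invfM mulrACA divff ?mulr1.
Qed.

Lemma dyS p i : dy p.+1 i.*2 = dy p i.
Proof. by rewrite -addn1 -muln2 -(expn1 2) dy_shift. Qed.

Lemma lam_ge0 p : 0 <= lam p. Proof. by rewrite exprn_ge0. Qed.

Lemma lamS p : lam p.+1 = 9 / 10 * lam p. Proof. exact: exprS. Qed.

Lemma lam_small (e : R) m0 : 0 < e -> exists m, (m0 <= m)%N /\ 20 * lam m <= e.
Proof.
move=> e0; have h : (fun m => 20 * lam m) @ \oo --> (20 * 0 : R).
  apply: cvgM; [exact: cvg_cst|apply: cvg_expr; rewrite ger0_norm; lra].
rewrite mulr0 in h; have /cvgrPdist_le/(_ _ e0)[m1 _ hm] := h.
exists (maxn m0 m1); split; first exact: leq_maxl.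
have := hm (maxn m0 m1) (leq_maxr _ _).
by rewrite /= sub0r normrN; apply: le_trans; exact: ler_norm.
Qed.

Lemma half_bounds (i : nat) : (i = i./2.*2 \/ i = (i./2.*2).+1)%N.
Proof. lia. Qed.

Section Triples.
Variables (y : R -> R) (p0 : nat).
Hypothesis Hy : forall p i, (p0 <= p)%N -> (i.+2 <= p * 2 ^ p)%N ->
  `|y (dy p i.+1) - y (dy p i)| <= lam p \/ `|y (dy p i.+2) - y (dy p i.+1)| <= lam p.

(** An even point already belongs to the coarser level. An odd one is the middle of two consecutive
    fine intervals, and one of its two neighbours, both coarse, has a close value. *)
Lemma near_coarse p i : (p0 <= p)%N -> (i < p.+1 * 2 ^ p.+1)%N ->
  exists i', (i./2 <= i' <= uphalf i)%N /\ `|y (dy p.+1 i) - y (dy p i')| <= lam p.+1.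
Proof.
move=> p0p ip; have [iE|iE] := half_bounds i.
  exists i./2; rewrite -(dyS p) -iE subrr normr0 lam_ge0; split => //; lia.
have [||h|h] := @Hy p.+1 (i./2.*2); [lia|lia| |]; rewrite -iE in h.
  exists i./2; rewrite -(dyS p); split => //; lia.
exists i./2.+1; rewrite -(dyS p) distrC doubleS -iE; split => //; lia.
Qed.

(* Triples at level [m + r] are moved, without changing their order, to triples at
the previous level; inside one block of level [m] this ends with a pair. *)
Lemma triple_block m b r i j k : (p0 <= m)%N -> (b < m * 2 ^ m)%N ->
  (b * 2 ^ r <= i <= j)%N -> (j <= k <= b.+1 * 2 ^ r)%N ->
  `|y (dy (m + r) j) - y (dy (m + r) i)| <= 20 * (lam m - lam (m + r)) \/
  `|y (dy (m + r) k) - y (dy (m + r) j)| <= 20 * (lam m - lam (m + r)).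
Proof.
move=> p0m bm; elim: r i j k => [|r IH] i j k ij jk.
  (* At level [m] a block has only its two end points, so the triple repeats a point. *)
  rewrite addn0 subrr mulr0 !normr_le0 !subr_eq0.
  have [->|->] : (j = i \/ k = j)%N by lia.
    by left.
  by right.
have B0 : 0 <= 20 * (lam m - lam (m + r.+1)).
  rewrite mulr_ge0// subr_ge0 /lam exprD ler_piMr ?lam_ge0//.
  by apply: exprn_ile1; lra.
(* For distinct points the order survives the move: [i < j] gives [uphalf i <= j./2]. *)
have [->|ij'] := eqVneq i j; first by left; rewrite subrr normr0.
have [->|jk'] := eqVneq j k; first by right; rewrite subrr normr0.
have hor : (b.+1 * 2 ^ r.+1 <= m * 2 ^ (m + r.+1))%N.
  by rewrite expnD mulnA leq_mul2r bm orbT.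
have hor' : (m * 2 ^ (m + r.+1) < (m + r).+1 * 2 ^ (m + r).+1)%N.
  rewrite -addnS ltn_mul2r expn_gt0/=; lia.
have near_le z : (z <= k)%N -> exists z', (z./2 <= z' <= uphalf z)%N /\
    `|y (dy (m + r.+1) z) - y (dy (m + r) z')| <= lam (m + r.+1).
  move=> zk; rewrite addnS; apply: near_coarse; [lia|].
  by apply: leq_ltn_trans hor'; apply: leq_trans hor; lia.
have [|i' [ii' di]] := near_le i; first lia.
have [|j' [jj' dj]] := near_le j; first lia.
have [k' [kk' dk]] := near_le k (leqnn _).
have [||h|h] := IH i' j' k'.
- move: ij; rewrite expnS; set q := (2 ^ r)%N; nia.
- move: jk; rewrite expnS; set q := (2 ^ r)%N; nia.
(* Moving both ends costs 2 lam (m + r + 1), which is at most 20 (lam (m + r) - lam (m + r + 1)) = 2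
   lam (m + r); this is the origin of the constant 20. *)
- left; have lS := lamS (m + r); rewrite -addnS in lS.
  have -> : y (dy (m + r.+1) j) - y (dy (m + r.+1) i) =
    (y (dy (m + r.+1) j) - y (dy (m + r) j')) + (y (dy (m + r) j') - y (dy (m + r) i'))
     - (y (dy (m + r.+1) i) - y (dy (m + r) i')) by ring.
  apply: (le_trans (ler_normB _ _)); apply: (le_trans (lerD (ler_normD _ _) (lexx _))).
  apply: (le_trans (lerD (lerD dj h) di)); have := lam_ge0 (m + r); lra.
- right; have lS := lamS (m + r); rewrite -addnS in lS.
  have -> : y (dy (m + r.+1) k) - y (dy (m + r.+1) j) =
    (y (dy (m + r.+1) k) - y (dy (m + r) k')) + (y (dy (m + r) k') - y (dy (m + r) j'))
     - (y (dy (m + r.+1) j) - y (dy (m + r) j')) by ring.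
  apply: (le_trans (ler_normB _ _)); apply: (le_trans (lerD (ler_normD _ _) (lexx _))).
  apply: (le_trans (lerD (lerD dk h) dj)); have := lam_ge0 (m + r); lra.
Qed.

Lemma isdy_level m r : isdy r -> exists n, forall n', (n <= n')%N -> exists i, r = dy (m + n') i.
Proof.
move=> [p [i ->]]; exists p => n' pn; exists (i * 2 ^ (m + n' - p))%N.
by rewrite -(dy_shift p (m + n' - p)); congr dy; lia.
Qed.

Lemma triple_isdy m b r s u : (p0 <= m)%N -> (b < m * 2 ^ m)%N ->
  isdy r -> isdy s -> isdy u -> dy m b <= r -> r <= s -> s <= u -> u <= dy m b.+1 ->
  `|y s - y r| <= 20 * lam m \/ `|y u - y s| <= 20 * lam m.
Proof.
move=> p0m bm /(isdy_level m)[n1 h1] /(isdy_level m)[n2 h2] /(isdy_level m)[n3 h3].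
pose n := (n1 + n2 + n3)%N.
have [i ri] := h1 n ltac:(lia); have [j sj] := h2 n ltac:(lia); have [k uk] := h3 n ltac:(lia).
have le_dy i' j' : (dy (m + n) i' <= dy (m + n) j') = (i' <= j')%N.
  by rewrite /dy ler_pM2r ?ler_nat// invr_gt0 pow2_gt0.
rewrite ri sj uk -[dy m b](dy_shift m n) -[dy m b.+1](dy_shift m n) !le_dy => bi ij jk kb.
have := @triple_block m b n i j k p0m bm; rewrite bi ij jk kb => /(_ isT isT).
have le20 : 20 * (lam m - lam (m + n)) <= 20 * lam m.
  by rewrite ler_pM2l// gerBl lam_ge0.
by move=> [h|h]; [left|right]; exact: le_trans le20.
Qed.

End Triples.

Section Regular.
Variable y : R -> R.
Hypothesis Hy : chained y.

Lemma truncn_dy t m : 0 <= t -> dy m (Num.truncn (t * 2 ^+ m)) <= t < dy m (Num.truncn (t * 2 ^+ m)).+1.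
Proof.
move=> t0; rewrite /dy ler_pdivrMr ?ltr_pdivlMr ?pow2_gt0//; apply: truncn_itv.
by rewrite mulr_ge0// ltW// pow2_gt0.
Qed.

Lemma dyB m i : dy m i.+1 - dy m i = 2 ^- m.
Proof. by rewrite /dy -mulrBl -natrB// subSnn mul1r. Qed.

Lemma level_exists t e : 0 <= t -> 0 < e -> forall p0, exists m, [/\ (p0 <= m)%N, 20 * lam m <= e &
  (Num.truncn (t * 2 ^+ m) < m * 2 ^ m)%N].
Proof.
move=> t0 e0 p0; have [m [hm em]] := lam_small (p0 + Num.truncn t).+1 e0.
exists m; split => //; first lia.
rewrite truncn_lt_nat ?mulr_ge0// ?natrM ?natrX ?ltr_pM2r ?pow2_gt0//.
apply: (lt_le_trans (truncnS_gt t)); rewrite ler_nat.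
exact: leq_ltn_trans (leq_addl _ _) hm.
Qed.

(** If some pair r <= s to the right of [t], in its block, has a large increment, then every point
    between [t] and [r] has a value close to that at [r], and the neighbourhood shrinks to end at
    [r]. If there is no such pair, the oscillation is already small. *)
Lemma right_osc t e : 0 <= t -> 0 < e -> exists2 d : R, 0 < d &
  forall r s, isdy r -> isdy s -> t < r -> r < t + d -> t < s -> s < t + d -> `|y r - y s| <= e.
Proof.
move=> t0 e0; have [p0 Hp] := Hy.
have [m [p0m em bm]] := level_exists t0 (divr_gt0 e0 (ltr0n R 2)) p0.
set b := Num.truncn _ in bm; have /andP[bt tb] := truncn_dy m t0; rewrite -/b in bt tb.
pose w r := t < r /\ r < dy m b.+1.
have tri r s u : isdy r -> isdy s -> isdy u -> w r -> w u -> r <= s -> s <= u ->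
    `|y s - y r| <= e / 2 \/ `|y u - y s| <= e / 2.
  move=> dr ds du [wr _] [_ wu] rs su.
  have [|h|h] := triple_isdy Hp p0m bm dr ds du _ rs su (ltW wu); [|left|right].
  - by rewrite (le_trans bt)// ltW.
  - exact: le_trans em.
  - exact: le_trans em.
have [[r [s [dr ds [wr ws [rs yrs]]]]]|no] := pselect (exists r s, [/\ isdy r, isdy s &
    [/\ w r, w s & r <= s /\ e / 2 < `|y s - y r|]]).
  exists (r - t); first by rewrite subr_gt0; case: wr.
  have near u : isdy u -> t < u -> u < r -> `|y r - y u| <= e / 2.
    move=> du tu ur; have wu : w u by split=> //; apply: (lt_trans ur); case: wr.
    by have [//|] := tri u r s du dr ds wu ws (ltW ur) rs; rewrite leNgt yrs.
  move=> u v du dv tu; rewrite addrC subrK => ur tv vr.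
  have -> : y u - y v = (y r - y v) - (y r - y u) by ring.
  by rewrite (le_trans (ler_normB _ _))// [leRHS]splitr lerD// near.
exists (dy m b.+1 - t); first by rewrite subr_gt0.
have half r s : isdy r -> isdy s -> w r -> w s -> r <= s -> `|y s - y r| <= e.
  move=> dr ds wr ws rs; rewrite leNgt; apply/negP => h; apply: no; exists r, s; split => //.
  by split => //; split => //; apply: le_lt_trans h; rewrite ler_piMr ?(ltW e0)//; lra.
move=> u v du dv; rewrite addrC subrK => tu um tv vm.
have [uv|vu] := leP u v; first by rewrite distrC half.
by rewrite half// ltW.
Qed.

Lemma left_osc t e : 0 < t -> 0 < e -> exists2 d : R, 0 < d <= t &
  forall r s, isdy r -> isdy s -> t - d < r -> r < t -> t - d < s -> s < t -> `|y r - y s| <= e.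
Proof.
move=> t0 e0; have [p0 Hp] := Hy.
have [m [p0m em cm]] := level_exists (ltW t0) (divr_gt0 e0 (ltr0n R 2)) p0.
set c := Num.truncn _ in cm; have /andP[ct tc] := truncn_dy m (ltW t0); rewrite -/c in ct tc.
(* When [t] is itself a grid point, the block to use is the one that ends at [t]. *)
have [b [bm bt tb b0]] : exists b, [/\ (b < m * 2 ^ m)%N, dy m b < t, t <= dy m b.+1 & 0 <= dy m b].
  have dy0 i : 0 <= dy m i by rewrite /dy divr_ge0// ltW// pow2_gt0.
  have [ct'|ct'] := ltP (dy m c) t; first by exists c; split => //; exact: ltW.
  have tE : t = dy m c by apply/eqP; rewrite eq_le ct ct'.
  case: c tE {ct tc ct'} cm => [|c] tE cm.
    by move: t0; rewrite tE /dy mul0r ltxx.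
  exists c; split => //; [lia| |by rewrite tE].
  by rewrite tE -subr_gt0 dyB invr_gt0 pow2_gt0.
pose w r := dy m b < r /\ r < t.
have tri r s u : isdy r -> isdy s -> isdy u -> w r -> w u -> r <= s -> s <= u ->
    `|y s - y r| <= e / 2 \/ `|y u - y s| <= e / 2.
  move=> dr ds du [wr _] [_ wu] rs su.
  have [|h|h] := triple_isdy Hp p0m bm dr ds du (ltW wr) rs su _; [|left|right].
  - exact: le_trans (ltW wu) tb.
  - exact: le_trans em.
  - exact: le_trans em.
have [[r [s [dr ds [wr ws [rs yrs]]]]]|no] := pselect (exists r s, [/\ isdy r, isdy s &
    [/\ w r, w s & r <= s /\ e / 2 < `|y s - y r|]]).
  have [bs st] := ws.
  exists (t - s); first by rewrite subr_gt0 st gerBl (le_trans b0)// ltW.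
  have near u : isdy u -> s < u -> u < t -> `|y u - y s| <= e / 2.
    move=> du su ut; have wu : w u by split=> //; exact: lt_trans su.
    by have [|//] := tri r s u dr ds du wr wu rs (ltW su); rewrite leNgt yrs.
  move=> u v du dv; rewrite opprB addrC subrK => su ut sv vt.
  have -> : y u - y v = (y u - y s) - (y v - y s) by ring.
  by rewrite (le_trans (ler_normB _ _))// [leRHS]splitr lerD// near.
exists (t - dy m b); first by rewrite subr_gt0 bt gerBl.
have half r s : isdy r -> isdy s -> w r -> w s -> r <= s -> `|y s - y r| <= e.
  move=> dr ds wr ws rs; rewrite leNgt; apply/negP => h; apply: no; exists r, s; split => //.
  by split => //; split => //; apply: le_lt_trans h; rewrite ler_piMr ?(ltW e0)//; lra.
move=> u v du dv; rewrite opprB addrC subrK => bu ut bv vt.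
have [uv|vu] := leP u v; first by rewrite distrC half.
by rewrite half// ltW.
Qed.

End Regular.

(** The next dyadic point of level [p] strictly after [t], even when [t] is dyadic; [rlim] is
    therefore a genuine right limit. *)
Definition rd (p : nat) t : R := dy p (Num.truncn (t * 2 ^+ p)).+1.

Definition rlim y t : R := lim ((fun p => y (rd p t)) @ \oo).

Lemma rd_isdy p t : isdy (rd p t). Proof. by exists p, (Num.truncn (t * 2 ^+ p)).+1. Qed.

Lemma rd_gt p t : 0 <= t -> t < rd p t.
Proof. by move=> t0; have /andP[] := truncn_dy p t0. Qed.

Lemma rd_le p t : 0 <= t -> rd p t <= t + 2 ^- p.
Proof.
move=> t0; have /andP[h _] := truncn_dy p t0.
by rewrite /rd -lerBlDr -(dyB p (Num.truncn (t * 2 ^+ p))) opprB addrC subrK.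
Qed.

Lemma pow2_small (e : R) : 0 < e -> exists m, forall p, (m <= p)%N -> 2 ^- p < e.
Proof.
move=> e0; have h : (fun m => (1 / 2) ^+ m) @ \oo --> (0 : R).
  by apply: cvg_expr; rewrite ger0_norm; lra.
have /cvgrPdist_lt/(_ _ e0)[m _ hm] := h; exists m => p mp.
by have := hm p mp; rewrite /= sub0r normrN ger0_norm ?exprn_ge0// div1r exprVn.
Qed.

Lemma rd_lt t (e : R) : 0 <= t -> 0 < e -> \forall p \near \oo, rd p t < t + e.
Proof.
move=> t0 e0; have [m hm] := pow2_small e0; exists m => // p mp.
by rewrite (le_lt_trans (rd_le p t0))// ltrD2l; exact: hm.
Qed.

Lemma rlim_cvg y t : chained y -> 0 <= t -> (fun p => y (rd p t)) @ \oo --> rlim y t.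
Proof.
move=> Hy t0; suff : cvg ((fun p => y (rd p t)) @ \oo) by [].
apply/cauchy_cvgP/cauchy_exP => e e0.
have [d d0 hd] := right_osc Hy t0 (divr_gt0 e0 (ltr0n R 2)).
have near_d := rd_lt t0 d0; have [m _ hm] := near_d.
exists (y (rd m t)); exists m => // p mp.
rewrite /ball/= /ball_/=; apply: (@le_lt_trans _ _ (e / 2)); last by rewrite ltr_pdivrMr//; lra.
by apply: hd; [exact: rd_isdy|exact: rd_isdy|exact: rd_gt|exact: hm m (leqnn m)|exact: rd_gt|exact: hm p mp].
Qed.

Lemma rlim_near y t u v (z e : R) : chained y -> 0 <= t -> u <= t -> t < v ->
  (forall r, isdy r -> u < r -> r < v -> `|z - y r| <= e) -> `|z - rlim y t| <= e.
Proof.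
move=> Hy t0 ut tv h.
have c : (fun p => `|z - y (rd p t)|) @ \oo --> `|z - rlim y t|.
  by apply: cvg_norm; apply: cvgB; [exact: cvg_cst|exact: rlim_cvg].
apply: (cvgr_to_le c).
have tv0 : 0 < v - t by rewrite subr_gt0.
apply: filterS (rd_lt t0 tv0) => p hp; apply: h; first exact: rd_isdy.
  exact: le_lt_trans ut (rd_gt p t0).
by move: hp; rewrite addrC subrK.
Qed.

Lemma rlim_dist y t (e : R) : chained y -> 0 <= t -> 0 < e -> exists2 d : R, 0 < d &
  forall r, isdy r -> t < r -> r < t + d -> `|rlim y t - y r| <= e.
Proof.
move=> Hy t0 e0; have [d d0 hd] := right_osc Hy t0 e0.
exists d => // r dr tr rd; rewrite distrC.
apply: (@rlim_near _ _ t (t + d)) => //; first by rewrite ltrDl.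
by move=> s ds ts sd; exact: hd.
Qed.

Lemma rlim_cadlag y : chained y -> cadlag (rlim y).
Proof.
move=> Hy; split => t t0.
  apply/cvgrPdist_le => e e0; have [d d0 hd] := rlim_dist Hy t0 e0.
  near=> s; have ts : t < s by near: s; exact: nbhs_right_gt.
  apply: (@rlim_near _ _ t (t + d)) => //.
  - by rewrite ltW// (le_lt_trans t0).
  - by near: s; apply: nbhs_right_lt; rewrite ltrDl.
apply/cvg_ex; apply/cauchy_cvgP/cauchy_exP => e e0.
have [d /andP[d0 dt] hd] := left_osc Hy t0 (divr_gt0 e0 (ltr0n R 2)).
have [p _ hp] := rd_lt (t := t - d) ltac:(by rewrite subr_ge0) d0.
have td0 : 0 <= t - d by rewrite subr_ge0.
have rp := hp p (leqnn p); rewrite /= subrK in rp.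
exists (y (rd p (t - d))); rewrite /fmapE /=; near=> s.
rewrite /ball/= /ball_/=; apply: (@le_lt_trans _ _ (e / 2)); last by rewrite ltr_pdivrMr//; lra.
have ds : t - d < s by near: s; apply: nbhs_left_gt; rewrite gtrBl.
apply: (@rlim_near _ _ (t - d) t) => //.
- by rewrite (le_trans td0)// ltW.
- exact: ltW.
- by move=> r dr dr1 rt; apply: hd => //; [exact: rd_isdy|exact: rd_gt].
Unshelve. all: by end_near. Qed.

Lemma measurable_truncn_comp (G : nat -> R) (D : set R) p : measurable D ->
  measurable_fun D (fun t : R => G (Num.truncn (t * 2 ^+ p))).
Proof.
move=> mD; apply: measurable_funS (measurableT) (@subsetT _ D) _ => _ B mB; rewrite setTI.
have mA n : measurable [set t : R | (Num.truncn (t * 2 ^+ p) <= n)%N].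
  have -> : [set t : R | (Num.truncn (t * 2 ^+ p) <= n)%N] = `]-oo, (n.+1%:R / 2 ^+ p)[%classic.
    apply/seteqP; split => t /=; rewrite in_itv/= truncn_le_nat ltr_pdivlMr ?pow2_gt0//.
  exact: measurable_itv.
have mE n : measurable [set t : R | Num.truncn (t * 2 ^+ p) = n].
  case: n => [|n].
    rewrite (_ : [set _ | _] = [set t : R | (Num.truncn (t * 2 ^+ p) <= 0)%N])//.
    by apply/seteqP; split => t /=; lia.
  rewrite (_ : [set _ | _] = [set t : R | (Num.truncn (t * 2 ^+ p) <= n.+1)%N] `\`
     [set t : R | (Num.truncn (t * 2 ^+ p) <= n)%N]); first exact: measurableD.
  by apply/seteqP; split => t /=; lia.
have -> : (fun t : R => G (Num.truncn (t * 2 ^+ p))) @^-1` B =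
   \bigcup_(n in [set n | B (G n)]) [set t : R | Num.truncn (t * 2 ^+ p) = n].
  apply/seteqP; split => [t Bt|t [n Bn /= ->]//]; by exists (Num.truncn (t * 2 ^+ p)).
by apply: bigcup_measurable => n _; exact: mE.
Qed.

Lemma rlim_measurable y (D : set R) : chained y -> measurable D -> (forall t, D t -> 0 <= t) ->
  measurable_fun D (rlim y).
Proof.
move=> Hy mD D0; apply: (@measurable_fun_cvg _ _ _ _ (fun p t => y (rd p t))).
- by move=> p; exact: (measurable_truncn_comp (fun n => y (dy p n.+1)) p mD).
- by move=> t /D0 t0; exact: rlim_cvg.
Qed.

End DyadicPaths.

(* The exceptional set of the almost everywhere convergence is cut off so that the
dominated convergence theorem applies to everywhere convergent sequences. *)
Lemma ae_eq_of_L1_cvg {d} {T : measurableType d} {R : realType} (P : probability T R)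
    (f : nat -> T -> R) (m g : T -> R) (B : R) :
  (forall n, measurable_fun setT (f n)) -> measurable_fun setT m ->
  (forall n w, `|f n w| <= B) -> (forall w, `|m w| <= B) ->
  (fun n => Rintegral P setT (fun w => `|m w - f n w|)) @ \oo --> (0 : R) ->
  {ae P, forall w, f ^~ w @ \oo --> g w} -> {ae P, forall w, m w = g w}.
Proof.
move=> mf mm fB mB L1 [N [mN N0 hN]].
have Pfin : (P setT < +oo)%E by rewrite probability_setT ltry.
pose k n w := `|m w - f n w| * \1_(~` N) w.
pose k' w := `|m w - g w| * \1_(~` N) w.
have mind : measurable_fun setT (\1_(~` N) : T -> R) by apply: measurable_indic; exact: measurableC.
have mk n : measurable_fun setT (k n).
  by apply: measurable_funM => //; apply: measurableT_comp => //; exact: measurable_funB.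
have kk w : k ^~ w @ \oo --> k' w.
  rewrite /k /k' indicE; have [wN|] := boolP (w \in ~` N); last first.
    by move=> _; rewrite mulr0; under eq_fun do rewrite mulr0; exact: cvg_cst.
  rewrite mulr1; under eq_fun do rewrite mulr1.
  apply: cvg_norm; apply: cvgB; first exact: cvg_cst.
  by apply: contrapT => nc; move: wN; rewrite inE => wN; apply: wN; apply: hN.
have mk' : measurable_fun setT k' by apply: (measurable_fun_cvg mk) => w _; exact: kk.
have kB n w : `|k n w| <= B + B.
  rewrite normrM normr_id -[leRHS]mulr1; apply: ler_pM => //.
    by rewrite (le_trans (ler_normB _ _))// lerD.
  by rewrite indicE; case: (_ \in _); rewrite ?normr1 ?normr0.
have c1 : (fun n => Rintegral P setT (k n)) @ \oo --> Rintegral P setT k'.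
  by apply: (@bint_cvg _ _ _ P _ measurableT Pfin k k' (B + B)) => //; exact: aeW.
have k'B w : `|k' w| <= B + B.
  by apply: (cvgr_to_le (cvg_norm (kk w))); apply: nearW => n; exact: kB.
have k'0 w : 0 <= k' w by rewrite mulr_ge0.
have c0 : Rintegral P setT k' = 0.
  apply/eqP; rewrite eq_le; apply/andP; split; last first.
    by apply: Rintegral_ge0 => w _; exact: k'0.
  apply: (@ler_cvg_to _ _ _ _ _ _ _ _ c1 L1); apply: nearW => n.
  have bmk : bmf setT (k n) by split => //; exists (B + B).
  have bmd : bmf setT (fun w => `|m w - f n w|).
    split; first by apply: measurableT_comp => //; exact: measurable_funB.
    by exists (B + B) => w _; rewrite normr_id (le_trans (ler_normB _ _))// lerD.
  apply: (bint_le measurableT Pfin bmk bmd) => w _.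
  by rewrite /k ler_piMr// indicE; case: (_ \in _).
have ik' : P.-integrable setT (EFin \o k').
  by apply: bmf_integrable => //; split => //; exists (B + B).
have i0 : (\int[P]_(w in setT) `|(k' w)%:E| = 0)%E.
  transitivity (\int[P]_(w in setT) (k' w)%:E)%E.
    by apply: eq_integral => w _; rewrite abse_EFin ger0_norm.
  by rewrite -[LHS]fineK ?(integrable_fin_num _ ik')//; congr EFin.
have mEk' : measurable_fun setT (EFin \o k') by exact/measurable_EFinP.
have h1 := (ae_eq_integral_abs P measurableT mEk').1 i0.
have h2 : {ae P, forall w, ~ N w} by exists N; split => // w /= /contrapT.
apply: filterS2 h1 h2 => w /= /(_ I) [] + nN.
rewrite /k' indicE mem_set// mulr1 => /eqP; rewrite normr_eq0 subr_eq0.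
by move/eqP.
Qed.

(** * The limit process *)

Section StepIndex.
Context {R : realType}.
Implicit Types (r s : R) (L : nat).

Definition stp L r : nat := Num.truncn (r * 2 ^+ L).

Lemma stp_itv L r : 0 <= r -> (stp L r)%:R * 2 ^- L <= r < (stp L r)%:R * 2 ^- L + 2 ^- L.
Proof. by move=> /(truncn_dy L) /andP[h1 h2]; move: h2; rewrite -(subrK (dy L (stp L r)) (dy _ _)) dyB addrC => ->; rewrite h1. Qed.

Lemma stp_mono L r s : r <= s -> (stp L r <= stp L s)%N.
Proof. by move=> rs; apply: le_truncn; rewrite ler_pM2r// pow2_gt0. Qed.

Lemma stp_dist L r s : 0 <= r -> r <= s ->
  `|(stp L s - stp L r)%N%:R * 2 ^- L - (s - r)| <= 2 ^- L.
Proof.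
move=> r0 rs; have s0 := le_trans r0 rs.
have /andP[r1 r2] := stp_itv L r0; have /andP[s1 s2] := stp_itv L s0.
rewrite natrB ?stp_mono// mulrBl.
by move: r1 r2 s1 s2; set A := _ * 2 ^- L; set B := _ * 2 ^- L => *;
  rewrite ler_norml; apply/andP; split; lra.
Qed.

Lemma stp_le L n r : 0 <= r -> r <= n.+1%:R -> (stp L r <= n.+1 * 2 ^ L)%N.
Proof.
move=> r0 rn; have /andP[h _] := stp_itv L r0.
rewrite -(ler_nat R) natrM natrX -ler_pdivrMr ?pow2_gt0//; exact: le_trans rn.
Qed.

Lemma stp_dy L p i : (p <= L)%N -> stp L (dy p i) = (i * 2 ^ (L - p))%N.
Proof.
move=> pL; apply: truncn_def; rewrite /dy.
have -> : i%:R / 2 ^+ p * 2 ^+ L = (i * 2 ^ (L - p))%N%:R :> R.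
  rewrite -[in LHS](subnKC pL) exprD mulrA divfK; last by rewrite gt_eqF// pow2_gt0.
  by rewrite natrM natrX.
by rewrite lexx ltr_nat ltnSn.
Qed.

Lemma stp0 L : stp L 0 = 0%N. Proof. by rewrite /stp mul0r truncn0. Qed.

Lemma pow2_inv_le n L : (n <= L)%N -> 2 ^- L <= n.+1%:R^-1 :> R.
Proof.
move=> nL; rewrite lef_pV2 ?posrE ?pow2_gt0// -natrX ler_nat.
by rewrite (leq_ltn_trans nL)// ltn_expl.
Qed.

End StepIndex.

Section Approximations.
Context {R : realType} (c : R) (nu : {measure set R -> \bar R}) (a : R -> R -> R).
Variables (K x0 M0 : R).
Hypothesis Hnu : levy_measure nu.
Hypothesis K0 : 0 < K.
Variables (ch : nat -> chain R) (l : nat -> nat).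
Hypothesis GL : forall n, good_level c nu a K x0 M0 n (ch n) (l n).

Definition En n : (seq int -> R) -> R := Ech (ch n) (n.+1 * 2 ^ l n).

Lemma En_mean n : is_mean (En n). Proof. exact: (Ech_mean (gl_ok (GL n))). Qed.

Let dE n : ch_d (ch n) = 2 ^- l n. Proof. exact: (gl_d (GL n)). Qed.

Lemma dt_le n : 2 ^- l n <= n.+1%:R^-1 :> R.
Proof. exact: pow2_inv_le (gl_l (GL n)). Qed.

Lemma inv_near (e : R) : 0 < e -> \forall n \near \oo, n.+1%:R^-1 <= e.
Proof.
move=> e0; have /cvgrPdist_le/(_ _ e0) := @cvg_harmonic R.
by apply: filterS => n /=; rewrite sub0r normrN ger0_norm.
Qed.

Definition gint (rho x : R) : R := levy_int nu (fun y => gfun (y / rho)) (fun y => gfun' (y / rho) / rho) x.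

(** Bound for the generator on [gfun] at scale [rho]: drift, jumps, and the consistency error with
    the constant 4 of [tfun_gfun]. *)
Definition Grho (rho q : R) n : R := (K + `|c|) / rho + q + 12 * n.+1%:R^-1.

Lemma gen_gfun n rho q b y : 1 <= rho -> (forall x, `|gint rho x| <= q) -> `|b| <= K ->
  gen (ch n) b (fun z => gfun ((y + ch_h (ch n) * z%:~R) / rho)) <= Grho rho q n.
Proof.
move=> r1 hq bK; have r0 : 0 < rho by exact: lt_le_trans r1.
have := gl_gen (GL n) y bK (tfun_gfun r1); rewrite /= -/(gint rho y) => h.
have h1 := le_trans (ler_norm _) h; rewrite lerBlDr in h1; apply: (le_trans h1).
have -> : 3 * n.+1%:R^-1 * 4 = 12 * n.+1%:R^-1 :> R by ring.
rewrite addrC /Grho lerD2r; apply: lerD; last exact: le_trans (ler_norm _) (hq y).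
apply: (le_trans (ler_norm _)); rewrite normrM; apply: ler_pM => //.
  by rewrite (le_trans (ler_normB _ _))// lerD2r.
by rewrite normrM normfV (gtr0_norm r0) ler_piMl ?invr_ge0 ?(ltW r0)// gfun'_le1.
Qed.

Lemma Grho_ge0 rho q n : 1 <= rho -> (forall x, `|gint rho x| <= q) -> 0 <= Grho rho q n.
Proof.
move=> r1 hq; have q0 := le_trans (normr_ge0 _) (hq 0).
rewrite /Grho !addr_ge0// ?divr_ge0 ?addr_ge0 ?(ltW K0)//; exact: le_trans r1.
Qed.

Lemma incr_nat n k j rho q (F : seq int -> R) : (k + j <= n.+1 * 2 ^ l n)%N -> 1 <= rho ->
  (forall x, `|gint rho x| <= q) -> adapted_at k F -> (forall s, 0 <= F s) ->
  En n (fun s => F s * gfun ((Xch (ch n) x0 (k + j) s - Xch (ch n) x0 k s) / rho)) <=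
  En n F * (j%:R * 2 ^- l n * Grho rho q n).
Proof.
move=> kj r1 hq aF F0.
have hG : forall y b : R, `|b| <= K ->
    gen (ch n) b (fun z => gfun ((y + ch_h (ch n) * z%:~R) / rho)) <= Grho rho q n.
  by move=> y b; exact: gen_gfun.
have := mean_increment x0 (gl_ok (GL n)) (f := fun y => gfun (y / rho)) kj aF F0 hG.
by rewrite mul0r gfun0 add0r dE.
Qed.

Lemma mean_lb n (A : set (seq int)) (f : seq int -> R) r : 0 < r ->
  (forall v, 0 <= f v) -> (forall v, A v -> r <= f v) -> En n (\1_A) <= r^-1 * En n f.
Proof.
move=> r0 f0 rf; rewrite -(meanZ (En_mean n)); apply: (le_mean (En_mean n)) => v.
rewrite indicE; have [|vA] := boolP (v \in A).
  by rewrite inE => /rf h; rewrite ler_pdivlMl// mulr1.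
by rewrite mulr_ge0// invr_ge0 ltW.
Qed.

(** Tightness at a fixed time: where the displacement exceeds [rho] the rescaled [gfun] is at least
    1/2, and its mean grows at a rate [Grho] that is small for large [rho]. *)
Lemma tail_bound (T0 e : R) : 0 <= T0 -> 0 < e -> exists rho : R, 1 <= rho /\
  \forall n \near \oo, forall k, (k <= stp (l n) T0)%N ->
    En n (\1_[set v | rho <= `|Xch (ch n) x0 k v - x0|]) <= e.
Proof.
move=> T00 e0; pose C : R := 2 * (T0 * (K + `|c| + 13)) + 1.
have C0 : 0 < C.
  by rewrite /C ltr_wpDl// !mulr_ge0// !addr_ge0// ltW.
have e1 : 0 < e / C by rewrite divr_gt0.
have [rho [r1 ri hq]] := levy_int_tail Hnu e1.
have r0 : 0 < rho by exact: lt_le_trans r1.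
exists rho; split => //.
apply: filterS2 (inv_near e1) (nbhs_infty_ger T0) => n hn Tn k kT.
have kN : (0 + k <= n.+1 * 2 ^ l n)%N.
  rewrite add0n (leq_trans kT)// stp_le// (le_trans Tn)// ler_nat//.
apply: (le_trans (@mean_lb n _ (fun v => 1 * gfun ((Xch (ch n) x0 (0 + k) v - Xch (ch n) x0 0 v) / rho)) (1 / 2) _ _ _)).
- by [].
- by move=> v; rewrite mul1r gfun_ge0.
- move=> v /=; rewrite add0n /Xch take0 /pos big_nil mulr0 addr0 mul1r => hv.
  have -> : 2^-1 = 1 ^+ 2 / 2 :> R by rewrite expr1n mul1r.
  rewrite mul1r; apply: gfun_lb => //.
  by rewrite normrM normfV (gtr0_norm r0) ler_pdivlMr// mul1r.
have := @incr_nat n 0 k rho (e / C) (fun=> 1) kN r1 hq _ _.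
rewrite (mean_cst (En_mean n)) mul1r => /(_ (fun=> erefl) (fun=> ler01)) h.
rewrite invf_div divr1; apply: (@le_trans _ _ (2 * (T0 * ((K + `|c| + 13) * (e / C))))).
  rewrite ler_pM2l//; apply: (le_trans h); apply: ler_pM.
  - by rewrite mulr_ge0// invr_ge0 ltW// pow2_gt0.
  - exact: Grho_ge0.
  - have /andP[h1 _] := stp_itv (l n) T00; apply: le_trans h1.
    by rewrite ler_pM2r ?ler_nat// invr_gt0 pow2_gt0.
  - rewrite /Grho [leRHS](_ : _ = (K + `|c|) * (e / C) + e / C + 12 * (e / C)); last by ring.
    rewrite !lerD// ?ler_pM2l//.
    by rewrite ltr_wpDr.
have -> : 2 * (T0 * ((K + `|c| + 13) * (e / C))) = e * ((C - 1) / C).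
  by rewrite /C; ring.
by rewrite ler_piMr ?(ltW e0)// ler_pdivrMr// mul1r gerBl.
Qed.

(** Rate at which the mean of [gfun] of an increment can grow, uniformly in the level. *)
Definition G0 : R := K + `|c| + 8 * Rintegral nu setT (@qfun R) + 12.

Lemma gint1 x : `|gint 1 x| <= 8 * Rintegral nu setT (@qfun R).
Proof.
have := levy_int_bound Hnu x (tfun_gfun (lexx (1 : R))).
by rewrite (_ : 2 * 4 = 8 :> R)//; lra.
Qed.

Lemma Grho1 n : Grho 1 (8 * Rintegral nu setT (@qfun R)) n <= G0.
Proof.
rewrite /Grho /G0 divr1 lerD2l -[leRHS]mulr1 ler_pM2l//.
by rewrite invf_le1 ?ltr0n// ler1n.
Qed.

Lemma G0_ge0 : 0 <= G0.
Proof. apply: le_trans (Grho1 0); apply: Grho_ge0 => //; exact: gint1. Qed.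

Lemma incr1 n k j (F : seq int -> R) : (k + j <= n.+1 * 2 ^ l n)%N ->
  adapted_at k F -> (forall s, 0 <= F s) ->
  En n (fun s => F s * gfun (Xch (ch n) x0 (k + j) s - Xch (ch n) x0 k s)) <=
  En n F * (j%:R * 2 ^- l n * G0).
Proof.
move=> kj aF F0; have := incr_nat kj (lexx 1) gint1 aF F0.
under [in X in X <= _]eq_fun do rewrite divr1.
move/le_trans; apply; rewrite ler_wpM2l ?(mean_ge0 (En_mean n))//.
rewrite ler_wpM2l ?Grho1// mulr_ge0// invr_ge0 ltW// pow2_gt0.
Qed.

Definition char_err (xi : R) n : R := 3 * n.+1%:R^-1 * (1 + 2 * xi ^+ 2).

Lemma char_bound n k j (F : seq int -> R) (xi al : R) : (k + j <= n.+1 * 2 ^ l n)%N ->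
  adapted_at k F -> (forall s, `|F s| <= 1) ->
  char_err xi n <= 1 -> 2 ^- l n * (1 + psi_re nu xi) <= 1 ->
  `|expR (psi_re nu xi * (j%:R * 2 ^- l n)) *
      En n (fun s => F s * cos (al + xi * (Sch (ch n) x0 (k + j) s - Sch (ch n) x0 k s)
        + psi_im c nu xi * (j%:R * 2 ^- l n)))
    - En n F * cos al| <=
  j%:R * 2 ^- l n * (expR (psi_re nu xi * (j%:R * 2 ^- l n)) *
    (char_cst K (psi_re nu xi) (psi_im c nu xi) xi * (char_err xi n + 2 ^- l n))).
Proof.
move=> kj aF F1 e1 d1; have ok := gl_ok (GL n).
have b0 : `|0 : R| <= K by rewrite normr0 ltW.
have h0 := ok_h ok.
have p0 : 0 <= psi_re nu xi by apply: Rintegral_ge0 => z _; rewrite subr_ge0 cos_le1.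
have er0 : 0 <= char_err xi n.
  by rewrite /char_err !mulr_ge0// addr_ge0// mulr_ge0// sqr_ge0.
have HR : `|sym_re (ch n) (xi * ch_h (ch n)) - psi_re nu xi| <= char_err xi n.
  have := gl_gen (GL n) 0 b0 (tfun_cos xi).
  rewrite levy_int_cos// mulr0 sin0 mulr0 oppr0 mulr0 add0r opprK.
  have -> : (fun z : int => cos (xi * (0 + ch_h (ch n) * z%:~R))) =
      (fun z : int => cos (0 + xi * ch_h (ch n) * z%:~R)).
    by apply/funext => z; rewrite !add0r mulrA.
  by rewrite gen_cos cos0 sin0 mul1r mul0r subr0 -normrN opprD !opprK /char_err.
have HI (b : R) : `|b| <= K ->
    `|sym_im (ch n) (xi * ch_h (ch n)) + b / ch_h (ch n) * sin (xi * ch_h (ch n))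
      - (xi * b - psi_im c nu xi)| <= char_err xi n.
  move=> bK; have := gl_gen (GL n) 0 bK (tfun_sin xi).
  have -> : (fun z : int => sin (xi * (0 + ch_h (ch n) * z%:~R))) =
      (fun z : int => sin (0 + xi * ch_h (ch n) * z%:~R)).
    by apply/funext => z; rewrite !add0r mulrA.
  rewrite gen_sin cos0 sin0 mul1r mul0r oppr0 add0r mulr0 cos0 mulr1 /char_err.
  have e := levy_int_sin Hnu c xi.
  set I := levy_int _ _ _ _ in e *.
  by have -> : (b - c) * xi + I = xi * b - psi_im c nu xi by rewrite -e; ring.
rewrite -!dE in d1 *; exact: (mean_char x0 ok p0 er0 HR HI e1 d1 al kj aF F1).
Qed.

End Approximations.

Section AlmostEverywhere.
Context {d} {T : measurableType d} {R : realType} (P : probability T R).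

Lemma superlevel_measurable (f : T -> R) (r : R) : measurable_fun setT f ->
  measurable [set w | r <= f w].
Proof.
move=> mf; have := mf measurableT `[r, +oo[%classic (measurable_itv _).
rewrite setTI; congr measurable; apply/seteqP; split => w /=; by rewrite in_itv/= andbT.
Qed.

Lemma bint_markov (f : T -> R) (r : R) : bmf setT f -> (forall w, 0 <= f w) -> 0 < r ->
  (P [set w | r <= f w]%R <= (r^-1 * Rintegral P setT f)%:E)%E.
Proof.
move=> bf f0 r0; have mA := superlevel_measurable r bf.1.
set A := [set w | _] in mA *.
have Pfin : (P setT < +oo)%E by rewrite probability_setT ltry.
have Af : P A \is a fin_num by rewrite fin_num_measure.
rewrite -(fineK Af) lee_fin -[A]setIT -(bint_indic P measurableT mA) -bintZ//.
apply: bint_le => //; first exact: bmf_indic.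
  by apply: bmfM => //; exact: bmf_cst.
move=> w _; rewrite indicE; have [|_] := boolP (w \in A).
  by rewrite inE => h; rewrite ler_pdivlMl// mulr1.
by rewrite mulr_ge0// invr_ge0 ltW.
Qed.

Lemma ae_small (B : T -> Prop) :
  (forall e : R, 0 < e -> exists A, [/\ measurable A, (P A <= e%:E)%E & forall w, ~ B w -> A w]) ->
  {ae P, forall w, B w}.
Proof.
move=> h; have /choice[A hA] : forall k : nat, exists A, [/\ measurable A,
    (P A <= (k.+1%:R^-1)%:E)%E & forall w, ~ B w -> A w].
  by move=> k; apply: h; rewrite invr_gt0.
exists (\bigcap_k A k); split.
- by apply: bigcap_measurable => // k _; have [] := hA k.
- apply/eqP; rewrite eq_le measure_ge0 andbT; apply/lee_addgt0Pr => e e0; rewrite add0e.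
  have /cvgrPdist_le/(_ _ e0)[k _ hk] := @cvg_harmonic R.
  have := hk k (leqnn k); rewrite /= sub0r normrN ger0_norm// => ke.
  have [mA PA _] := hA k.
  apply: (@le_trans _ _ (P (A k))); last by apply: (le_trans PA); rewrite lee_fin.
  apply: le_measure; rewrite ?inE//; last exact: bigcap_inf.
  by apply: bigcap_measurable => // j _; have [] := hA j.
- by move=> w nB k _; have [_ _] := hA k; exact.
Qed.

Lemma geometric_sum_le (C z : R) n : 0 <= C -> 0 <= z -> z < 1 ->
  \sum_(0 <= p < n) C * z ^+ p <= C / (1 - z).
Proof.
move=> C0 z0 z1; have z2 : 0 < 1 - z by rewrite subr_gt0.
have -> : \sum_(0 <= p < n) C * z ^+ p = C * (1 - z ^+ n) / (1 - z).
  elim: n => [|n IH]; first by rewrite big_nil expr0 subrr mulr0 mul0r.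
  by rewrite big_nat_recr//= IH exprS; field; rewrite gt_eqF.
by rewrite ler_pM2r ?invr_gt0// ler_piMr// gerBl exprn_ge0.
Qed.

Lemma borel_cantelli_geometric (F : nat -> set T) (C z : R) : (forall p, measurable (F p)) ->
  0 <= C -> 0 <= z -> z < 1 -> (forall p, (P (F p) <= (C * z ^+ p)%:E)%E) ->
  {ae P, forall w, exists p0, forall p, (p0 <= p)%N -> ~ F p w}.
Proof.
move=> mF C0 z0 z1 FC; exists (lim_sup_set F); split.
- by apply: bigcap_measurable => // n _; apply: bigcup_measurable.
- apply: lim_sup_set_cvg0 => //; apply: (@le_lt_trans _ _ (C / (1 - z))%:E); last exact: ltry.
  apply: lime_le; first exact: is_cvg_nneseries.
  apply: nearW => n; apply: (@le_trans _ _ (\sum_(0 <= p < n) (C * z ^+ p)%:E)%E).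
    by apply: lee_sum => p _; exact: FC.
  by rewrite sumEFin lee_fin; exact: geometric_sum_le.
- move=> w nw n _; apply: contrapT => h; apply: nw; exists n => p np Fp.
  by apply: h; exists p.
Qed.

End AlmostEverywhere.

Lemma ulim_le_cvg {R : realType} (U : set_system nat) {UU : UltraFilter U} (u b : nat -> R) (L : R) :
  \oo `<=` U -> ubd U u -> (\forall n \near \oo, u n <= b n) -> b @ \oo --> L -> ulim U u <= L.
Proof.
move=> Uoo bu ub bL; apply: ler_cvg_to (ubd_cvg bu) _ _; last exact: Uoo ub.
by apply: cvg_trans bL; apply: cvg_app => A; exact: Uoo.
Qed.

Section LimitProcess.
Context {R : realType} (c : R) (nu : {measure set R -> \bar R}) (a : R -> R -> R).
Variables (K x0 M0 : R).
Hypothesis Hnu : levy_measure nu.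
Hypothesis K0 : 0 < K.
Variables (ch : nat -> chain R) (l : nat -> nat).
Hypothesis GL : forall n, good_level c nu a K x0 M0 n (ch n) (l n).
Context {U : set_system nat} {UU : UltraFilter U}.
Hypothesis Uoo : \oo `<=` U.
Context {d : measure_display} {T : measurableType d} {P : probability T R}.
Context {t : T -> nat -> seq int}.

Let E := En ch l.
Let HE : forall n, is_mean (E n) := En_mean GL.

Hypothesis HI : forall A : nat -> set (seq int),
  measurable (internal_event (U := U) (t := t) A) /\
  P (internal_event (U := U) (t := t) A) = (ulim U (fun n => E n (\1_(A n))))%:E.

Definition lattice_path n (r : R) : seq int -> R := Xch (ch n) x0 (stp (l n) r).

Definition std_path (r : R) (w : T) : R := ulim U (fun n => lattice_path n r (t w n)).

(** Without boundedness along [U], the value [ulim] may be a mere default. At each fixed time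
    boundedness holds almost surely, by tightness. *)
Definition bounded_path (r : R) (w : T) := ubd U (fun n => lattice_path n r (t w n)).

Lemma nearU (Q : nat -> Prop) : (\forall n \near \oo, Q n) -> \forall n \near U, Q n.
Proof. exact: Uoo. Qed.

Lemma dt_cvg0 : (fun n => 2 ^- l n : R) @ \oo --> (0 : R).
Proof.
apply/cvgrPdist_le => e e0; apply: filterS (inv_near e0) => n hn.
rewrite sub0r normrN ger0_norm; last by rewrite invr_ge0 ltW// pow2_gt0.
exact: le_trans (dt_le GL n) hn.
Qed.

Lemma dt_cvg_lin (q g : R) : (fun n => (q + 2 ^- l n) * g) @ \oo --> q * g.
Proof.
have h : (fun n => (q + 2 ^- l n) * g) @ \oo --> (q + 0) * g.
  apply: cvgM; last exact: cvg_cst.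
  by apply: cvgD; [exact: cvg_cst|exact: dt_cvg0].
by rewrite addr0 in h.
Qed.

Lemma stp_le_N (r : R) : 0 <= r -> \forall n \near \oo, (stp (l n) r <= n.+1 * 2 ^ l n)%N.
Proof.
move=> r0; apply: filterS (nbhs_infty_ger r) => n rn; apply: stp_le => //.
by rewrite (le_trans rn)// ler_nat.
Qed.

Lemma bdd_ae r : 0 <= r -> {ae P, forall w, bounded_path r w}.
Proof.
move=> r0; apply: ae_small => e e0.
have [rho [r1 hrho]] := tail_bound Hnu K0 GL r0 e0.
pose A n : set (seq int) := [set v | rho <= `|lattice_path n r v - x0|].
exists (internal_event (U := U) (t := t) A); have [mA PA] := HI A; split => //.
  rewrite PA lee_fin; apply: ulim_le_cst.
    by apply: (ubd_E HE (B := 1)) => n w; rewrite indicE; case: (_ \in _); rewrite ?normr1 ?normr0.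
  by apply: nearU; apply: filterS hrho => n; exact.
move=> w nb; apply: contrapT => nA; apply: nb; exists (rho + `|x0|).
have [//|NU] := in_ultra_setVsetC [set n | A n (t w n)] UU.
apply: (@filterS _ U _ _ _ _ NU) => n /negP; rewrite -ltNge => h.
by rewrite -[X in `|X|](subrK x0) (le_trans (ler_normD _ _))// lerD2r ltW.
Qed.

Lemma ubd_incr r s w : bounded_path r w -> bounded_path s w -> ubd U (fun n => lattice_path n s (t w n) - lattice_path n r (t w n)).
Proof. by move=> br bs; apply: ubdD => //; exact: ubdN. Qed.

Lemma gfun_continuous : continuous (@gfun R).
Proof.
apply: (@lip_continuous _ 1) => y z; rewrite mul1r; exact: gfun_lip.
Qed.

Lemma gfun_norm (y : R) : `|gfun y| <= 1.
Proof. by rewrite ger0_norm ?gfun_ge0// gfun_le1. Qed.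

Lemma st_gfun r s w : bounded_path r w -> bounded_path s w ->
  std_part (U := U) (t := t) (fun n v => gfun (lattice_path n s v - lattice_path n r v)) w = gfun (std_path s w - std_path r w).
Proof.
move=> br bs; rewrite /std_part ulim_continuous; [|exact: gfun_continuous|exact: ubd_incr].
by rewrite /std_path -ulimB.
Qed.

Lemma mean_gfun1 r s : 0 <= r -> r <= s ->
  Rintegral P setT (std_part (U := U) (t := t) (fun n v => gfun (lattice_path n s v - lattice_path n r v))) <= (s - r) * G0 c nu K.
Proof.
move=> r0 rs; have s0 := le_trans r0 rs; have G := G0_ge0 c Hnu K0.
have gB n v : `|gfun (lattice_path n s v - lattice_path n r v)| <= 1 by exact: gfun_norm.
rewrite (st_int HE HI gB).
apply: (ulim_le_cvg Uoo (ubd_E HE gB) (b := fun n => (s - r + 2 ^- l n) * G0 c nu K)).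
  apply: filterS (stp_le_N s0) => n sN.
  have kj : (stp (l n) r + (stp (l n) s - stp (l n) r) <= n.+1 * 2 ^ l n)%N.
    by rewrite subnKC// stp_mono.
  have := incr1 Hnu GL kj (F := fun=> 1) (fun=> erefl) (fun=> ler01).
  rewrite subnKC ?stp_mono// (mean_cst (En_mean GL n)) mul1r => h.
  apply: (@le_trans _ _ (E n (fun v => 1 * gfun (lattice_path n s v - lattice_path n r v)))).
    by apply: (le_mean (HE n)) => v; rewrite mul1r.
  apply: (le_trans h); rewrite ler_wpM2r//.
  have := stp_dist (l n) r0 rs; rewrite ler_norml => /andP[_ h2]; lra.
exact: dt_cvg_lin.
Qed.

(** The first factor is known at time [s], so it can serve as the weight in the estimate of the
    second increment; this yields the product of two lengths that Chentsov's criterion requires. *)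
Lemma mean_gfun2 r s u : 0 <= r -> r <= s -> s <= u ->
  Rintegral P setT (std_part (U := U) (t := t)
    (fun n v => gfun (lattice_path n s v - lattice_path n r v) * gfun (lattice_path n u v - lattice_path n s v))) <=
  (s - r) * G0 c nu K * ((u - s) * G0 c nu K).
Proof.
move=> r0 rs su; have s0 := le_trans r0 rs; have u0 := le_trans s0 su.
have G := G0_ge0 c Hnu K0.
have gB n v : `|gfun (lattice_path n s v - lattice_path n r v) * gfun (lattice_path n u v - lattice_path n s v)| <= 1.
  by rewrite normrM -[leRHS]mulr1 ler_pM// gfun_norm.
rewrite (st_int HE HI gB).
apply: (ulim_le_cvg Uoo (ubd_E HE gB)
  (b := fun n => (s - r + 2 ^- l n) * G0 c nu K * ((u - s + 2 ^- l n) * G0 c nu K))).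
  apply: filterS2 (stp_le_N s0) (stp_le_N u0) => n sN uN.
  have kj : (stp (l n) r + (stp (l n) s - stp (l n) r) <= n.+1 * 2 ^ l n)%N.
    by rewrite subnKC// stp_mono.
  have kj' : (stp (l n) s + (stp (l n) u - stp (l n) s) <= n.+1 * 2 ^ l n)%N.
    by rewrite subnKC// stp_mono.
  have ag : adapted_at (stp (l n) s) (fun v => gfun (lattice_path n s v - lattice_path n r v)).
    move=> v; rewrite /lattice_path; congr (gfun (_ - _)); first exact: Xch_adapted.
    exact: adapted_atW (stp_mono _ rs) (@Xch_adapted _ _ _ _) _.
  have := incr1 Hnu GL kj' ag (fun=> gfun_ge0 _).
  rewrite subnKC ?stp_mono// => h; apply: (le_trans h).
  have := incr1 Hnu GL kj (F := fun=> 1) (fun=> erefl) (fun=> ler01).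
  rewrite subnKC ?stp_mono// (mean_cst (En_mean GL n)) mul1r => h'.
  have d0 : 0 <= 2 ^- l n :> R by rewrite invr_ge0 ltW// pow2_gt0.
  apply: ler_pM.
  - by apply: (mean_ge0 (HE n)) => v; exact: gfun_ge0.
  - by rewrite !mulr_ge0.
  - apply: (@le_trans _ _ (E n (fun v => 1 * gfun (lattice_path n s v - lattice_path n r v)))).
      by apply: (le_mean (HE n)) => v; rewrite mul1r.
    apply: (le_trans h'); rewrite ler_wpM2r//.
    have := stp_dist (l n) r0 rs; rewrite ler_norml => /andP[_ h2]; lra.
  - rewrite ler_wpM2r//.
    have := stp_dist (l n) s0 su; rewrite ler_norml => /andP[_ h2]; lra.
by apply: cvgM; exact: dt_cvg_lin.
Qed.

Lemma dy_ge0 p i : 0 <= dy p i :> R.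
Proof. by rewrite /dy divr_ge0// ltW// pow2_gt0. Qed.

Lemma dyadic_bdd_ae : {ae P, forall w, forall p i, bounded_path (dy p i) w}.
Proof.
by apply: ae_foralln => p; apply: ae_foralln => i; apply: bdd_ae; exact: dy_ge0.
Qed.

Lemma nat_le_pow (p : nat) : p%:R <= 10 * (11 / 10) ^+ p :> R.
Proof.
elim: p => [|p IH]; first by rewrite expr0 mulr1.
have h : (11 / 10) ^+ p >= 1 :> R by apply: exprn_ege1; lra.
by rewrite exprS -natr1; move: IH h; set q := _ ^+ p; set u := p%:R => *; lra.
Qed.

(** At level [p] there are p 2^p triples, each with mean product at most (2^-p G0)^2. Markov's
    inequality at the threshold lam^4 / 4 leaves p (2 (9/10)^4)^-p up to a constant, and
    Borel-Cantelli applies. Level [p] covers times up to [p], so every time is eventually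
    included. *)
Lemma chained_ae : {ae P, forall w, chained (fun r => std_path r w)}.
Proof.
have G := G0_ge0 c Hnu K0.
pose g p i n v : R := gfun (lattice_path n (dy p i.+1) v - lattice_path n (dy p i) v) *
  gfun (lattice_path n (dy p i.+2) v - lattice_path n (dy p i.+1) v).
pose D p i : T -> R := std_part (U := U) (t := t) (g p i).
have gB p i n v : `|g p i n v| <= 1 by rewrite normrM -[leRHS]mulr1 ler_pM// gfun_norm.
have D0 p i w : 0 <= D p i w.
  apply: ulim_ge_cst; first by apply: (ubdW (B := 1)) => n; exact: gB.
  by apply: nearW => n; rewrite mulr_ge0// gfun_ge0.
have bD p i : bmf setT (D p i) by exact: (st_bmf HE HI (gB p i)).
pose S p w : R := \sum_(i <- iota 0 (p * 2 ^ p)) D p i w.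
have bS p : bmf setT (S p) by apply: bmf_sum => i.
have S0 p w : 0 <= S p w by apply: sumr_ge0.
pose F p : set T := [set w | lam p ^+ 4 / 4 <= S p w].
(* The factor [p] is bounded by 10 (11/10)^p, which enters [C] and [z]; the threshold contributes
   4. *)
pose C : R := 40 * G0 c nu K ^+ 2.
pose z : R := (11 / 10) / (2 * (9 / 10) ^+ 4).
have lam0 p : 0 < lam p :> R by rewrite exprn_gt0.
have dyE p i : dy p i.+1 - dy p i = 2 ^- p :> R by exact: dyB.
have Pfin : (P setT < +oo)%E by rewrite probability_setT ltry.
have FC p : (P (F p) <= (C * z ^+ p)%:E)%E.
  have l4 : 0 < lam p ^+ 4 / 4 :> R by rewrite divr_gt0// exprn_gt0.
  apply: (le_trans (bint_markov P (bS p) (S0 p) l4)).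
  rewrite lee_fin bint_sum//.
  have Dle i : Rintegral P setT (D p i) <= 2 ^- p * G0 c nu K * (2 ^- p * G0 c nu K).
    have le_dy j : dy p j <= dy p j.+1 :> R.
      by rewrite -subr_ge0 dyE invr_ge0 ltW// pow2_gt0.
    have := mean_gfun2 (dy_ge0 p i) (le_dy i) (le_dy i.+1).
    by rewrite !dyE.
  apply: (@le_trans _ _ ((lam p ^+ 4 / 4)^-1 *
     \sum_(i <- iota 0 (p * 2 ^ p)) 2 ^- p * G0 c nu K * (2 ^- p * G0 c nu K))).
    by rewrite ler_pM2l ?invr_gt0//; apply: ler_sum => i _; exact: Dle.
  rewrite big_const_seq count_predT size_iota iter_addr_0 -(mulr_natl _ (p * 2 ^ p)) natrM natrX.
  have p2 := pow2_gt0 (R := R) p.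
  have -> : (lam p ^+ 4 / 4)^-1 * (p%:R * 2 ^+ p * (2 ^- p * G0 c nu K * (2 ^- p * G0 c nu K))) =
    p%:R * (4 * G0 c nu K ^+ 2 * (2 * (9 / 10) ^+ 4) ^- p).
    rewrite exprMn exprAC -/(lam p); field; rewrite !gt_eqF// exprn_gt0//.
  have -> : C * z ^+ p = 10 * (11 / 10) ^+ p * (4 * G0 c nu K ^+ 2 * (2 * (9 / 10) ^+ 4) ^- p).
    by rewrite /C /z expr_div_n; ring.
  by rewrite ler_wpM2r ?nat_le_pow// mulr_ge0// mulr_ge0// sqr_ge0.
have mF p : measurable (F p) by apply: superlevel_measurable; exact: (bS p).1.
have C0 : 0 <= C by rewrite mulr_ge0// sqr_ge0.
have z0 : 0 <= z by rewrite divr_ge0.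
have z1 : z < 1 by rewrite ltr_pdivrMr ?mul1r; lra.
have := borel_cantelli_geometric mF C0 z0 z1 FC.
apply: filterS2 dyadic_bdd_ae => w bw [p0 hp]; exists p0 => p i p0p ip.
have := hp p p0p; rewrite /F /= => /negP; rewrite -ltNge => h.
apply: contrapT => /not_orP[/negP + /negP]; rewrite -!ltNge => h1 h2.
move: h; apply/negP; rewrite -leNgt.
have iI : i \in iota 0 (p * 2 ^ p) by rewrite mem_iota; lia.
apply: (@le_trans _ _ (D p i w)); last first.
  by rewrite /S (perm_big _ (perm_to_rem iI)) big_cons lerDl sumr_ge0.
have -> : D p i w = gfun (std_path (dy p i.+1) w - std_path (dy p i) w) * gfun (std_path (dy p i.+2) w - std_path (dy p i.+1) w).
  rewrite /D /std_part /g ulimM; last 2 first.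
  - by apply: (ubdW (B := 1)) => n; exact: gfun_norm.
  - by apply: (ubdW (B := 1)) => n; exact: gfun_norm.
  by congr (_ * _); exact: st_gfun.
have l1 : lam p <= 1 :> R by apply: exprn_ile1; lra.
have -> : lam p ^+ 4 / 4 = lam p ^+ 2 / 2 * (lam p ^+ 2 / 2) :> R by field.
apply: ler_pM; rewrite ?divr_ge0 ?sqr_ge0//; apply: gfun_lb => //; exact: ltW.
Qed.

Lemma gfun_eq0 (y : R) : gfun y = 0 -> y = 0.
Proof.
rewrite /gfun => /eqP; rewrite mulf_eq0 invr_eq0 sqrf_eq0 => /orP[/eqP//|/eqP h].
by have := sqr_ge0 y; lra.
Qed.

(** Right continuity in probability: the mean of [gfun] of the increment up to [rd p q] tends to 0,
    while along almost every path it converges to [gfun] of the difference of the two values, which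
    therefore vanishes. *)
Lemma rlim_Y_ae q : 0 <= q -> {ae P, forall w, rlim (fun r => std_path r w) q = std_path q w}.
Proof.
move=> q0; have G := G0_ge0 c Hnu K0.
pose f p : T -> R := std_part (U := U) (t := t) (fun n v => gfun (lattice_path n (rd p q) v - lattice_path n q v)).
have gB p n v : `|gfun (lattice_path n (rd p q) v - lattice_path n q v)| <= 1 by exact: gfun_norm.
have bf p : bmf setT (f p) by exact: (st_bmf HE HI (gB p)).
have f0 p w : 0 <= f p w.
  apply: ulim_ge_cst; first by apply: (ubdW (B := 1)) => n; exact: gB.
  by apply: nearW => n; exact: gfun_ge0.
have fle1 p w : `|f p w| <= 1.
  rewrite ger0_norm//; apply: ulim_le_cst; first by apply: (ubdW (B := 1)) => n; exact: gB.
  by apply: nearW => n; exact: gfun_le1.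
have rdq p : q <= rd p q by rewrite ltW// rd_gt.
have fle p : Rintegral P setT (f p) <= 2 ^- p * G0 c nu K.
  apply: (le_trans (mean_gfun1 q0 (rdq p))); rewrite ler_wpM2r//.
  by rewrite lerBlDl rd_le.
have c0 : (fun p => Rintegral P setT (fun w => `|0 - f p w|)) @ \oo --> (0 : R).
  apply/cvgrPdist_le => e e0.
  have e1 : 0 < e / (G0 c nu K + 1) by rewrite divr_gt0// ltr_wpDl.
  have [m hm] := pow2_small e1; exists m => // p /= mp.
  rewrite sub0r normrN ger0_norm; last by apply: Rintegral_ge0 => w _.
  have -> : (fun w => `|0 - f p w|) = f p.
    by apply/funext => w; rewrite sub0r normrN ger0_norm.
  apply: (le_trans (fle p)); have := hm p mp; rewrite ltr_pdivlMr ?ltr_wpDl// => h.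
  by apply: (le_trans _ (ltW h)); rewrite ler_pM2l ?lerDl.
have cf : {ae P, forall w, f ^~ w @ \oo --> gfun (rlim (fun r => std_path r w) q - std_path q w)}.
  have h1 := bdd_ae q0; apply: filterS3 h1 dyadic_bdd_ae chained_ae => w bq bw cw.
  have -> : f ^~ w = fun p => gfun (std_path (rd p q) w - std_path q w).
    by apply/funext => p; apply: st_gfun => //; exact: bw.
  apply: continuous_cvg; first exact: gfun_continuous.
  by apply: cvgB; [exact: rlim_cvg|exact: cvg_cst].
have := @ae_eq_of_L1_cvg _ _ _ P f (fun=> 0) _ 1 (fun p => (bf p).1) (measurable_cst _) fle1
  (fun w => _) c0 cf.
rewrite normr0 => /(_ (fun=> ler01)).
by apply: filterS => w /esym/gfun_eq0/eqP; rewrite subr_eq0 => /eqP.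
Qed.

(** The initial value is included because a right limit at 0 equals [x0] only almost surely. *)
Definition good_path (w : T) := chained (fun r => std_path r w) /\ rlim (fun r => std_path r w) 0 = x0.

Lemma Y0 w : std_path 0 w = x0.
Proof.
rewrite /std_path -[RHS](ulim_cst (U := U)); apply: ulim_eq; apply: nearW => n.
by rewrite /lattice_path stp0 /Xch take0 /pos big_nil mulr0 addr0.
Qed.

Lemma good_ae : {ae P, forall w, good_path w}.
Proof.
apply: filterS2 chained_ae (rlim_Y_ae (lexx 0)) => w cw h; split => //.
by rewrite h Y0.
Qed.

(** Constant on the exceptional paths, so that regularity and the initial value hold everywhere, not
    only almost surely. *)
Definition limit_path (r : R) (w : T) : R := if pselect (good_path w) then rlim (fun s => std_path s w) r else x0.

Lemma XE w : (fun r => limit_path r w) = rlim (fun s => std_path s w) /\ chained (fun s => std_path s w) \/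
  (fun r => limit_path r w) = (fun=> x0).
Proof.
by have [g|g] := pselect (good_path w); [left|right]; (split; last by case: g) || idtac;
  apply/funext => r; rewrite /limit_path; case: pselect.
Qed.

Lemma X_cadlag w : cadlag (fun r => limit_path r w).
Proof.
have [[-> cw]|->] := XE w; first exact: rlim_cadlag.
by split => r _; [exact: cvg_cst|exists x0; exact: cvg_cst].
Qed.

Lemma X0 w : limit_path 0 w = x0.
Proof. by rewrite /limit_path; case: pselect => // -[]. Qed.

Lemma XY_ae q : 0 <= q -> {ae P, forall w, limit_path q w = std_path q w}.
Proof.
move=> q0; apply: filterS2 good_ae (rlim_Y_ae q0) => w gw <-.
by rewrite /limit_path; case: pselect.
Qed.

Lemma X_measurable w (D : set R) : measurable D -> (forall r, D r -> 0 <= r) ->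
  measurable_fun D (fun r => limit_path r w).
Proof.
move=> mD D0; have [[-> cw]|->] := XE w; last exact: measurable_cst.
exact: rlim_measurable.
Qed.

End LimitProcess.

Lemma bint_vanish {d} {T : measurableType d} {R : realType} (mu : {measure set T -> \bar R})
    (D : set T) (C : nat -> set T) (e : R) : measurable D -> (mu D < +oo)%E ->
  (forall k, measurable (C k)) -> (forall w, D w -> exists k0, forall k, (k0 <= k)%N -> ~ C k w) ->
  0 < e -> \forall k \near \oo, fine (mu (C k `&` D)) <= e.
Proof.
move=> mD muD mC C0 e0.
have h : (fun k => Rintegral mu D (\1_(C k))) @ \oo --> Rintegral mu D (fun=> 0).
  apply: (@bint_cvg _ _ _ mu _ mD muD _ _ 1).
  - by move=> k; apply: measurable_funTS; exact: measurable_indic.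
  - exact: measurable_cst.
  - by move=> k w _; rewrite indicE; case: (_ \in _); rewrite ?normr1 ?normr0.
  - apply: aeW => w /C0[k0 hk]; apply: (cvg_near_cst); exists k0 => // k /= kk.
    by rewrite indicE memNset//; exact: hk.
have i0 : Rintegral mu D (fun=> 0 : R) = 0 by rewrite Rintegral_cst// mul0r.
rewrite i0 in h; move/cvgrPdist_le: h => /(_ _ e0); apply: filterS => k.
rewrite bint_indic// sub0r normrN ger0_norm//; exact: fine_ge0.
Qed.

(** * Filtration and Levy property *)

Section Complete.
Context {d} {T : measurableType d} {R : realType} (P : probability T R).
Hypothesis HP : complete_prob P.

Lemma null_measurable (B : set T) : P.-negligible B -> measurable B.
Proof. by move=> [N [mN N0 BN]]; exact: HP mN N0 _ BN. Qed.

Lemma ae_measurable_fun (f g : T -> R) : measurable_fun setT f -> {ae P, forall w, f w = g w} ->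
  measurable_fun setT g.
Proof.
move=> mf fg _ B mB; rewrite setTI.
have nN : P.-negligible [set w | f w <> g w] by exact: fg.
have mN := null_measurable nN.
have -> : g @^-1` B = (f @^-1` B `&` ~` [set w | f w <> g w]) `|`
    (g @^-1` B `&` [set w | f w <> g w]).
  apply/seteqP; split => w /=.
    by move=> gB; have [e|ne] := pselect (f w = g w); [left; rewrite e; split=> // -[]|right].
  by move=> [[fB /contrapT <-]|[]].
apply: measurableU.
  apply: measurableI; last exact: measurableC.
  by have := mf measurableT B mB; rewrite setTI.
by apply: null_measurable; apply: negligibleS nN => w [].
Qed.

End Complete.

Section Filtration.
Context {R : realType} (c : R) (nu : {measure set R -> \bar R}) (a : R -> R -> R).
Variables (K x0 M0 : R).
Hypothesis Hnu : levy_measure nu.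
Hypothesis K0 : 0 < K.
Variables (ch : nat -> chain R) (l : nat -> nat).
Hypothesis GL : forall n, good_level c nu a K x0 M0 n (ch n) (l n).
Context {U : set_system nat} {UU : UltraFilter U}.
Hypothesis Uoo : \oo `<=` U.
Context {d : measure_display} {T : measurableType d} {P : probability T R}.
Context {t : T -> nat -> seq int}.

Let E := En ch l.
Let HE : forall n, is_mean (E n) := En_mean GL.

Hypothesis HP : complete_prob P.
Hypothesis HI : forall A : nat -> set (seq int),
  measurable (internal_event (U := U) (t := t) A) /\
  P (internal_event (U := U) (t := t) A) = (ulim U (fun n => E n (\1_(A n))))%:E.

Local Notation intl := (internal_event (U := U) (t := t)).
Local Notation st := (std_part (U := U) (t := t)).

Lemma intlC A : intl (fun n => ~` A n) = ~` intl A.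
Proof.
apply/seteqP; split => w /=; last first.
  by move=> nA; have [//|] := in_ultra_setVsetC [set n | A n (t w n)] UU.
move=> cA iA; have h1 : U [set n | A n (t w n)] by exact: iA.
have h2 : U [set n | ~ A n (t w n)] by exact: cA.
have : U set0 by apply: filterS2 h1 h2 => n /= a1 a2; exact: a2.
exact: filter_not_empty.
Qed.

Lemma intlU A B : intl (fun n => A n `|` B n) = intl A `|` intl B.
Proof.
apply/seteqP; split => w /=; last first.
  by move=> [h|h]; [have h' : U [set n | A n (t w n)] by exact: h|
    have h' : U [set n | B n (t w n)] by exact: h]; apply: filterS h' => n /= ?; [left|right].
move=> h; apply: contrapT => /not_orP[].
rewrite -[intl A w]/((intl A) w) => nA nB.
have hA : (~` intl A) w by [].
have hB : (~` intl B) w by [].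
move: hA hB; rewrite -!intlC => hA hB.
have h0 : U [set n | (A n `|` B n) (t w n)] by exact: h.
have h1 : U [set n | ~ A n (t w n)] by exact: hA.
have h2 : U [set n | ~ B n (t w n)] by exact: hB.
have : U set0 by apply: filterS3 h0 h1 h2 => n /= [].
exact: filter_not_empty.
Qed.

(* Events measurable at time [r]: those which, up to a set of arbitrarily small
probability, are internal and determined by the first [stp (l n) r] steps. *)
Definition Gs (r : R) : set (set T) := [set A | measurable A /\
  forall e : R, 0 < e -> exists (A' : nat -> set (seq int)) (N : set T),
    [/\ forall n, adapted_at (stp (l n) r) (A' n), measurable N, (P N <= e%:E)%E &
        forall w, ~ N w -> (A w <-> intl A' w)]].

Lemma Gs_null r B : P.-negligible B -> Gs r B.
Proof.
move=> nB; have mB := null_measurable HP nB; split => // e e0.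
exists (fun=> set0), B; split => //.
  by rewrite (proj1 (negligibleP P mB) nB) lee_fin ltW.
move=> w nw; split => // h.
have : U [set n | (set0 : set (seq int)) (t w n)] by exact: h.
by move/filter_ex => [].
Qed.

Lemma Gs_intl r A : (forall n, adapted_at (stp (l n) r) (A n)) -> Gs r (intl A).
Proof.
move=> aA; split; first exact: (HI A).1.
by move=> e e0; exists A, set0; split => //; rewrite measure0 lee_fin ltW.
Qed.

Lemma GsC r A : Gs r A -> Gs r (~` A).
Proof.
move=> [mA hA]; split; first exact: measurableC.
move=> e e0; have [A' [N [aA mN PN h]]] := hA e e0.
exists (fun n => ~` A' n), N; split => //.
  by move=> n s; rewrite /setC/=; congr (~ _); exact: aA.
by move=> w /h; rewrite intlC /setC/= => ->.
Qed.

Lemma GsU r A B : Gs r A -> Gs r B -> Gs r (A `|` B).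
Proof.
move=> [mA hA] [mB hB]; split; first exact: measurableU.
move=> e e0; have e2 : 0 < e / 2 by rewrite divr_gt0.
have [A' [N [aA mN PN h]]] := hA _ e2; have [B' [M [aB mM PM g]]] := hB _ e2.
exists (fun n => A' n `|` B' n), (N `|` M); split.
- by move=> n s; rewrite /setU/=; congr (_ \/ _); [exact: aA|exact: aB].
- exact: measurableU.
- apply: (le_trans (measureU2 _ mN mM)); rewrite [e]splitr EFinD; exact: leeD.
- move=> w /not_orP[/h hw /g gw]; rewrite intlU /setU/=.
  by rewrite (propext hw) (propext gw).
Qed.

(** Finite unions of internal events are internal, and the tolerance [e] absorbs the small remainder
    of a countable union. *)
Lemma Gs_sigma r : sigma_algebra setT (Gs r).
Proof.
have G0 : Gs r set0 by apply: Gs_null; exact: negligible_set0.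
split => // [A GA|A GA].
  by rewrite setTD; exact: GsC.
have mA k : measurable (A k) by case: (GA k).
split; first exact: bigcup_measurable.
move=> e e0; have e2 : 0 < e / 2 by rewrite divr_gt0.
pose B k := \bigcup_(i in `I_k) A i.
have GB k : Gs r (B k).
  elim: k => [|k IH]; first by rewrite /B II0 bigcup_set0.
  by rewrite /B bigcup_mkord big_ord_recr/= -bigcup_mkord; exact: GsU.
pose C k := \bigcup_i A i `\` B k.
have mC k : measurable (C k).
  by apply: measurableD; [exact: bigcup_measurable|case: (GB k)].
have Pfin : (P setT < +oo)%E by rewrite probability_setT ltry.
have [] := bint_vanish measurableT Pfin mC _ e2.
  move=> w _; have [[i _ Ai]|nA] := pselect ((\bigcup_i A i) w); last by exists 0%N => k _ [].
  by exists i.+1 => k ik [_]; apply; exists i.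
move=> k _ /(_ k (leqnn k)); rewrite setIT => Ck.
have [_ /(_ _ e2)[A' [N [aA mN PN h]]]] := GB k.
exists A', (N `|` C k); split => //.
- exact: measurableU.
- apply: (le_trans (measureU2 _ mN (mC k))); rewrite [e]splitr EFinD; apply: leeD => //.
  by move: Ck; rewrite -lee_fin fineK// fin_num_measure.
- move=> w /not_orP[/h hw nC]; rewrite -hw; split; last by move=> [i _ Ai]; exists i.
  by move=> Aw; apply: contrapT => nB; apply: nC.
Qed.

Lemma Gs_mono r s : r <= s -> Gs r `<=` Gs s.
Proof.
move=> rs A [mA hA]; split => // e /hA[A' [N [aA mN PN h]]].
exists A', N; split => // n; exact: adapted_atW (stp_mono _ rs) (aA n).
Qed.

Lemma Gs_filtration : filtration Gs.
Proof.
split; first by move=> r _; exact: Gs_sigma.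
by split => [r _ A []//|r s _]; exact: Gs_mono.
Qed.

Local Notation GT r := (g_sigma_algebraType (Gs r)).

Lemma Gs_measurableE r : (measurable : set (set (GT r))) = Gs r.
Proof. exact: measurable_g_measurableTypeE (Gs_sigma r). Qed.

(** Turning [Gs r] into the sigma-algebra of a type makes sums and limits of adapted functions
    instances of general facts on measurable functions. *)
Lemma Gs_preimage r (f : T -> R) : measurable_fun (setT : set (GT r)) f <->
  forall B, measurable B -> Gs r (f @^-1` B).
Proof.
split.
  by move=> mf B mB; have := mf measurableT B mB; rewrite setTI Gs_measurableE.
by move=> h _ B mB; rewrite setTI Gs_measurableE; exact: h.
Qed.

Lemma Gs_fun_ae r (f g : T -> R) : measurable_fun (setT : set (GT r)) f ->
  {ae P, forall w, f w = g w} -> measurable_fun (setT : set (GT r)) g.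
Proof.
move=> /Gs_preimage mf fg; apply/Gs_preimage => B mB.
have nN : P.-negligible [set w | f w <> g w] by exact: fg.
have GN := Gs_null r nN.
have -> : g @^-1` B = ~` (~` (f @^-1` B) `|` [set w | f w <> g w]) `|`
    (g @^-1` B `&` [set w | f w <> g w]).
  apply/seteqP; split => w /=.
    move=> gB; have [e|ne] := pselect (f w = g w); [left|by right].
    by move=> [|]; rewrite /= ?e.
  by move=> [/not_orP[/contrapT fB /contrapT <-]|[]].
apply: GsU; last by apply: Gs_null; apply: negligibleS nN => w [].
by apply: GsC; apply: GsU => //; apply: GsC; exact: mf.
Qed.

(** A strict lower bound on the ultralimit holds with some margin at [U]-almost every level, so a
    superlevel set is a countable union of internal events. *)
Lemma st_Gs r (f : nat -> seq int -> R) (B : R) : (forall n v, `|f n v| <= B) ->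
  (forall n, adapted_at (stp (l n) r) (f n)) -> measurable_fun (setT : set (GT r)) (st f).
Proof.
move=> fB af; 
apply: (measurability (@RGenOInfty.G R)).
  exact: RGenOInfty.measurableE.
move=> _ [_ [x ->] <-].
rewrite setTI Gs_measurableE.
have bf w : ubd U (fun n => f n (t w n)) by apply: (ubdW (B := B)) => n.
have -> : st f @^-1` `]x, +oo[ =
    \bigcup_k intl (fun n => [set v | x + k.+1%:R^-1 <= f n v]).
  apply/seteqP; split => w; rewrite /= in_itv/= andbT.
    move=> xf; have xf0 : 0 < st f w - x by rewrite subr_gt0.
    have /cvgrPdist_lt/(_ _ xf0)[k _ hk] := @cvg_harmonic R.
    have := hk k (leqnn k); rewrite /= sub0r normrN ger0_norm// => hk'.
    exists k => //; have e0 : 0 < st f w - x - k.+1%:R^-1 by rewrite subr_gt0.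
    have cf : (fun n => f n (t w n)) @ U --> st f w by exact: ubd_cvg (bf w).
    have h := (cvgrPdist_lt _ _).1 cf _ e0.
    have h' : U [set n | `|st f w - f n (t w n)| < st f w - x - k.+1%:R^-1] by exact: h.
    apply: filterS h' => n /= /(le_lt_trans (ler_norm _)); set q := _^-1; lra.
  move=> [k _ hk]; apply: (@lt_le_trans _ _ (x + k.+1%:R^-1)).
    by rewrite ltrDl invr_gt0.
  by apply: ulim_ge_cst.
by have [_ _] := Gs_sigma r; apply => k; apply: Gs_intl => n s /=; rewrite af.
Qed.

Definition limit_drift (r : R) : T -> R := st (fun n => Ach (ch n) (stp (l n) r)).

Lemma Ach_le n r v : 0 <= r -> `|Ach (ch n) (stp (l n) r) v| <= r * K.
Proof.
move=> r0; have := Ach_bound (gl_ok (GL n)) v (leq0n (stp (l n) r)).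
rewrite {2}/Ach big_ord0 subr0 subn0 (gl_d (GL n)) => h; apply: (le_trans h).
by rewrite ler_pM2r//; have /andP[] := stp_itv (l n) r0.
Qed.

Lemma V_Gs r : 0 <= r -> measurable_fun (setT : set (GT r)) (limit_drift r).
Proof.
by move=> r0; apply: (@st_Gs _ _ (r * K)) => n; [move=> v; exact: Ach_le|exact: Ach_adapted].
Qed.

Local Notation Y := (std_path x0 ch l (U := U) (t := t)).
Local Notation bdd := (bounded_path x0 ch l (U := U) (t := t)).
Local Notation Xn := (lattice_path x0 ch l).

Let bddae r : 0 <= r -> {ae P, forall w, bdd r w}.
Proof. exact: (bdd_ae Hnu K0 GL Uoo HI). Qed.

Definition clamp (m : nat) (y : R) : R := Num.max (- m%:R) (Num.min m%:R y).

Lemma clamp_norm m y : `|clamp m y| <= m%:R.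
Proof. by rewrite ler_norml le_max lexx/= ge_max ge_min lexx/= andbT (le_trans (y := 0))// oppr_le0. Qed.

Lemma clamp_id m y : `|y| <= m%:R -> clamp m y = y.
Proof. by rewrite ler_norml /clamp => /andP[h1 h2]; rewrite min_r// max_r. Qed.

(** Truncation reduces to bounded functions; where the path is bounded, the truncated values are
    eventually constant in [m]. *)
Lemma Y_Gs r : 0 <= r -> measurable_fun (setT : set (GT r)) (Y r).
Proof.
move=> r0; have bae := bddae r0.
have nb : P.-negligible [set w | ~ bdd r w] by exact: bae.
pose b := ~` [set w | ~ bdd r w].
have Gb : Gs r b by apply: GsC; exact: Gs_null.
have mb : measurable (b : set (GT r)) by rewrite Gs_measurableE.
pose f m w := st (fun n v => clamp m (Xn n r v)) w * \1_b w.
pose g w := Y r w * \1_b w.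
apply: (@Gs_fun_ae r g).
  apply: (@measurable_fun_cvg _ (GT r) R setT f g).
  - move=> m; apply: measurable_funM; last exact: measurable_indic.
    apply: (@st_Gs _ _ m%:R) => n; first by move=> v; exact: clamp_norm.
    by move=> s; congr clamp; exact: Xch_adapted.
  - move=> w _; rewrite /f /g indicE; have [|_] := boolP (w \in b); last first.
      by rewrite mulr0; under eq_fun do rewrite mulr0; exact: cvg_cst.
    rewrite inE => /contrapT[B hB].
    apply: cvg_near_cst; exists (Num.truncn `|B|).+1 => // m /= Bm.
    rewrite !mulr1; apply: ulim_eq.
    have hB' : U [set n | `|Xn n r (t w n)| <= B] by exact: hB.
    apply: filterS hB' => n /= hn; apply: clamp_id; apply: (le_trans hn).
    apply: (le_trans (ler_norm B)); apply: ltW; apply: (lt_le_trans (truncnS_gt _)).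
    by rewrite ler_nat.
by apply: filterS bae => w bw; rewrite /g indicE mem_set ?mulr1//; apply.
Qed.

Definition limit_noise (r : R) (w : T) : R := Y r w - x0 - limit_drift r w.

Local Notation Sn n r := (Sch (ch n) x0 (stp (l n) r)).

Lemma Ach_ubd (r : R) (w : T) : 0 <= r -> ubd U (fun n => Ach (ch n) (stp (l n) r) (t w n)).
Proof. by move=> r0; apply: (ubdW (B := r * K)) => n; exact: Ach_le. Qed.

Lemma Sn_ubd r w : 0 <= r -> bdd r w -> ubd U (fun n => Sn n r (t w n)).
Proof.
move=> r0 br; apply: ubdD; last by apply: ubdN; exact: Ach_ubd.
by apply: ubdD => //; exact: ubd_cst.
Qed.

Lemma Sn_ulim r w : 0 <= r -> bdd r w -> ulim U (fun n => Sn n r (t w n)) = limit_noise r w.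
Proof.
move=> r0 br; rewrite /Sch ulimB; last 2 first.
- by apply: ubdD => //; exact: ubd_cst.
- exact: Ach_ubd.
by rewrite ulimB ?ulim_cst//; exact: ubd_cst.
Qed.

(** * Conditional characteristic function of the limit noise *)

Section Levy.
Variables (s u xi al : R).
Hypotheses (s0 : 0 <= s) (su : s < u).

Local Notation rho := (psi_re nu xi).
Local Notation eta := (psi_im c nu xi).

Let u0 : 0 <= u. Proof. exact: le_trans s0 (ltW su). Qed.

(** The free phase [al] makes one statement cover the real part ([al] = 0) and the imaginary part
    ([al] = - pi / 2). *)
Let g n v : R := cos (al + xi * (Sn n u v - Sn n s v)).

Let gB n v : `|g n v| <= 1. Proof. exact: cos_max. Qed.

Let kappa : R := expR (- (u - s) * rho) * cos (al - (u - s) * eta).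

Let rho0 : 0 <= rho.
Proof. by apply: Rintegral_ge0 => z _; rewrite subr_ge0 cos_le1. Qed.

Let tau n : R := (stp (l n) u - stp (l n) s)%N%:R * 2 ^- l n.

Let tau_cvg : tau @ \oo --> u - s.
Proof.
apply/cvgrPdist_le => e e0; have /cvgrPdist_le/(_ _ e0) := dt_cvg0 GL.
apply: filterS => n; rewrite sub0r normrN ger0_norm; last first.
  by rewrite invr_ge0 ltW// pow2_gt0.
by move=> h; rewrite distrC; apply: le_trans h; exact: stp_dist (ltW su).
Qed.

Let indic_norm (A : set (seq int)) v : `|\1_A v : R| <= 1.
Proof. by rewrite indicE; case: (_ \in _); rewrite ?normr1 ?normr0. Qed.

Let fB (A : nat -> set (seq int)) n v : `|\1_(A n) v * g n v| <= 1.
Proof. by rewrite normrM -[leRHS]mulr1 ler_pM. Qed.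

(** The estimate [char_bound] is used with the phase [al - eta * tau n], which cancels its
    compensating term. The elapsed lattice time [tau n] tends to u - s, and the exponential factor
    is divided out in the limit. *)
Lemma levy_intl (A : nat -> set (seq int)) : (forall n, adapted_at (stp (l n) s) (A n)) ->
  Rintegral P setT (fun w => \1_(intl A) w * st g w) = fine (P (intl A)) * kappa.
Proof.
move=> aA.
have -> : (fun w => \1_(intl A) w * st g w) = st (fun n v => \1_(A n) v * g n v).
  apply/funext => w; rewrite /std_part ulimM ?ulim_intl//.
  - by apply: (ubdW (B := 1)).
  - by apply: (ubdW (B := 1)).
rewrite (st_int HE HI (fB A)).
have PA : fine (P (intl A)) = ulim U (fun n => E n (\1_(A n))).
  exact: (congr1 fine (HI A).2).
rewrite PA.
have bE : ubd U (fun n => E n (fun v => \1_(A n) v * g n v)) by exact: (ubd_E HE (fB A)).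
have b1 : ubd U (fun n => E n (\1_(A n))) by apply: (ubd_E HE (B := 1)).
pose ex n : R := expR (rho * tau n); pose co n : R := cos (al - eta * tau n).
have tau_b : \forall n \near \oo, `|tau n| <= u - s + 1.
  have /cvgrPdist_le/(_ _ ltr01) := tau_cvg; apply: filterS => n h.
  rewrite -[tau n](subKr (u - s)) (le_trans (ler_normB _ _))// lerD//.
  by rewrite gtr0_norm ?subr_gt0.
have ex_cvg : ex @ \oo --> expR (rho * (u - s)).
  apply: continuous_cvg; first exact: continuous_expR.
  by apply: cvgM; [exact: cvg_cst|exact: tau_cvg].
have co_cvg : co @ \oo --> cos (al - eta * (u - s)).
  apply: continuous_cvg; first exact: continuous_cos.
  by apply: cvgB; [exact: cvg_cst|apply: cvgM; [exact: cvg_cst|exact: tau_cvg]].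
have bco : ubd U co by apply: (ubdW (B := 1)) => n; exact: cos_max.
have bex : ubd U ex.
  exists (expR (rho * (u - s + 1))); apply: (nearU Uoo); apply: filterS tau_b => n hn.
  rewrite ger0_norm ?expR_ge0// ler_expR ler_wpM2l//; exact: le_trans (ler_norm _) hn.
pose er n : R := tau n * (ex n * (char_cst K rho eta xi * (char_err xi n + 2 ^- l n))).
have err_cvg : char_err xi @ \oo --> (0 : R).
  have h : char_err xi @ \oo --> 3 * 0 * (1 + 2 * xi ^+ 2).
    apply: cvgM; last exact: cvg_cst.
    by apply: cvgM; [exact: cvg_cst|exact: cvg_harmonic].
  by rewrite mulr0 mul0r in h.
have er_cvg : er @ \oo --> (0 : R).
  have h : er @ \oo --> (u - s) * (expR (rho * (u - s)) * (char_cst K rho eta xi * (0 + 0))).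
    apply: cvgM; first exact: tau_cvg.
    apply: cvgM; first exact: ex_cvg.
    apply: cvgM; first exact: cvg_cst.
    by apply: cvgD; [exact: err_cvg|exact: (dt_cvg0 GL)].
  by rewrite addr0 !mulr0 in h.
have key : ulim U (fun n => ex n * E n (fun v => \1_(A n) v * g n v) - E n (\1_(A n)) * co n) = 0.
  have bm : ubd U (fun n => ex n * E n (fun v => \1_(A n) v * g n v) - E n (\1_(A n)) * co n).
    by apply: ubdD; [exact: ubdM|apply: ubdN; exact: ubdM].
  apply/eqP; rewrite -normr_le0 -ulim_norm//.
  apply: (ulim_le_cvg Uoo _ _ er_cvg).
    by case: bm => B hB; exists B; have hB' := hB; move: hB'; apply: filterS => n; rewrite normr_id.
  have c1 : \forall n \near \oo, char_err xi n <= 1.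
    have /cvgrPdist_le/(_ _ ltr01) := err_cvg; apply: filterS => n.
    by rewrite sub0r normrN; apply: le_trans; exact: ler_norm.
  have c2 : \forall n \near \oo, 2 ^- l n * (1 + rho) <= 1.
    have r1 : 0 < (1 + rho)^-1 by rewrite invr_gt0 ltr_pwDl.
    have /cvgrPdist_le/(_ _ r1) := dt_cvg0 GL; apply: filterS => n.
    rewrite sub0r normrN => /(le_trans (ler_norm _)).
    by rewrite -ler_pdivlMr ?ltr_pwDl// mul1r.
  apply: filterS3 (stp_le_N l u0) c1 c2 => n uN e1 d1.
  have kj : (stp (l n) s + (stp (l n) u - stp (l n) s) <= n.+1 * 2 ^ l n)%N.
    by rewrite subnKC// stp_mono// ltW.
  have aF : adapted_at (stp (l n) s) (\1_(A n) : seq int -> R).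
    move=> v; rewrite !indicE; congr (nat_of_bool _)%:R.
    by apply/idP/idP; rewrite !inE (aA n v).
  have := char_bound Hnu K0 GL (al - eta * tau n) kj aF (@indic_norm _) e1 d1.
  rewrite subnKC ?stp_mono ?(ltW su)// -/(tau n) -/(ex n) -/(co n).
  have -> : (fun v => \1_(A n) v * cos (al - eta * tau n + xi * (Sn n u v - Sn n s v) + eta * tau n))
      = fun v => \1_(A n) v * g n v.
    by apply/funext => v; rewrite /g; congr (_ * cos _); ring.
  by apply.
rewrite ulimB in key; [|exact: ubdM|exact: ubdM].
rewrite !ulimM// (ulim_cvg_oo Uoo ex_cvg) (ulim_cvg_oo Uoo co_cvg) in key.
move/eqP: key; rewrite subr_eq0 => /eqP key.
rewrite /kappa mulrCA -[LHS](mulKf (lt0r_neq0 (expR_gt0 (rho * (u - s))))) key.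
by rewrite -expRN mulNr [(u - s) * rho]mulrC [(u - s) * eta]mulrC.
Qed.

(** An event of [Gs s] differs from an internal one by a small set, and both sides are continuous in
    the event. [D] may be any version of the increment; completeness makes it measurable. *)
Lemma levy_Gs (D : T -> R) (A : set T) : Gs s A ->
  {ae P, forall w, D w = limit_noise u w - limit_noise s w} ->
  Rintegral P A (fun w => cos (al + xi * D w)) = fine (P A) * kappa.
Proof.
move=> [mA hA] DS.
have Pfin : (P setT < +oo)%E by rewrite probability_setT ltry.
have bg : bmf setT (st g) by exact: (st_bmf HE HI gB).
have gD : {ae P, forall w, st g w = cos (al + xi * D w)}.
  have h1 := bddae s0; have h2 := bddae u0.
  apply: filterS3 h1 h2 DS => w bs bu ->.
  rewrite -(Sn_ulim s0 bs) -(Sn_ulim u0 bu) -ulimB; [|exact: Sn_ubd|exact: Sn_ubd].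
  have bd : ubd U (fun n => Sn n u (t w n) - Sn n s (t w n)).
    by apply: ubdD; [exact: Sn_ubd|apply: ubdN; exact: Sn_ubd].
  rewrite /std_part (ulim_continuous (f := fun y => cos (al + xi * y)))// => y.
  apply: continuous_comp; last exact: continuous_cos.
  by apply: cvgD; [exact: cvg_cst|apply: cvgM; [exact: cvg_cst|exact: cvg_id]].
have stB w : `|st g w| <= 1.
  rewrite /std_part -ulim_norm; last by apply: (ubdW (B := 1)) => n; exact: gB.
  apply: ulim_le_cst; last by apply: nearW => n; exact: gB.
  by apply: (ubdW (B := 1)) => n; rewrite normr_id; exact: gB.
have mD := ae_measurable_fun HP bg.1 gD.
have -> : Rintegral P A (fun w => cos (al + xi * D w)) = Rintegral P setT (fun w => \1_A w * st g w).
  rewrite Rintegral_mkcond /Rintegral; congr fine; apply: ae_eq_integral => //.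
  - apply/measurable_EFinP; apply/(measurable_restrictT _ mA).1; exact: measurable_funTS.
  - apply/measurable_EFinP; apply: measurable_funM; [exact: measurable_indic|exact: bg.1].
  - by apply: filterS gD => w /= e _; rewrite patchE indicE; case: ifP; rewrite ?mul1r ?mul0r ?e.
have bi (B : set T) : measurable B -> bmf setT (fun w => \1_B w * st g w).
  by move=> mB; apply: bmfM => //; exact: bmf_indic.
have kB : `|kappa| <= 1.
  rewrite normrM -[leRHS]mulr1 ler_pM ?cos_max// ger0_norm ?expR_ge0//.
  by rewrite -expR0 ler_expR mulNr oppr_le0 mulr_ge0// subr_ge0 ltW.
have indB (B B' N : set T) w : (~ N w -> (B w <-> B' w)) -> `|\1_B w - \1_B' w| <= \1_N w :> R.
  move=> h; rewrite !indicE; have [Nw|] := boolP (w \in N).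
    by case: (w \in B); case: (w \in B'); rewrite ?subrr ?subr0 ?sub0r ?normrN ?normr0 ?normr1.
  rewrite notin_setE => /h e; have -> : (w \in B) = (w \in B').
    by apply/idP/idP; rewrite !inE e.
  by rewrite subrr normr0.
apply/eqP; rewrite -subr_eq0 -normr_le0; apply/ler_addgt0Pr => e e0; rewrite add0r.
have e2 : 0 < e / 2 by rewrite divr_gt0.
have [A' [N [aA mN PN hN]]] := hA _ e2.
have PNe : fine (P N) <= e / 2 by rewrite -lee_fin fineK ?fin_num_measure.
have mA' := (HI A').1.
have lA := levy_intl aA.
have iN : Rintegral P setT (\1_N) = fine (P N) by rewrite bint_indic// setIT.
have dI : `|Rintegral P setT (fun w => \1_A w * st g w) -
    Rintegral P setT (fun w => \1_(intl A') w * st g w)| <= e / 2.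
  rewrite -(bintB measurableT Pfin (bi _ mA) (bi _ mA')).
  apply: (le_trans (bint_norm measurableT Pfin (bmfB (bi _ mA) (bi _ mA')))).
  apply: le_trans PNe; rewrite -iN; apply: bint_le => //.
  - by apply: bmf_norm; apply: bmfB; exact: bi.
  - exact: bmf_indic.
  - move=> w _; rewrite -mulrBl normrM -[leRHS]mulr1; apply: ler_pM => //.
    exact: indB (hN w).
have dP : `|fine (P A) - fine (P (intl A'))| <= e / 2.
  have iA (B : set T) : measurable B -> fine (P B) = Rintegral P setT (\1_B).
    by move=> mB; rewrite bint_indic// setIT.
  have bb (B : set T) : measurable B -> bmf setT (\1_B : T -> R) by move=> mB; exact: bmf_indic.
  rewrite (iA _ mA) (iA _ mA') -(bintB measurableT Pfin (bb _ mA) (bb _ mA')).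
  apply: (le_trans (bint_norm measurableT Pfin (bmfB (bb _ mA) (bb _ mA')))).
  apply: le_trans PNe; rewrite -iN; apply: bint_le => //.
  - by apply: bmf_norm; apply: bmfB; exact: bb.
  - exact: bmf_indic.
  - by move=> w _; exact: indB (hN w).
set I := Rintegral _ _ _ in dI *; set I' := Rintegral _ _ _ in lA dI.
have -> : I - fine (P A) * kappa = (I - I') - (fine (P A) - fine (P (intl A'))) * kappa.
  by rewrite lA; ring.
rewrite (le_trans (ler_normB _ _))// [e]splitr lerD// normrM.
by rewrite -[leRHS]mulr1; apply: ler_pM.
Qed.

End Levy.

End Filtration.

(** * Identification of the drift *)

Section OccupationFunctional.
Context {R : realType} (c : R) (nu : {measure set R -> \bar R}) (a : R -> R -> R).
Variables (K x0 M0 : R).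
Hypothesis Hnu : levy_measure nu.
Hypothesis K0 : 0 < K.
Variables (ch : nat -> chain R) (l : nat -> nat).
Hypothesis GL : forall n, good_level c nu a K x0 M0 n (ch n) (l n).
Context {U : set_system nat} {UU : UltraFilter U}.
Hypothesis Uoo : \oo `<=` U.
Context {d : measure_display} {T : measurableType d} {P : probability T R}.
Context {t : T -> nat -> seq int}.

Let E := En ch l.
Let HE : forall n, is_mean (E n) := En_mean GL.

Hypothesis HI : forall A : nat -> set (seq int),
  measurable (internal_event (U := U) (t := t) A) /\
  P (internal_event (U := U) (t := t) A) = (ulim U (fun n => E n (\1_(A n))))%:E.

Local Notation st := (std_part (U := U) (t := t)).

Let d0 n : 0 < 2 ^- l n :> R. Proof. by rewrite invr_gt0 pow2_gt0. Qed.
Let h0 n : 0 < ch_h (ch n). Proof. exact: (ok_h (gl_ok (GL n))). Qed.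

Definition avn n (f : R * R -> R) k j := avg x0 (ch_h (ch n)) (2 ^- l n) f k j.

(** Occupation functional of the chain. The test function enters through cell averages, so it need
    not be continuous; for the drift coefficient this is the accumulated drift [Ach]. *)
Definition riemann_sum n k (f : R * R -> R) (v : seq int) : R :=
  \sum_(i < k) 2 ^- l n * avn n f i (pos (take i v)).

Implicit Types f g : R * R -> R.

Definition bmeas2 f := bmf setT f.

Lemma bm2_cell n k j f : bmeas2 f -> bmf (cell x0 (ch_h (ch n)) (2 ^- l n) k j) f.
Proof. by apply: bmfS. Qed.

Lemma mn_norm n T0 f (B : R) v : 0 <= T0 -> bmeas2 f -> (forall p, `|f p| <= B) ->
  `|riemann_sum n (stp (l n) T0) f v| <= T0 * B.
Proof.
move=> T00 bf fB; have B0 : 0 <= B by exact: le_trans (fB (0, 0)).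
rewrite /riemann_sum (le_trans (ler_norm_sum _ _ _))//.
apply: (@le_trans _ _ (\sum_(i < stp (l n) T0) 2 ^- l n * B)).
  apply: ler_sum => i _; rewrite normrM gtr0_norm// ler_pM2l//.
  by apply: avg_norm_le => //; exact: bm2_cell.
rewrite sumr_const card_ord -(mulr_natl _ (stp (l n) T0)) mulrA ler_wpM2r//.
by have /andP[] := stp_itv (l n) T00.
Qed.

Lemma mn_le n k f g v : bmeas2 f -> bmeas2 g -> (forall p, f p <= g p) -> riemann_sum n k f v <= riemann_sum n k g v.
Proof.
move=> bf bg fg; apply: ler_sum => i _; rewrite ler_pM2l//.
by apply: avg_le; [exact: h0|exact: d0|exact: bm2_cell|exact: bm2_cell|move=> p _; exact: fg].
Qed.

Lemma mnD n k f g v : bmeas2 f -> bmeas2 g -> riemann_sum n k (fun p => f p + g p) v = riemann_sum n k f v + riemann_sum n k g v.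
Proof.
move=> bf bg; rewrite /riemann_sum -big_split; apply: eq_bigr => i _ /=.
by rewrite /avn avgD ?mulrDr//; exact: bm2_cell.
Qed.

Lemma mnZ n k r f v : bmeas2 f -> riemann_sum n k (fun p => r * f p) v = r * riemann_sum n k f v.
Proof.
move=> bf; rewrite /riemann_sum mulr_sumr; apply: eq_bigr => i _ /=.
by rewrite /avn avgZ 1?mulrCA//; exact: bm2_cell.
Qed.

Definition limit_riemann (T0 : R) f : T -> R := st (fun n => riemann_sum n (stp (l n) T0) f).

Section FixedTime.
Variable T0 : R.
Hypothesis T00 : 0 <= T0.

Lemma mT_ubd f w : bmeas2 f -> ubd U (fun n => riemann_sum n (stp (l n) T0) f (t w n)).
Proof.
by move=> bf; have [_ [B hB]] := bf; apply: (ubdW (B := T0 * B)) => n; apply: mn_norm => // p; exact: hB.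
Qed.

Lemma mT_bmf f : bmeas2 f -> bmf setT (limit_riemann T0 f).
Proof.
move=> bf; have [_ [B hB]] := bf; apply: (st_bmf HE HI (B := T0 * B)) => n v.
by apply: mn_norm => // p; exact: hB.
Qed.

Lemma mT_norm f (B : R) w : bmeas2 f -> (forall p, `|f p| <= B) -> `|limit_riemann T0 f w| <= T0 * B.
Proof.
move=> bf fB; rewrite /limit_riemann /std_part -ulim_norm; last exact: mT_ubd.
apply: ulim_le_cst; last by apply: nearW => n; exact: mn_norm.
by apply: (ubdW (B := T0 * B)) => n; rewrite normr_id; exact: mn_norm.
Qed.

Lemma mT_int f : bmeas2 f ->
  Rintegral P setT (limit_riemann T0 f) = ulim U (fun n => E n (riemann_sum n (stp (l n) T0) f)).
Proof.
move=> bf; have [_ [B hB]] := bf; apply: (st_int HE HI (B := T0 * B)) => n v.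
by apply: mn_norm => // p; exact: hB.
Qed.

Lemma mT_E_ubd f : bmeas2 f -> ubd U (fun n => E n (riemann_sum n (stp (l n) T0) f)).
Proof.
move=> bf; have [_ [B hB]] := bf; apply: (ubd_E HE (B := T0 * B)) => n v.
by apply: mn_norm => // p; exact: hB.
Qed.

Lemma mTD f g w : bmeas2 f -> bmeas2 g -> limit_riemann T0 (fun p => f p + g p) w = limit_riemann T0 f w + limit_riemann T0 g w.
Proof.
move=> bf bg; rewrite /limit_riemann /std_part -ulimD; [|exact: mT_ubd|exact: mT_ubd].
by congr ulim; apply/funext => n; exact: mnD.
Qed.

Lemma mTZ r f w : bmeas2 f -> limit_riemann T0 (fun p => r * f p) w = r * limit_riemann T0 f w.
Proof.
move=> bf; rewrite /limit_riemann /std_part -ulimZ; last exact: mT_ubd.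
by congr ulim; apply/funext => n; exact: mnZ.
Qed.

Lemma mTB f g w : bmeas2 f -> bmeas2 g -> limit_riemann T0 (fun p => f p - g p) w = limit_riemann T0 f w - limit_riemann T0 g w.
Proof.
move=> bf bg; have -> : (fun p => f p - g p) = (fun p => f p + (-1) * g p).
  by apply/funext => p; rewrite mulN1r.
by rewrite mTD ?mTZ ?mulN1r//; apply: bmfM => //; exact: bmf_cst.
Qed.

Lemma mT_le f g w : bmeas2 f -> bmeas2 g -> (forall p, f p <= g p) -> limit_riemann T0 f w <= limit_riemann T0 g w.
Proof.
move=> bf bg fg; apply: ulim_mono; [exact: mT_ubd|exact: mT_ubd|].
by apply: nearW => n; exact: mn_le.
Qed.

Lemma mT_dist f g w : bmeas2 f -> bmeas2 g -> `|limit_riemann T0 f w - limit_riemann T0 g w| <= limit_riemann T0 (fun p => `|f p - g p|) w.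
Proof.
move=> bf bg; rewrite -mTB//; have b := bmfB bf bg; have b' := bmf_norm b.
rewrite ler_norml; apply/andP; split; last by apply: mT_le => // p; exact: ler_norm.
rewrite -mulN1r -mTZ//; apply: mT_le => //.
  by apply: bmfM => //; exact: bmf_cst.
by move=> p; rewrite mulN1r lerNl -normrN ler_norm.
Qed.

(** Pays for the times before [tau], at which the time weight in the Krylov estimate is too small to
    be removed. *)
Lemma small_times k (tau dl : R) : 0 < dl -> 0 <= tau ->
  \sum_(i < k) dl * (i%:R * dl < tau)%R%:R <= tau + dl.
Proof.
move=> dl0 tau0; suff [] : \sum_(i < k) dl * (i%:R * dl < tau)%R%:R <= tau + dl /\
   \sum_(i < k) dl * (i%:R * dl < tau)%R%:R <= k%:R * dl by [].
elim: k => [|k [IH1 IH2]]; first by rewrite big_ord0 mul0r addr_ge0// ltW.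
rewrite big_ord_recr/= -natr1 mulrDl mul1r.
have [kt|_] := ltP (k%:R * dl) tau; rewrite ?mulr1 ?mulr0 ?addr0.
  by split; rewrite lerD2r// (le_trans IH2)// ltW.
by split => //; rewrite (le_trans IH2)// lerDl ltW.
Qed.

Definition kcst : R := krylov_cst M0 (4 * K) T0.

Lemma kcst_mono s : 0 <= s -> s <= T0 -> krylov_cst M0 (4 * K) s <= kcst.
Proof.
move=> s0 sT; rewrite /kcst /krylov_cst lerD2r ler_wpM2r//.
  by rewrite addr_ge0// sqr_ge0.
by rewrite ler_pM2l// lerXn2r ?nnegrE.
Qed.

Lemma kcst_ge0 : 0 <= kcst.
Proof.
rewrite /kcst /krylov_cst addr_ge0// ?divr_ge0 ?sqr_ge0// !mulr_ge0 ?sqr_ge0//.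
by rewrite addr_ge0// sqr_ge0.
Qed.

(** The spatial margin contains the cells of points within [rho] of [x0], as [h] is at most 1; the
    extra unit of time keeps the box nondegenerate when [T0] is 0. *)
Definition box (rho : R) : set (R * R) :=
  `[0, T0 + 1[%classic `*` `[x0 - rho - 1, x0 + rho + 1[%classic.

Lemma measurable_box rho : measurable (box rho).
Proof. by apply: measurableX; exact: measurable_itv. Qed.

Lemma box_lty rho : 0 < rho -> (@lam2 R (box rho) < +oo)%E.
Proof.
move=> r0; have h1 : 0 < T0 + 1 by rewrite ltr_wpDl.
have h2 : x0 - rho - 1 < x0 + rho + 1 by rewrite -addrA -[ltRHS]addrA ltrD2l -opprD gt0_cp// addr_gt0.
by rewrite /box lam2_itv// ltry.
Qed.

(** Early times cost at most tau + dt, exits from the ball of radius [rho] at most T0 q. At the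
    remaining times and places the weight is at least [tau], and it is removed from the weighted
    Krylov bound at the price of 1 / tau. *)
Lemma krylov_level n rho (A : set (R * R)) (tau eta q : R) :
  0 < tau -> 0 < eta -> 0 < rho -> measurable A -> T0 <= n.+1%:R ->
  (forall k, (k <= stp (l n) T0)%N ->
    E n (\1_[set v | rho <= `|Xch (ch n) x0 k v - x0|]) <= q) ->
  E n (riemann_sum n (stp (l n) T0) (\1_A)) <= tau + 2 ^- l n + T0 * q +
   tau^-1 * (2 * T0 * kcst * eta + fine (@lam2 R (A `&` box rho)) / (2 * eta)).
Proof.
move=> tau0 eta0 rho0 mA Tn tl; set k := stp (l n) T0.
pose B := A `&` box rho.
have mB : measurable B by apply: measurableI => //; exact: measurable_box.
have Blty : (@lam2 R B < +oo)%E.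
  apply: le_lt_trans (box_lty rho0); apply: le_measure; rewrite ?inE.
  - exact: mB.
  - exact: measurable_box.
  - exact: subIsetr.
have kd : k%:R * 2 ^- l n <= T0 by have /andP[] := stp_itv (l n) T00.
have hle1 : ch_h (ch n) <= 1.
  by apply: (le_trans (gl_h (GL n))); rewrite invf_le1 ?ltr0n// ler1n.
have bA : bmeas2 (\1_A) by exact: bmf_indic.
have bB : bmeas2 (\1_B) by exact: bmf_indic.
have avB i j : 0 <= avn n (\1_B) i j <= 1 by exact: avg_indic_itv.
have avA i j : 0 <= avn n (\1_A) i j <= 1 by exact: avg_indic_itv.
pose tailset i : set (seq int) := [set v | rho <= `|Xch (ch n) x0 i v - x0|].
have term (i : 'I_k) v : avn n (\1_A) i (pos (take i v)) <=
    avn n (\1_B) i (pos (take i v)) + \1_(tailset i) v.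
  rewrite indicE; have [_|] := boolP (v \in tailset i).
    have /andP[_ h1] := avA i (pos (take i v)); have /andP[h2 _] := avB i (pos (take i v)).
    by apply: (le_trans h1); rewrite lerDr.
  rewrite notin_setE /tailset /= /Xch => /negP; rewrite -ltNge addrAC subrr add0r => hj.
  rewrite addr0; apply: avg_le; [exact: h0|exact: d0|exact: bm2_cell|exact: bm2_cell|].
  move=> p; rewrite /cell /= !in_itv/= => -[/andP[p1 p2] /andP[p3 p4]].
  suff bp : box rho p.
    rewrite !indicE; have [|] := boolP (p \in A); last by [].
    by rewrite inE => Ap; rewrite mem_set.
  rewrite /box /= !in_itv/=; move: hj; rewrite ltr_norml => /andP[j1 j2].
  split; apply/andP; split.
  - by apply: le_trans p1; rewrite mulr_ge0// ltW.
  - apply: (lt_le_trans p2); apply: (@le_trans _ _ (k%:R * 2 ^- l n)).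
      by rewrite ler_pM2r// ler_nat.
    by apply: (le_trans kd); rewrite lerDl.
  - apply: le_trans p3; move: j1; set z := _ * _; lra.
  - apply: (lt_le_trans p4); rewrite intrD mulrDr mulr1.
    move: j2 hle1; set z := _ * _; set hh := ch_h _; lra.
have kN : (k <= n.+1 * 2 ^ l n)%N by exact: stp_le.
have [Bd kry] := gl_krylov (GL n).
have := kry k (fun i j => avn n (\1_B) i j) eta kN eta0; rewrite (gl_d (GL n)) => {}kry.
have sumB : 2 ^- l n * ch_h (ch n) / (2 * eta) *
    \sum_(i < k) \sum_(x <- srange Bd) avn n (\1_B) i x ^+ 2 <= fine (@lam2 R B) / (2 * eta).
  rewrite mulrAC ler_pM2r ?invr_gt0 ?mulr_gt0//.
  apply: le_trans (sum_avg_indic x0 (h0 n) (d0 n) k mB Blty (srange_uniq Bd)).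
  rewrite ler_pM2l ?mulr_gt0//; apply: ler_sum => i _; apply: ler_sum => x _.
  have /andP[b0 b1] := avB i x; by rewrite expr2 ler_piMl.
have main2 : \sum_(i < k) 2 ^- l n * (i%:R * 2 ^- l n * E n (fun v => avn n (\1_B) i (pos (take i v)))) <=
   2 * T0 * kcst * eta + fine (@lam2 R B) / (2 * eta).
  apply: (le_trans kry); apply: lerD => //.
  rewrite ler_pM2r//; apply: ler_pM.
  - by rewrite !mulr_ge0// ltW.
  - rewrite /krylov_cst addr_ge0// ?divr_ge0 ?sqr_ge0// !mulr_ge0 ?sqr_ge0//.
    by rewrite addr_ge0// sqr_ge0.
  - by rewrite ler_pM2l.
  - by apply: kcst_mono => //; rewrite mulr_ge0// ltW.
have EB i : 0 <= E n (fun v => avn n (\1_B) i (pos (take i v))) <= 1.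
  apply/andP; split; first by apply: (mean_ge0 (HE n)) => v; have /andP[] := avB i (pos (take i v)).
  by rewrite -[leRHS](mean1 (HE n)); apply: (le_mean (HE n)) => v; have /andP[] := avB i (pos (take i v)).
have -> : E n (riemann_sum n k (\1_A)) = \sum_(i < k) 2 ^- l n * E n (fun v => avn n (\1_A) i (pos (take i v))).
  by rewrite /riemann_sum (mean_sum (HE n)); apply: eq_bigr => i _; rewrite (meanZ (HE n)).
apply: (@le_trans _ _ (\sum_(i < k) (2 ^- l n * (i%:R * 2 ^- l n < tau)%R%:R + 2 ^- l n * q +
   tau^-1 * (2 ^- l n * (i%:R * 2 ^- l n * E n (fun v => avn n (\1_B) i (pos (take i v)))))))).
  apply: ler_sum => i _; have -> : tau^-1 * (2 ^- l n * (i%:R * 2 ^- l n *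
      E n (fun v => avn n (\1_B) i (pos (take i v))))) = 2 ^- l n * (tau^-1 * (i%:R * 2 ^- l n *
      E n (fun v => avn n (\1_B) i (pos (take i v))))) by ring.
  rewrite -!mulrDr ler_pM2l//.
  apply: (@le_trans _ _ (E n (fun v => avn n (\1_B) i (pos (take i v))) + q)).
    apply: (@le_trans _ _ (E n (fun v => avn n (\1_B) i (pos (take i v)) + \1_(tailset i) v))).
      by apply: (le_mean (HE n)) => v; exact: term.
    by rewrite (meanD (HE n)) lerD2l; apply: tl; exact: ltnW (ltn_ord i).
  rewrite addrAC lerD2r; have /andP[e1 e2] := EB i.
  have [it|it] := ltP (i%:R * 2 ^- l n) tau.
    by apply: (le_trans e2); rewrite lerDl !mulr_ge0// ?invr_ge0 ltW.
  by rewrite add0r mulrA ler_peMl// ler_pdivlMl// mulr1.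
rewrite !big_split/=; apply: lerD; last by rewrite -mulr_sumr ler_pM2l ?invr_gt0.
apply: lerD; first exact: small_times (d0 n) (ltW tau0).
rewrite sumr_const card_ord -(mulr_natl _ k) mulrA ler_wpM2r//.
by apply: le_trans (tl 0%N (leq0n _)); apply: (mean_ge0 (HE n)).
Qed.

(** The radius and [tau] control the tails and the early times, then [eta] the constant term of the
    Krylov bound, and finally [dl] the measure of the set; with the time step this makes five errors
    of e / 5. Only the part of [A] in a bounded box matters, so [A] may have infinite measure. *)
Lemma krylov_limit (e : R) : 0 < e -> exists D dl, [/\ measurable D, (@lam2 R D < +oo)%E, 0 < dl &
  forall A, measurable A -> fine (@lam2 R (A `&` D)) <= dl ->
    Rintegral P setT (limit_riemann T0 (\1_A)) <= e].
Proof.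
move=> e0; have e5 : 0 < e / 5 by rewrite divr_gt0.
have T1 : 0 < T0 + 1 by rewrite ltr_wpDl.
have q0 : 0 < e / 5 / (T0 + 1) by rewrite divr_gt0.
have [rho [r1 tl]] := tail_bound Hnu K0 GL T00 q0.
have r0 : 0 < rho by exact: lt_le_trans r1.
pose tau := e / 5; pose C : R := 2 * T0 * kcst + 1.
have C0 : 0 < C by rewrite ltr_wpDl// !mulr_ge0// kcst_ge0.
pose eta := e / 5 * tau / C; have eta0 : 0 < eta by rewrite divr_gt0// mulr_gt0.
exists (box rho), (e / 5 * tau * (2 * eta)); split.
- exact: measurable_box.
- exact: box_lty.
- by apply: mulr_gt0; apply: mulr_gt0.
move=> A mA hA; have bA : bmeas2 (\1_A) by exact: bmf_indic.
rewrite mT_int//; apply: ulim_le_cst; first exact: mT_E_ubd.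
apply: (nearU Uoo); apply: filterS3 (inv_near e5) (nbhs_infty_ger T0) tl => n en Tn hn.
have Tn' : T0 <= n.+1%:R by apply: (le_trans Tn); rewrite ler_nat.
apply: (le_trans (krylov_level e5 eta0 r0 mA Tn' hn)).
have b1 : 2 ^- l n <= e / 5 by exact: le_trans (dt_le GL n) en.
have b2 : T0 * (e / 5 / (T0 + 1)) <= e / 5.
  by rewrite mulrA ler_pdivrMr// mulrC ler_pM2l// lerDl.
have b3 : (e / 5)^-1 * (2 * T0 * kcst * eta) <= e / 5.
  rewrite ler_pdivrMl// /eta mulrA ler_pdivrMr//.
  have -> : 2 * T0 * kcst * (e / 5 * tau) = e / 5 * (e / 5) * (2 * T0 * kcst) by rewrite /tau; ring.
  by rewrite ler_pM2l ?mulr_gt0// /C lerDl.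
have b4 : (e / 5)^-1 * (fine (@lam2 R (A `&` box rho)) / (2 * eta)) <= e / 5.
  have hh : fine (@lam2 R (A `&` box rho)) / (2 * eta) <= e / 5 * (e / 5).
    rewrite ler_pdivrMr; first exact: hA.
    exact: mulr_gt0.
  by rewrite ler_pdivrMl.
rewrite mulrDr.
rewrite [leRHS](_ : _ = e / 5 + e / 5 + e / 5 + (e / 5 + e / 5)); last by field.
by apply: lerD; [apply: lerD => //; apply: lerD|apply: lerD].
Qed.

(** In the manner of Egorov: the set where [fk k] is far from [f] has vanishing measure inside the
    box, so by the Krylov estimate the chain rarely visits it; elsewhere the difference is uniformly
    small. *)
Lemma mT_cvg f (fk : nat -> R * R -> R) (B : R) : bmeas2 f -> (forall k, bmeas2 (fk k)) ->
  (forall p, `|f p| <= B) -> (forall k p, `|fk k p| <= B) ->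
  (forall p, fk ^~ p @ \oo --> f p) ->
  (fun k => Rintegral P setT (fun w => `|limit_riemann T0 f w - limit_riemann T0 (fk k) w|)) @ \oo --> (0 : R).
Proof.
move=> bf bfk fB fkB cf.
have B0 : 0 <= B by exact: le_trans (fB (0, 0)).
have Pfin : (P setT < +oo)%E by rewrite probability_setT ltry.
apply/cvgrPdist_le => e e0.
have T1 : 0 < T0 + 1 by rewrite ltr_wpDl.
pose e1 := e / 2 / (T0 + 1); have e10 : 0 < e1 by rewrite !divr_gt0.
pose e2 := e / 2 / (2 * B + 1).
have B1 : 0 < 2 * B + 1 by rewrite ltr_wpDl// mulr_ge0.
have e20 : 0 < e2 by rewrite !divr_gt0.
have [D [dl [mD Dlty dl0 hD]]] := krylov_limit e20.
pose A k := [set p | e1 <= `|f p - fk k p|].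
have bd k : bmeas2 (fun p => `|f p - fk k p|) by exact: (bmf_norm (bmfB bf (bfk k))).
have mA k : measurable (A k).
  have := (bd k).1 measurableT `[e1, +oo[%classic (measurable_itv _).
  rewrite setTI; congr measurable; apply/seteqP; split => p /=; by rewrite in_itv/= andbT.
have vanish : forall p, D p -> exists k0, forall k, (k0 <= k)%N -> ~ A k p.
  move=> p _; have /cvgrPdist_lt/(_ _ e10)[k0 _ hk] := cf p.
  by exists k0 => k kk; apply/negP; rewrite -ltNge; exact: hk k kk.
have := bint_vanish mD Dlty mA vanish dl0; apply: filterS => k hk.
have bA : bmeas2 (\1_(A k)) by exact: bmf_indic.
have be : bmeas2 (fun p => e1 * 1 + 2 * B * \1_(A k) p).
  by apply: bmfD; apply: bmfM => //; exact: bmf_cst.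
have bnd w : `|limit_riemann T0 f w - limit_riemann T0 (fk k) w| <= e1 * T0 + 2 * B * limit_riemann T0 (\1_(A k)) w.
  apply: (le_trans (mT_dist w bf (bfk k))).
  apply: (@le_trans _ _ (limit_riemann T0 (fun p => e1 * 1 + 2 * B * \1_(A k) p) w)).
    apply: mT_le => // p; rewrite mulr1 indicE; have [_|] := boolP (p \in A k).
      rewrite mulr1 (le_trans (ler_normB _ _))//.
      apply: (@le_trans _ _ (B + B)); first exact: lerD.
      by rewrite (mulr_natl B 2) mulr2n lerDr ltW.
    by rewrite notin_setE /A /= => /negP; rewrite -ltNge mulr0 addr0; exact: ltW.
  rewrite mTD; last 2 first.
  - by apply: bmfM; exact: bmf_cst.
  - by apply: bmfM => //; exact: bmf_cst.
  rewrite !mTZ//; last exact: bmf_cst.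
  rewrite lerD2r ler_pM2l//; apply: (le_trans (ler_norm _)).
  rewrite -[leRHS]mulr1; apply: mT_norm; first exact: bmf_cst.
  by move=> p; rewrite normr1.
have bm := mT_bmf bA; have bmf1 := mT_bmf bf; have bmf2 := mT_bmf (bfk k).
rewrite sub0r normrN ger0_norm; last by apply: Rintegral_ge0 => w _.
apply: (@le_trans _ _ (Rintegral P setT (fun w => e1 * T0 + 2 * B * limit_riemann T0 (\1_(A k)) w))).
  apply: bint_le => //.
  - by apply: bmf_norm; exact: bmfB.
  - by apply: bmfD; [exact: bmf_cst|apply: bmfM => //; exact: bmf_cst].
rewrite bintD//; [|exact: bmf_cst|by apply: bmfM => //; exact: bmf_cst].
rewrite bintZ// (P_cst (P := P)) [e]splitr; apply: lerD.
  by rewrite /e1 mulrAC ler_pdivrMr// ler_pM2l ?divr_gt0// lerDl.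
apply: (@le_trans _ _ (2 * B * e2)).
  by rewrite ler_wpM2l// ?mulr_ge0//; exact: hD.
by rewrite /e2 mulrA ler_pdivrMr// mulrC ler_pM2l ?divr_gt0// lerDl.
Qed.

End FixedTime.

End OccupationFunctional.

Section StepIntegral.
Context {R : realType}.
Local Notation mu := (@lebesgue_measure R).

Lemma mu_itv_lty (u v : R) : (mu `[u, v[%classic < +oo)%E.
Proof. by rewrite lebesgue_measure_itv/=; case: ifP => _; rewrite ?ltry// -EFinB ltry. Qed.

Lemma step_integral (G : nat -> R) p M :
  Rintegral mu `[0, dy p M[%classic (fun s => G (Num.truncn (s * 2 ^+ p))) =
  \sum_(i < M) 2 ^- p * G i.
Proof.
set D := `[0, dy p M[%classic.
have mD : measurable D by exact: measurable_itv.
pose I (i : nat) : set R := `[dy p i, dy p i.+1[%classic.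
have mI i : measurable (I i) by exact: measurable_itv.
have lt_dy i j : (dy p i < dy p j :> R) = (i < j)%N.
  by rewrite /dy ltr_pM2r ?ltr_nat// invr_gt0 pow2_gt0.
have le_dy i j : (dy p i <= dy p j :> R) = (i <= j)%N.
  by rewrite /dy ler_pM2r ?ler_nat// invr_gt0 pow2_gt0.
have dy0 : dy p 0 = 0 :> R by rewrite /dy mul0r.
have Dlty := mu_itv_lty 0 (dy p M).
have bI i : bmf D (\1_(I i) : R -> R) by exact: bmf_indic.
transitivity (Rintegral mu D (fun s => \sum_(i <- index_enum 'I_M) G i * \1_(I i) s)).
  apply: eq_Rintegral => s; rewrite inE /D /= in_itv/= => /andP[s0 sM].
  have /andP[h1 h2] := truncn_dy p s0; set k := Num.truncn _ in h1 h2 *.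
  have kM : (k < M)%N by rewrite -lt_dy (le_lt_trans h1).
  rewrite (bigD1 (Ordinal kM))//= big1 ?addr0 => [|i ik].
    by rewrite indicE mem_set ?mulr1// /I /= in_itv/= h1.
  rewrite indicE memNset ?mulr0// /I /= in_itv/= => /andP[i1 i2]; move/negP: ik; apply.
  apply/eqP/val_inj => /=; apply/eqP; rewrite eqn_leq.
  have := le_lt_trans i1 h2; have := le_lt_trans h1 i2; rewrite !lt_dy !ltnS => -> ->//.
have bGI (i : 'I_M) : bmf D (fun s => G i * \1_(I i) s : R).
  by apply: bmfM; [exact: bmf_cst|exact: bI].
rewrite (bint_sum (mu := mu) mD Dlty _ bGI).
apply: eq_bigr => i _.
transitivity (G i * fine (mu (I i `&` D))).
  etransitivity; first exact: (bintZ (mu := mu) mD Dlty (G i) (bI i)).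
  exact: (congr1 (fun z => G i * z) (bint_indic mu mD (mI i))).
rewrite mulrC; congr (_ * _).
have -> : I i `&` D = I i.
  apply/setIidPl => s; rewrite /I /D /= !in_itv/= => /andP[i1 i2]; apply/andP; split.
    by apply: le_trans i1; rewrite -dy0 le_dy.
  by apply: (lt_le_trans i2); rewrite le_dy.
by rewrite /I lebesgue_measure_itv/= lte_fin lt_dy ltnSn -EFinB/= dyB.
Qed.

Lemma sum_blocks (G : nat -> R) M q : (0 < q)%N ->
  \sum_(i < M * q) G (i %/ q)%N = q%:R * \sum_(i < M) G i.
Proof.
move=> q0; elim: M => [|M IH]; first by rewrite mul0n !big_ord0 mulr0.
rewrite mulSnr big_split_ord/= IH big_ord_recr/= mulrDr; congr (_ + _).
under eq_bigr => j _ do rewrite divnMDl// divn_small// addn0.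
by rewrite sumr_const card_ord mulr_natl.
Qed.

End StepIntegral.

Section Identification.
Context {R : realType} (c : R) (nu : {measure set R -> \bar R}) (a : R -> R -> R).
Variables (K x0 M0 : R).
Hypothesis Hnu : levy_measure nu.
Hypothesis K0 : 0 < K.
Variables (ch : nat -> chain R) (l : nat -> nat).
Hypothesis GL : forall n, good_level c nu a K x0 M0 n (ch n) (l n).
Context {U : set_system nat} {UU : UltraFilter U}.
Hypothesis Uoo : \oo `<=` U.
Context {d : measure_display} {T : measurableType d} {P : probability T R}.
Context {t : T -> nat -> seq int}.

Let E := En ch l.
Let HE : forall n, is_mean (E n) := En_mean GL.

Hypothesis HI : forall A : nat -> set (seq int),
  measurable (internal_event (U := U) (t := t) A) /\
  P (internal_event (U := U) (t := t) A) = (ulim U (fun n => E n (\1_(A n))))%:E.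

Local Notation st := (std_part (U := U) (t := t)).
Local Notation mu := (@lebesgue_measure R).
Local Notation Y := (std_path x0 ch l (U := U) (t := t)).
Local Notation X := (limit_path x0 ch l (U := U) (t := t)).
Local Notation bdd := (bounded_path x0 ch l (U := U) (t := t)).
Local Notation Xn := (lattice_path x0 ch l).
Local Notation mT := (limit_riemann x0 ch l (U := U) (t := t)).
Local Notation mn := (riemann_sum x0 ch l).
Local Notation bm2 := (@bmeas2 R).

Implicit Types f g : R * R -> R.

Let d0 n : 0 < 2 ^- l n :> R. Proof. by rewrite invr_gt0 pow2_gt0. Qed.
Let h0 n : 0 < ch_h (ch n). Proof. exact: (ok_h (gl_ok (GL n))). Qed.
Let Pfin : (P setT < +oo)%E. Proof. by rewrite probability_setT ltry. Qed.

Definition path_integral (T0 : R) f (w : T) : R := Rintegral mu `[0, T0[%classic (fun s => f (s, X s w)).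

Lemma path_bmf (T0 : R) f w : bm2 f -> bmf `[0, T0[%classic (fun s => f (s, X s w)).
Proof.
move=> [mf [B fB]]; split; last by exists B => s _; exact: fB.
(* The path is known to be measurable on nonnegative times only; taking the maximum with 0 extends
   it to the line, so that it can be composed with [f]. *)
pose g (s : R) := X (Num.max 0 s) w.
have mg : measurable_fun setT g.
  have mX : measurable_fun (`[0, +oo[%classic : set R) (fun r => X r w).
    apply: X_measurable; first exact: measurable_itv.
    by move=> r; rewrite /= in_itv/= andbT.
  have mm : measurable_fun setT (fun s : R => Num.max 0 s).
    by apply: measurable_maxr; [exact: measurable_cst|exact: measurable_id].
  apply: (measurable_comp (measurable_itv `[0, +oo[) _ mX mm).
  by move=> _ [s _ <-]; rewrite /= in_itv/= andbT le_max lexx.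
have mp : measurable_fun setT (fun s : R => (s, g s)).
  by apply: measurable_fun_pair => //; exact: measurable_id.
have mfp : measurable_fun setT (fun s => f (s, g s)).
  exact: (measurableT_comp (f := f) (g := fun s => (s, g s))).
have mfp' : measurable_fun `[0, T0[%classic (fun s => f (s, g s)) by exact: measurable_funTS.
apply: eq_measurable_fun mfp' => s; rewrite inE/= in_itv/= => /andP[s0 _].
by rewrite /g max_r.
Qed.

Let mI (T0 : R) : measurable (`[0, T0[%classic : set R). Proof. exact: measurable_itv. Qed.

Lemma nTD T0 f g w : bm2 f -> bm2 g -> path_integral T0 (fun p => f p + g p) w = path_integral T0 f w + path_integral T0 g w.
Proof. by move=> bf bg; apply: (bintD (mu := mu) (mI T0) (mu_itv_lty 0 T0)); exact: path_bmf. Qed.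

Lemma nTZ T0 r f w : bm2 f -> path_integral T0 (fun p => r * f p) w = r * path_integral T0 f w.
Proof. by move=> bf; apply: (bintZ (mu := mu) (mI T0) (mu_itv_lty 0 T0)); exact: path_bmf. Qed.

Lemma nT_cvg T0 f (fk : nat -> R * R -> R) (B : R) w : bm2 f -> (forall k, bm2 (fk k)) ->
  (forall k p, `|fk k p| <= B) -> (forall p, fk ^~ p @ \oo --> f p) ->
  (fun k => path_integral T0 (fk k) w) @ \oo --> path_integral T0 f w.
Proof.
move=> bf bfk fkB cf.
apply: (@bint_cvg _ _ _ mu _ (mI T0) (mu_itv_lty 0 T0) _ _ B).
- by move=> k; exact: (path_bmf T0 w (bfk k)).1.
- exact: (path_bmf T0 w bf).1.
- by move=> k s _; exact: fkB.
- by apply: aeW => s _; exact: cf.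
Qed.

Definition identified T0 f := {ae P, forall w, mT T0 f w = path_integral T0 f w}.

Section FixedTime.
Variable T0 : R.
Hypothesis T00 : 0 <= T0.

Lemma identD f g : bm2 f -> bm2 g -> identified T0 f -> identified T0 g -> identified T0 (fun p => f p + g p).
Proof.
move=> bf bg; apply: filterS2 => w hf hg.
by rewrite nTD// -hf -hg (mTD GL T00).
Qed.

Lemma identZ r f : bm2 f -> identified T0 f -> identified T0 (fun p => r * f p).
Proof. by move=> bf; apply: filterS => w hf; rewrite nTZ// -hf (mTZ GL T00). Qed.

(** The left sides converge in mean by the Krylov estimate, the right sides path by path by bounded
    convergence. *)
Lemma ident_lim f (fk : nat -> R * R -> R) (B : R) : bm2 f -> (forall k, bm2 (fk k)) ->
  (forall p, `|f p| <= B) -> (forall k p, `|fk k p| <= B) ->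
  (forall p, fk ^~ p @ \oo --> f p) -> (forall k, identified T0 (fk k)) -> identified T0 f.
Proof.
move=> bf bfk fB fkB cf ik.
apply: (@ae_eq_of_L1_cvg _ _ _ P (fun k => mT T0 (fk k)) (mT T0 f) _ (T0 * B)).
- by move=> k; exact: (mT_bmf GL HI T00 (bfk k)).1.
- exact: (mT_bmf GL HI T00 bf).1.
- by move=> k w; apply: (mT_norm GL T00).
- by move=> w; apply: (mT_norm GL T00).
- exact: (mT_cvg Hnu K0 GL Uoo HI T00 bf bfk fB fkB cf).
- have /ae_foralln : forall k, {ae P, forall w, mT T0 (fk k) w = path_integral T0 (fk k) w} by exact: ik.
  apply: filterS => w hw.
  have -> : (fun k => mT T0 (fk k) w) = (fun k => path_integral T0 (fk k) w) by apply/funext.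
  exact: nT_cvg.
Qed.

End FixedTime.

Section Lipschitz.
Variables (f : R * R -> R) (k : R).
Hypotheses (bf : bm2 f) (f1 : forall p, `|f p| <= 1) (k0 : 0 <= k).
Hypothesis lipf : forall s s' x x', `|f (s, x) - f (s', x')| <= k * (`|s - s'| + `|x - x'|).

(** Increments may have no first moment, so the Lipschitz bound is rewritten through [gfun]: small
    increments cost [eta], and for the others the bound 2 on the difference is dominated by [C]
    times [gfun]. *)
Lemma lip_gfun (eta : R) : 0 < eta -> exists C : R, 0 < C /\
  forall s s' x y, `|f (s, x) - f (s', y)| <= k * `|s - s'| + eta + C * gfun (y - x).
Proof.
move=> eta0; pose lm := Num.min 1 (eta / (k + 1)).
have k1 : 0 < k + 1 by rewrite ltr_wpDl.
have lm0 : 0 < lm by rewrite lt_min ltr01/= divr_gt0.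
have lm1 : lm <= 1 by rewrite ge_min lexx.
exists (4 / lm ^+ 2); split; first by rewrite divr_gt0// exprn_gt0.
move=> s s' x y; have gg := gfun_ge0 (y - x).
have C0 : 0 < 4 / lm ^+ 2 by rewrite divr_gt0// exprn_gt0.
have [xy|xy] := leP `|y - x| lm.
  apply: (le_trans (lipf _ _ _ _)); rewrite mulrDr -[leLHS]addr0 lerD//; last first.
    by rewrite mulr_ge0// ltW.
  rewrite lerD2l distrC; apply: (@le_trans _ _ (k * (eta / (k + 1)))).
    by rewrite ler_wpM2l//; apply: (le_trans xy); rewrite ge_min lexx orbT.
  by rewrite mulrA ler_pdivrMr// mulrC ler_pM2l// lerDl.
apply: (@le_trans _ _ 2).
  by rewrite (le_trans (ler_normB _ _))// -[leRHS]/(1 + 1) lerD.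
have h := gfun_lb (ltW lm0) lm1 (ltW xy).
apply: (@le_trans _ _ (4 / lm ^+ 2 * (lm ^+ 2 / 2))).
  by rewrite [leRHS](_ : _ = 2)//; field; rewrite gt_eqF.
apply: (@le_trans _ _ (4 / lm ^+ 2 * gfun (y - x))); first by rewrite ler_pM2l.
by rewrite lerDr addr_ge0 ?(ltW eta0)// mulr_ge0.
Qed.

Variables (p0 m0 : nat).
Local Notation T0 := (dy p0 m0 : R).

Let T00 : 0 <= T0. Proof. exact: dy_ge0. Qed.

Let M p := (m0 * 2 ^ (p - p0))%N.

Let dyM p : (p0 <= p)%N -> dy p (M p) = T0.
Proof. by move=> pp; rewrite -(dy_shift p0 (p - p0)) subnKC. Qed.

(** Values at right end points, because [rd p s] is the right end point of the interval of level [p]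
    that contains [s] and paths are right continuous. *)
Definition riem p n v : R := \sum_(i < M p) 2 ^- p * f (dy p i.+1, Xn n (dy p i.+1) v).

Lemma riem_norm p n v : (p0 <= p)%N -> `|riem p n v| <= T0.
Proof.
move=> pp; rewrite (le_trans (ler_norm_sum _ _ _))//.
apply: (@le_trans _ _ (\sum_(i < M p) 2 ^- p)).
  have p2 : 0 <= 2 ^- p :> R by rewrite invr_ge0 ltW// pow2_gt0.
  by apply: ler_sum => i _; rewrite normrM ger0_norm ?ler_piMr.
by rewrite sumr_const card_ord -(mulr_natl _ (M p)) -(dyM pp).
Qed.

(** Compares the sum over the fine steps of the chain with the coarse sum of level [p], uniformly in
    [n]; this uniformity allows the limit in [n] to be taken before that in [p]. *)
Lemma riem_mean (eta : R) : 0 < eta -> exists C : R, 0 < C /\ forall p n, (p0 <= p)%N -> (p <= l n)%N ->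
  (m0 * 2 ^ (l n - p0) <= n.+1 * 2 ^ l n)%N ->
  E n (fun v => `|mn n (stp (l n) T0) f v - riem p n v|) <=
  T0 * (k * (2 ^- l n + ch_h (ch n)) + k * 2 ^- p + eta + C * (2 ^- p * G0 c nu K)).
Proof.
move=> eta0; have [C [C0 hC]] := lip_gfun eta0; exists C; split => // p n pp pl kN.
have G := G0_ge0 c Hnu K0.
pose q := (2 ^ (l n - p))%N.
have q0 : (0 < q)%N by rewrite expn_gt0.
have qd : q%:R * 2 ^- l n = 2 ^- p :> R.
  by rewrite /q natrX -[in X in _ / X](subnK pl) exprD invfM mulrA divff ?mul1r//.
have p0l : (p0 <= l n)%N by exact: leq_trans pl.
have kE : stp (l n) T0 = (M p * q)%N.
  rewrite stp_dy// /M /q -mulnA -expnD; congr (_ * 2 ^ _)%N; lia.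
have stpq i : stp (l n) (dy p i : R) = (i * q)%N by rewrite stp_dy.
have dyq i : dy p i = (i * q)%N%:R * 2 ^- l n :> R by rewrite natrM -mulrA qd.
(* The first coarse time strictly after step [m], at most [q] fine steps away. *)
pose b (m : nat) := ((m %/ q).+1 * q)%N.
have bm m : (m <= b m)%N by rewrite /b mulSn addnC ltnW// {1}(divn_eq m q) ltn_add2l ltn_mod.
have bm' m : (b m - m <= q)%N by rewrite /b mulSn {2}(divn_eq m q) addnC subnDl leq_subr.
pose Xc m := Xch (ch n) x0 m.
have dterm m v : `|avn x0 ch l n f m (pos (take m v)) - f (dy p (m %/ q).+1, Xc (b m) v)| <=
    k * (2 ^- l n + ch_h (ch n)) + (k * 2 ^- p + eta + C * gfun (Xc (b m) v - Xc m v)).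
  set j := pos (take m v).
  have -> : avn x0 ch l n f m j - f (dy p (m %/ q).+1, Xc (b m) v) =
     (avn x0 ch l n f m j - f (m%:R * 2 ^- l n, Xc m v)) +
     (f (m%:R * 2 ^- l n, Xc m v) - f (dy p (m %/ q).+1, Xc (b m) v)) by rewrite addrA subrK.
  apply: (le_trans (ler_normD _ _)); apply: lerD.
    rewrite -[X in `|_ - X|](avg_cst x0 (h0 n) (d0 n) _ m j).
    apply: avg_dist; [exact: h0|exact: d0|exact: bm2_cell|exact: bmf_cst|].
    move=> [u x]; rewrite /cell /= !in_itv/= => -[/andP[u1 u2] /andP[v1 v2]].
    apply: (le_trans (lipf _ _ _ _)); rewrite ler_wpM2l// lerD//.
      rewrite ger0_norm ?subr_ge0//; move: u1 u2; rewrite -[m.+1]addn1 natrD mulrDl mul1r.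
      by set z := _ * _ => ? ?; lra.
    rewrite /Xc /Xch -/j; move: v1 v2; rewrite intrD mulrDr mulr1.
    by set z := _ * _ => ? ?; rewrite ger0_norm; lra.
  apply: (le_trans (hC _ _ _ _)); rewrite lerD2r lerD2r ler_wpM2l//.
  rewrite dyq distrC -mulrBl -/(b m) -natrB// ger0_norm; last by rewrite mulr_ge0// ltW.
  by rewrite -qd ler_pM2r// ler_nat.
have -> : riem p n = fun v => \sum_(m < M p * q) 2 ^- l n * f (dy p (m %/ q).+1, Xc (b m) v).
  apply/funext => v; rewrite -mulr_sumr.
  rewrite (sum_blocks (fun i => f (dy p i.+1, Xc (i.+1 * q)%N v)))//.
  rewrite mulrA [_ * q%:R]mulrC qd /riem mulr_sumr; apply: eq_bigr => i _.
  by rewrite /lattice_path stpq.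
rewrite kE.
apply: (@le_trans _ _ (E n (fun v => \sum_(m < M p * q) 2 ^- l n *
   (k * (2 ^- l n + ch_h (ch n)) + (k * 2 ^- p + eta + C * gfun (Xc (b m) v - Xc m v)))))).
  apply: (le_mean (HE n)) => v; rewrite /riemann_sum -sumrB (le_trans (ler_norm_sum _ _ _))//.
  apply: ler_sum => m _; rewrite -mulrBr normrM gtr0_norm// ler_pM2l//; exact: dterm.
rewrite (mean_sum (HE n)).
apply: (@le_trans _ _ (\sum_(m < M p * q) 2 ^- l n * (k * (2 ^- l n + ch_h (ch n)) + k * 2 ^- p + eta + C * (2 ^- p * G0 c nu K)))).
  apply: ler_sum => m _; rewrite (meanZ (HE n)) ler_pM2l//.
  rewrite (meanD (HE n)) (mean_cst (HE n)) -!addrA lerD2l.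
  rewrite (meanD (HE n)) (mean_cst (HE n)) -!addrA lerD2l lerD2l (meanZ (HE n)) ler_pM2l//.
  have bN : (m + (b m - m) <= n.+1 * 2 ^ l n)%N.
    rewrite subnKC//; apply: leq_trans kN; rewrite -(stp_dy (R := R) _ p0l) kE /b leq_mul2r.
    by rewrite ltn_divLR// ltn_ord orbT.
  have := incr1 Hnu GL bN (F := fun=> 1) (fun=> erefl) (fun=> ler01).
  rewrite subnKC// (mean_cst (En_mean GL n)) mul1r => h.
  apply: (@le_trans _ _ (E n (fun v => 1 * gfun (Xc (b m) v - Xc m v)))).
    by apply: (le_mean (HE n)) => v; rewrite mul1r.
  by apply: (le_trans h); rewrite ler_wpM2r// -qd ler_pM2r// ler_nat.
rewrite sumr_const card_ord -(mulr_natl _ (M p * q)) mulrA ler_wpM2r//.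
  by rewrite !addr_ge0// ?mulr_ge0// ?addr_ge0 ?(ltW eta0) ?(ltW C0)// ltW.
by rewrite -kE; have /andP[] := stp_itv (l n) T00.
Qed.

Lemma rd_cvg (s : R) : 0 <= s -> (rd^~ s) @ \oo --> s^'+.
Proof.
move=> s0 A; rewrite /at_right /within /= => /nbhs_ballP[e /= e0 hA].
apply: filterS (rd_lt s0 e0) => p hp; apply: hA; last exact: rd_gt.
rewrite /ball/= ltr0_norm ?subr_lt0 ?rd_gt//; lra.
Qed.

Lemma riem_path w : (forall p i, X (dy p i) w = Y (dy p i) w) -> (forall p i, bdd (dy p i) w) ->
  (fun p => st (fun n v => riem (p0 + p) n v) w) @ \oo --> path_integral T0 f w.
Proof.
move=> XY bw.
have cf (s : R) : continuous (fun x => f (s, x)).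
  apply: (@lip_continuous _ k) => x y; apply: (le_trans (lipf _ _ _ _)).
  by rewrite subrr normr0 add0r.
pose G p (i : nat) : R := f (dy p i.+1, X (dy p i.+1) w).
have e1 p : st (fun n v => riem (p0 + p) n v) w =
    Rintegral mu `[0, T0[%classic (fun s => G (p0 + p)%N (Num.truncn (s * 2 ^+ (p0 + p)))).
  rewrite -(dyM (leq_addr p p0)) step_integral /std_part /riem.
  have bt i : ubd U (fun n => f (dy (p0 + p) i.+1, Xn n (dy (p0 + p) i.+1) (t w n))).
    by apply: (ubdW (B := 1)) => n.
  rewrite ulim_sum => [|i]; last by apply: ubdM => //; exact: ubd_cst.
  apply: eq_bigr => i _; rewrite ulimZ//; congr (_ * _).
  rewrite (ulim_continuous (f := fun x => f (dy (p0 + p) i.+1, x)))//; last exact: bw.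
  by rewrite /G XY.
under eq_fun do rewrite e1.
have mG p : measurable_fun (`[0, T0[%classic : set R) (fun s : R => G p (Num.truncn (s * 2 ^+ p))).
  by apply: measurable_truncn_comp; exact: measurable_itv.
apply: (@bint_cvg _ _ _ mu _ (mI T0) (mu_itv_lty 0 T0) _ _ 1).
- by move=> p; exact: mG.
- exact: (path_bmf _ w bf).1.
- by move=> p s _; exact: f1.
- apply: aeW => s; rewrite /= in_itv/= => /andP[s0 _].
  have h1 : (fun p => X (rd p s) w) @ \oo --> X s w.
    apply: (cvg_comp (rd^~ s) (fun r => X r w)); first exact: rd_cvg.
    exact: (X_cadlag x0 ch l w).1.
  have h2 : (fun p => rd p s) @ \oo --> s.
    by apply: cvg_trans (rd_cvg s0) _; exact: cvg_at_right_filter.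
  apply/cvgrPdist_le => e e0.
  have k1 : 0 < 2 * (k + 1) by rewrite mulr_gt0// ltr_wpDl.
  have ek : 0 < e / (2 * (k + 1)) by rewrite divr_gt0.
  have := (cvgrPdist_le _ _).1 h1 _ ek; have := (cvgrPdist_le _ _).1 h2 _ ek.
  move=> [N1 _ g1] [N2 _ g2]; exists (N1 + N2)%N => // p /= Np.
  have b1 := g1 (p0 + p)%N (leq_trans (leq_trans (leq_addr N2 N1) Np) (leq_addl _ _)).
  have b2 := g2 (p0 + p)%N (leq_trans (leq_trans (leq_addl N1 N2) Np) (leq_addl _ _)).
  apply: (le_trans (lipf _ _ _ _)).
  apply: (@le_trans _ _ (k * (e / (2 * (k + 1)) + e / (2 * (k + 1))))).
    by rewrite ler_wpM2l//; apply: lerD.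
  have -> : k * (e / (2 * (k + 1)) + e / (2 * (k + 1))) = e * (k / (k + 1)).
    by field; rewrite gt_eqF// ltr_wpDl.
  by rewrite ler_piMr ?(ltW e0)// ler_pdivrMr ?ltr_wpDl// mul1r lerDl.
Qed.

(** The coarse sums converge to the path integral on almost every path and are close in mean to the
    occupation functional. A dyadic [T0] is filled exactly by the intervals of level [p]. *)
Lemma ident_lip : identified T0 f.
Proof.
pose F p : T -> R := st (fun n v => riem (p0 + p) n v).
have rB p n v : `|riem (p0 + p) n v| <= T0 by exact: riem_norm (leq_addr _ _).
have G := G0_ge0 c Hnu K0.
apply: (@ae_eq_of_L1_cvg _ _ _ P F (mT T0 f) _ T0).
- by move=> p; exact: (st_bmf HE HI (rB p)).1.
- exact: (mT_bmf GL HI T00 bf).1.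
- move=> p w; rewrite /F /std_part -ulim_norm; last by apply: (ubdW (B := T0)) => n; exact: rB.
  apply: ulim_le_cst; last by apply: nearW => n; exact: rB.
  by apply: (ubdW (B := T0)) => n; rewrite normr_id; exact: rB.
- by move=> w; rewrite -[leRHS]mulr1; exact: (mT_norm GL T00).
- apply/cvgrPdist_le => e e0.
  have T1 : 0 < T0 + 1 by rewrite ltr_wpDl.
  have eta0 : 0 < e / 4 / (T0 + 1) by rewrite !divr_gt0.
  have [C [C0 hC]] := riem_mean eta0.
  pose W := T0 * (2 * k + C * G0 c nu K) + 1.
  have W0 : 0 < W.
    by rewrite ltr_wpDl// mulr_ge0// addr_ge0// mulr_ge0// ltW.
  have eW : 0 < e / 4 / W by rewrite !divr_gt0.
  have [m hm] := pow2_small eW; exists m => // p /= mp.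
  have pB : 2 ^- (p0 + p) <= e / 4 / W by rewrite ltW// hm// (leq_trans mp)// leq_addl.
  have mB n v : `|mn n (stp (l n) T0) f v| <= T0.
    by rewrite -[leRHS]mulr1; exact: (mn_norm GL).
  have mrB n v : `|(`|mn n (stp (l n) T0) f v - riem (p0 + p) n v|)| <= T0 + T0.
    by rewrite normr_id (le_trans (ler_normB _ _))// lerD.
  rewrite sub0r normrN ger0_norm; last by apply: Rintegral_ge0.
  have -> : (fun w => `|mT T0 f w - F p w|) =
      st (fun n v => `|mn n (stp (l n) T0) f v - riem (p0 + p) n v|).
    apply/funext => w; rewrite /std_part.
    have b1 : ubd U (fun n => mn n (stp (l n) T0) f (t w n)) by apply: (ubdW (B := T0)) => n.
    have b2 : ubd U (fun n => riem (p0 + p) n (t w n)) by apply: (ubdW (B := T0)) => n.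
    rewrite ulim_norm; last by apply: ubdD => //; exact: ubdN.
    by rewrite ulimB.
  rewrite (st_int HE HI mrB); apply: ulim_le_cst; first exact: (ubd_E HE mrB).
  apply: (nearU Uoo).
  have eW2 : 0 < e / 4 / W / 2 by rewrite divr_gt0.
  apply: filterS3 (inv_near eW2) (nbhs_infty_ger T0) (nbhs_infty_ge (p0 + p)) => n nW Tn np.
  have pl : (p0 + p <= l n)%N by exact: leq_trans (gl_l (GL n)).
  have kN : (m0 * 2 ^ (l n - p0) <= n.+1 * 2 ^ l n)%N.
    rewrite -(stp_dy (R := R) m0); last by apply: leq_trans pl; rewrite leq_addr.
    by apply: stp_le => //; apply: (le_trans Tn); rewrite ler_nat.
  apply: (le_trans (hC _ _ (leq_addr _ _) pl kN)).
  have dh : 2 ^- l n + ch_h (ch n) <= e / 4 / W.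
    rewrite [leRHS]splitr lerD//; first exact: (le_trans (dt_le GL n)).
    exact: le_trans (gl_h (GL n)) nW.
  apply: (@le_trans _ _ (T0 * (k * (e / 4 / W) + k * (e / 4 / W) + e / 4 / (T0 + 1) + C * (e / 4 / W * G0 c nu K)))).
    rewrite ler_wpM2l// !lerD// ?ler_wpM2l ?(ltW C0)//.
    by rewrite ler_wpM2r.
  have -> : T0 * (k * (e / 4 / W) + k * (e / 4 / W) + e / 4 / (T0 + 1) + C * (e / 4 / W * G0 c nu K)) =
     e / 4 * ((W - 1) / W) + e / 4 * (T0 / (T0 + 1)).
    by rewrite /W; ring.
  have w1 : (W - 1) / W <= 1 by rewrite ler_pdivrMr// mul1r gerBl.
  have w2 : T0 / (T0 + 1) <= 1 by rewrite ler_pdivrMr// mul1r lerDl.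
  have e4 : 0 <= e / 4 by rewrite divr_ge0// ltW.
  apply: (@le_trans _ _ (e / 4 + e / 4)); first by rewrite lerD// ler_piMr.
  lra.
- have h1 : {ae P, forall w, forall p i, X (dy p i) w = Y (dy p i) w}.
    apply: ae_foralln => p; apply: ae_foralln => i.
    by apply: (XY_ae Hnu K0 GL Uoo HI); exact: dy_ge0.
  have h2 : {ae P, forall w, forall p i, bdd (dy p i) w} by exact: (dyadic_bdd_ae Hnu K0 GL Uoo HI).
  by apply: filterS2 h1 h2 => w XY bw; exact: riem_path.
Qed.

End Lipschitz.

End Identification.

(** * From Lipschitz to bounded measurable integrands *)

Section Ramp.
Context {R : realType}.

Definition ramp (k : nat) (u z : R) : R := Num.min 1 (Num.max 0 (k%:R * (u - z))).

Lemma ramp_itv k u z : 0 <= ramp k u z <= 1.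
Proof. by rewrite /ramp le_min ler01 le_max lexx ge_min lexx. Qed.

Lemma ramp_lip k u z z' : `|ramp k u z - ramp k u z'| <= k%:R * `|z - z'|.
Proof.
have h (x y : R) : `|Num.min 1 (Num.max 0 x) - Num.min 1 (Num.max 0 y)| <= `|x - y|.
  wlog xy : x y / x <= y.
    move=> wl; have [|/ltW] := leP x y; first exact: wl.
    by move=> /wl; rewrite distrC [`|y - x|]distrC.
  have -> : `|x - y| = y - x by rewrite distrC ger0_norm ?subr_ge0.
  rewrite ler_norml.
  have cE (w : R) : [\/ w <= 0 /\ Num.min 1 (Num.max 0 w) = 0,
      0 <= w /\ w <= 1 /\ Num.min 1 (Num.max 0 w) = w | 1 <= w /\ Num.min 1 (Num.max 0 w) = 1].
    have [w0|w0] := leP w 0; first by constructor 1; rewrite min_r.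
    by have [w1|w1] := leP w 1; [constructor 2|constructor 3]; rewrite ltW.
  have [[x1 ->]|[x1 [x2 ->]]|[x1 ->]] := cE x; have [[y1 ->]|[y1 [y2 ->]]|[y1 ->]] := cE y; lra.
apply: (le_trans (h _ _)); rewrite -mulrBr normrM normr_nat ler_wpM2l//.
by rewrite opprB addrC addrA subrK distrC.
Qed.

Lemma ramp_cvg u z : (fun k => ramp k u z) @ \oo --> (\1_(`]-oo, u[%classic : set R) z : R).
Proof.
apply: cvg_near_cst; rewrite indicE; have [zu|uz] := ltP z u.
  have uz0 : 0 < u - z by rewrite subr_gt0.
  exists (Num.truncn (u - z)^-1).+1 => // k /= kk; rewrite mem_set; last by rewrite /= in_itv.
  apply/min_idPl; rewrite le_max; apply/orP; right.
  rewrite -ler_pdivrMr// div1r; apply: ltW; apply: (lt_le_trans (truncnS_gt _)).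
  by rewrite ler_nat.
exists 0%N => // k _; rewrite memNset; last by rewrite /= in_itv/=; apply/negP; rewrite -leNgt.
rewrite /ramp max_l ?min_r// mulr_ge0_le0// subr_le0//.
Qed.

Lemma ramp_measurable k u : measurable_fun setT (ramp k u).
Proof.
by apply: continuous_measurable_fun; apply: (@lip_continuous _ k%:R) => y z; exact: ramp_lip.
Qed.

End Ramp.

Section IdentificationAll.
Context {R : realType} (c : R) (nu : {measure set R -> \bar R}) (a : R -> R -> R).
Variables (K x0 M0 : R).
Hypothesis Hnu : levy_measure nu.
Hypothesis K0 : 0 < K.
Hypothesis ma : measurable_fun [set p : R * R | 0 <= p.1] (fun p : R * R => a p.1 p.2).
Hypothesis aK : forall s x, 0 <= s -> `|a s x| <= K.
Variables (ch : nat -> chain R) (l : nat -> nat).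
Hypothesis GL : forall n, good_level c nu a K x0 M0 n (ch n) (l n).
Context {U : set_system nat} {UU : UltraFilter U}.
Hypothesis Uoo : \oo `<=` U.
Context {d : measure_display} {T : measurableType d} {P : probability T R}.
Context {t : T -> nat -> seq int}.

Let E := En ch l.
Let HE : forall n, is_mean (E n) := En_mean GL.

Hypothesis HI : forall A : nat -> set (seq int),
  measurable (internal_event (U := U) (t := t) A) /\
  P (internal_event (U := U) (t := t) A) = (ulim U (fun n => E n (\1_(A n))))%:E.

Local Notation st := (std_part (U := U) (t := t)).
Local Notation mu := (@lebesgue_measure R).
Local Notation Y := (std_path x0 ch l (U := U) (t := t)).
Local Notation X := (limit_path x0 ch l (U := U) (t := t)).
Local Notation V := (limit_drift ch l (U := U) (t := t)).
Local Notation mT := (limit_riemann x0 ch l (U := U) (t := t)).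
Local Notation nT := (path_integral x0 ch l (U := U) (t := t)).
Local Notation mn := (riemann_sum x0 ch l).
Local Notation bm2 := (@bmeas2 R).
Local Notation Ident := (identified x0 ch l (U := U) (P := P) (t := t)).

Implicit Types f g : R * R -> R.

Let bind {dZ} {Z : measurableType dZ} (e : R * R -> Z) (A : set Z) :
  measurable_fun setT e -> measurable A -> bm2 (fun p => \1_A (e p)).
Proof.
move=> me mA; split.
  by apply: (measurableT_comp (f := \1_A : Z -> R) _ me); exact: measurable_indic.
by exists 1 => p _; rewrite indicE; case: (_ \in _); rewrite ?normr1 ?normr0.
Qed.

Let indic_norm {Z : Type} (A : set Z) z : `|\1_A z : R| <= 1.
Proof. by rewrite indicE; case: (_ \in _); rewrite ?normr1 ?normr0. Qed.

Let norm1M (x y : R) : `|x| <= 1 -> `|y| <= 1 -> `|x * y| <= 1.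
Proof. by move=> hx hy; rewrite normrM -[leRHS]mulr1 ler_pM. Qed.

Section Dyadic.
Variables p0 m0 : nat.
Local Notation T0 := (dy p0 m0 : R).
Let T00 : 0 <= T0. Proof. exact: dy_ge0. Qed.

Let ilim f fk (B : R) := @ident_lim _ _ _ _ _ _ _ Hnu K0 _ _ GL _ _ Uoo _ _ P t HI T0 T00 f fk B.

Let iD f g := @identD _ _ _ _ _ _ _ _ _ GL _ _ _ _ P t _ T00 f g.
Let iZ r f := @identZ _ _ _ _ _ _ _ _ _ GL _ _ _ _ P t _ T00 r f.

Let lft (u : R) : set R := `]-oo, u[%classic.
Let mlft u : measurable (lft u). Proof. exact: measurable_itv. Qed.

(** Products of ramps are Lipschitz; since the half-lines are open, the ramps converge to their
    indicators at every point. *)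
Lemma ident_quadrant u v : Ident T0 (fun p => \1_(lft u) p.1 * \1_(lft v) p.2).
Proof.
pose fk k (p : R * R) : R := ramp k u p.1 * ramp k v p.2.
have r1 k w z : `|ramp k w z : R| <= 1 by have /andP[? ?] := ramp_itv k w z; rewrite ger0_norm.
have bfk k : bm2 (fk k).
  split; last by exists 1 => p _; exact: norm1M.
  apply: measurable_funM.
    by apply: (measurableT_comp (f := ramp k u)); [exact: ramp_measurable|exact: measurable_fst].
  by apply: (measurableT_comp (f := ramp k v)); [exact: ramp_measurable|exact: measurable_snd].
apply: (@ilim _ fk 1).
- by apply: bmfM; apply: bind.
- exact: bfk.
- by move=> p; exact: norm1M.
- by move=> k p; exact: norm1M.
- by move=> p; apply: cvgM; exact: ramp_cvg.
- move=> k; apply: (ident_lip Hnu K0 GL Uoo HI (bfk k) (k := k%:R)) => //.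
    by move=> p; exact: norm1M.
  move=> s s' x x'; rewrite /fk /=.
  have -> : ramp k u s * ramp k v x - ramp k u s' * ramp k v x' =
    (ramp k u s - ramp k u s') * ramp k v x + ramp k u s' * (ramp k v x - ramp k v x') by ring.
  apply: (le_trans (ler_normD _ _)); rewrite [leRHS]mulrDr !normrM; apply: lerD.
    by rewrite -[leRHS]mulr1; apply: ler_pM => //; exact: ramp_lip.
  by rewrite -[leRHS]mul1r; apply: ler_pM => //; exact: ramp_lip.
Qed.

(** One monotone class argument for three uses: [e] selects the variable that is extended from a
    generating class, and [h] carries the factor kept fixed. Countable disjoint unions are limits of
    finite ones, to which [ident_lim] applies. *)
Lemma ident_dynkin {dZ} {Z : measurableType dZ} (e : R * R -> Z) (G : set (set Z)) h :
  measurable_fun setT e -> @measurable _ Z = <<s G >> -> setI_closed G ->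
  bm2 h -> (forall p, `|h p| <= 1) -> Ident T0 h ->
  (forall A, G A -> Ident T0 (fun p => \1_A (e p) * h p)) ->
  forall A, measurable A -> Ident T0 (fun p => \1_A (e p) * h p).
Proof.
move=> me GE GI bh h1 ih iG A; rewrite GE.
apply: (dynkin_induction (P := fun A => Ident T0 (fun p => \1_A (e p) * h p)) GE GI) => //.
- rewrite (_ : (fun p => _) = h)//; apply/funext => p; by rewrite indicT mul1r.
- move=> S mS iS.
  rewrite (_ : (fun p => _) = (fun p => h p + (-1) * (\1_S (e p) * h p))); last first.
    apply/funext => p; rewrite !indicE in_setC; case: (_ \in _) => /=; ring.
  have b : bm2 (fun p => \1_S (e p) * h p) by apply: bmfM => //; exact: bind.
  apply: iD => //; last exact: iZ.
  by apply: bmfM => //; exact: bmf_cst.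
- move=> F mF tF iF.
  pose B k := \bigcup_(i in `I_k) F i.
  have mB k : measurable (B k) by exact: bigcup_measurable.
  have iB k : Ident T0 (fun p => \1_(B k) (e p) * h p).
    elim: k => [|k IH].
      rewrite (_ : (fun p => _) = (fun p => 0 * h p)); first exact: iZ.
      by apply/funext => p; rewrite /B II0 bigcup_set0 indic0.
    rewrite (_ : (fun p => _) = (fun p => \1_(B k) (e p) * h p + \1_(F k) (e p) * h p)).
      by apply: iD => //; apply: bmfM => //; exact: bind.
    apply/funext => p; rewrite -mulrDl; congr (_ * _); rewrite !indicE.
    have -> : (e p \in B k.+1) = (e p \in B k) || (e p \in F k).
      apply/idP/idP; rewrite ?inE.
        move=> [i /= ik Fi]; apply/orP; move: ik; rewrite ltnS leq_eqVlt => /predU1P[ik|ik].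
          by right; rewrite inE -ik.
        by left; rewrite inE; exists i.
      move=> /orP[|]; rewrite inE; last by move=> Fi; exists k => /=.
      by move=> [i /= ik Fi]; exists i => //=; exact: ltnW.
    have [|] := boolP (e p \in B k); have [|] := boolP (e p \in F k); rewrite /= ?addr0 ?add0r//.
    rewrite !inE => Fk [i /= ik Fi]; exfalso; move/trivIsetP: tF => /(_ i k I I).
    by rewrite ltn_eqF// => /(_ isT)/seteqP[+ _] => /(_ (e p)); apply.
  apply: (@ilim _ (fun k p => \1_(B k) (e p) * h p) 1) => //.
  + by apply: bmfM => //; apply: bind => //; exact: bigcup_measurable.
  + by move=> k; apply: bmfM => //; exact: bind.
  + by move=> p; exact: norm1M.
  + by move=> k p; exact: norm1M.
  + move=> p; apply: cvgM; last exact: cvg_cst.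
    apply: cvg_near_cst; rewrite !indicE.
    have [[i _ Fi]|nF] := pselect ((\bigcup_i F i) (e p)).
      exists i.+1 => // k /= ik; rewrite mem_set; last by exists i.
      by rewrite indicE mem_set//; exists i.
    exists 0%N => // k _; rewrite (memNset nF).
    by rewrite indicE memNset// => -[i _ Fi]; apply: nF; exists i.
Qed.

Let lft_cvg (z : R) : (fun k : nat => \1_(lft k%:R) z : R) @ \oo --> (1 : R).
Proof.
apply: cvg_near_cst; exists (Num.truncn `|z|).+1 => // k /= zk; rewrite indicE mem_set//.
rewrite /lft /= in_itv/=; apply: (le_lt_trans (ler_norm z)); apply: (lt_le_trans (truncnS_gt _)).
by rewrite ler_nat.
Qed.

Let lftG : set (set R) := @RGenInftyO.G R.

Let lftI : setI_closed lftG.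
Proof.
move=> _ _ [u ->] [v ->]; exists (Num.min u v).
by apply/seteqP; split => z /=; rewrite !in_itv/= lt_min => /andP.
Qed.

Let mfst : measurable_fun setT (fst : R * R -> R). Proof. exact: measurable_fst. Qed.
Let msnd : measurable_fun setT (snd : R * R -> R). Proof. exact: measurable_snd. Qed.

Lemma ident_fst v (A : set R) : measurable A -> Ident T0 (fun p => \1_A p.1 * \1_(lft v) p.2).
Proof.
apply: (ident_dynkin (G := lftG) (e := fst) (h := fun p => \1_(lft v) p.2)) => //.
- exact: RGenInftyO.measurableE.
- exact: bind.
(* The fixed factor alone corresponds to the whole line, which is the limit of the half-lines of the
   generating class. *)
- apply: (@ilim _ (fun k p => \1_(lft k%:R) p.1 * \1_(lft v) p.2) 1).
  + exact: bind.
  + by move=> k; apply: bmfM; exact: bind.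
  + by move=> p.
  + by move=> k p; exact: norm1M.
  + move=> p; rewrite -[X in _ --> X]mul1r; apply: cvgM; [exact: lft_cvg|exact: cvg_cst].
  + by move=> k; exact: ident_quadrant.
- by move=> _ [u ->]; exact: ident_quadrant.
Qed.

Lemma ident_rect (A B : set R) : measurable A -> measurable B ->
  Ident T0 (fun p => \1_B p.2 * \1_A p.1).
Proof.
move=> mA; apply: (ident_dynkin (G := lftG) (e := snd) (h := fun p => \1_A p.1)) => //.
- exact: RGenInftyO.measurableE.
- exact: bind.
- apply: (@ilim _ (fun k p => \1_A p.1 * \1_(lft k%:R) p.2) 1).
  + exact: bind.
  + by move=> k; apply: bmfM; exact: bind.
  + by move=> p.
  + by move=> k p; exact: norm1M.
  + move=> p; rewrite -[X in _ --> X]mulr1; apply: cvgM; [exact: cvg_cst|exact: lft_cvg].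
  + by move=> k; exact: ident_fst.
- move=> _ [u ->]; rewrite (_ : (fun p => _) = (fun p : R * R => \1_A p.1 * \1_(lft u) p.2)).
    exact: ident_fst.
  by apply/funext => p; rewrite mulrC.
Qed.

Lemma ident_indic (C : set (R * R)) : measurable C -> Ident T0 (\1_C).
Proof.
move=> mC; rewrite (_ : \1_C = (fun p => \1_C (id p) * 1)); last first.
  by apply/funext => p; rewrite mulr1.
move: C mC; apply: (ident_dynkin
  (G := [set A `*` B | A in @measurable _ R & B in @measurable _ R]) (e := id) (h := fun=> 1)) => //.
- exact: measurable_prod_measurableType.
- move=> _ _ [A1 mA1 [B1 mB1 <-]] [A2 mA2 [B2 mB2 <-]].
  exists (A1 `&` A2); first exact: measurableI.
  by exists (B1 `&` B2); [exact: measurableI|rewrite setXI].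
- exact: bmf_cst.
- by move=> p; rewrite normr1.
- rewrite (_ : (fun=> 1) = (fun p : R * R => \1_[set: R] p.2 * \1_[set: R] p.1)); first exact: ident_rect.
  by apply/funext => p; rewrite !indicT mulr1.
- move=> _ [A mA [B mB <-]].
  rewrite (_ : (fun p => _) = (fun p : R * R => \1_B p.2 * \1_A p.1)); first exact: ident_rect.
  apply/funext => -[x y] /=; rewrite !indicE mulr1 -natrM mulnb; congr (nat_of_bool _)%:R.
  apply/idP/idP; first by rewrite inE => -[/= Ax By]; rewrite !mem_set.
  by move=> /andP[]; rewrite !inE => By Ax; split.
Qed.

Lemma ident_sum I (s : seq I) (F : I -> R * R -> R) : (forall i, bm2 (F i)) ->
  (forall i, Ident T0 (F i)) -> Ident T0 (fun p => \sum_(i <- s) F i p).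
Proof.
move=> bF iF; elim: s => [|i s IH].
  rewrite (_ : (fun p => _) = (fun p : R * R => 0 * \1_[set: R * R] p)).
    by apply: iZ; [exact: bmf_indic|exact: ident_indic].
  by apply/funext => p; rewrite big_nil mul0r.
rewrite (_ : (fun p => _) = (fun p => F i p + \sum_(i <- s) F i p)).
  by apply: iD => //; exact: bmf_sum.
by apply/funext => p; rewrite big_cons.
Qed.

(** After a shift by its bound, [f] is a uniform limit of finite sums of indicators of superlevel
    sets, by [stair_bound]. *)
Lemma ident_bm2 f : bm2 f -> Ident T0 f.
Proof.
move=> bf; have [mf [B hB]] := bf; have fB p : `|f p| <= B by exact: hB.
have B0 : 0 <= B by exact: le_trans (fB (0, 0)).
pose A m (j : nat) : set (R * R) := [set p | j.+1%:R <= m.+1%:R * (f p + B)].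
have mA m j : measurable (A m j).
  have mg : measurable_fun setT (fun p => m.+1%:R * (f p + B)).
    by apply: measurable_funM => //; exact: measurable_funD.
  have := mg measurableT `[j.+1%:R, +oo[%classic (measurable_itv _).
  by rewrite setTI; congr measurable; apply/seteqP; split => p /=; rewrite in_itv/= andbT.
pose J m := (Num.truncn (m.+1%:R * (B + B))).+1.
pose fk m p : R := m.+1%:R^-1 * (\sum_(j <- iota 0 (J m)) \1_(A m j) p) + (- B) * \1_[set: R * R] p.
have fk_dist m p : `|f p - fk m p| <= m.+1%:R^-1.
  have m0' : 0 < m.+1%:R :> R by rewrite ltr0n.
  have /andP[fl fu] : - B <= f p <= B by rewrite -ler_norml.
  have y0 : 0 <= m.+1%:R * (f p + B) by rewrite mulr_ge0//; lra.
  have yJ : m.+1%:R * (f p + B) <= (J m)%:R.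
    by apply: le_trans (ltW (truncnS_gt _)); rewrite ler_pM2l//; lra.
  have [h1 h2] := stair_bound y0 yJ.
  have sE : \sum_(j <- iota 0 (J m)) \1_(A m j) p = \sum_(j < J m) (j.+1%:R <= m.+1%:R * (f p + B) :> R)%:R :> R.
    rewrite -[iota 0 (J m)]/(index_iota 0 (J m - 0)) subn0 big_mkord; apply: eq_bigr => j _.
    by rewrite indicE /A; congr (nat_of_bool _)%:R; apply/idP/idP; rewrite inE.
  rewrite /fk sE indicT mulr1; set S := \sum_(j < _) _ in h1 h2 *.
  have -> : f p - (m.+1%:R^-1 * S + - B) = m.+1%:R^-1 * (m.+1%:R * (f p + B) - S).
    by rewrite mulrBr mulKf ?gt_eqF//; ring.
  rewrite normrM gtr0_norm ?invr_gt0// -[leRHS]mulr1 ler_pM2l ?invr_gt0//.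
  by rewrite ler_norml; apply/andP; split; lra.
have bS m : bm2 (fun p => \sum_(j <- iota 0 (J m)) \1_(A m j) p).
  by apply: bmf_sum => j; exact: bmf_indic.
have b1 : bm2 (\1_[set: R * R]) by exact: bmf_indic.
have bfk m : bm2 (fk m).
  by apply: bmfD; (apply: bmfM; first exact: bmf_cst); [exact: bS|exact: b1].
apply: (@ilim _ fk (B + 1)) => //.
- by move=> p; rewrite (le_trans (fB p))// lerDl.
- move=> m p; rewrite -[fk m p](subKr (f p)) (le_trans (ler_normB _ _))// lerD//.
  by rewrite (le_trans (fk_dist m p))// invf_le1 ?ltr0n// ler1n.
- move=> p; apply/cvgrPdist_le => e e0; apply: filterS (inv_near e0) => m me.
  exact: le_trans (fk_dist m p) me.
- move=> m; apply: iD.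
  + by apply: bmfM; [exact: bmf_cst|exact: bS].
  + by apply: bmfM; [exact: bmf_cst|exact: b1].
  + by apply: iZ; first exact: bS; apply: ident_sum => j; [exact: bmf_indic|exact: ident_indic].
  + by apply: iZ; [exact: b1|exact: ident_indic].
Qed.

End Dyadic.

(** Set to 0 at negative times, where nothing is assumed on [a], so that it is bounded and
    measurable on the plane. *)
Definition drift (p : R * R) : R := a p.1 p.2 * \1_[set p : R * R | 0 <= p.1] p.

Let mpos : measurable [set p : R * R | 0 <= p.1].
Proof.
have -> : [set p : R * R | 0 <= p.1] = `[0, +oo[%classic `*` setT.
  by apply/seteqP; split => p /=; rewrite in_itv/= andbT; tauto.
by apply: measurableX => //; exact: measurable_itv.
Qed.

Lemma drift_norm p : `|drift p| <= K.
Proof.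
rewrite /drift indicE; have [|_] := boolP (p \in _); last by rewrite mulr0 normr0 ltW.
by rewrite inE mulr1; exact: aK.
Qed.

Lemma drift_bm2 : bm2 drift.
Proof.
split; last by exists K => p _; exact: drift_norm.
have := (measurable_restrictT (fun p : R * R => a p.1 p.2) mpos).1 ma.
congr measurable_fun; apply/funext => p; rewrite patchE /drift indicE.
by case: ifP => _; rewrite ?mulr1 ?mulr0.
Qed.

Lemma V_mT r w : V r w = mT r drift w.
Proof.
rewrite /limit_drift /limit_riemann /std_part; congr ulim; apply/funext => n.
rewrite /Ach /riemann_sum; apply: eq_bigr => i _; rewrite (gl_d (GL n)); congr (_ * _).
rewrite (gl_a (GL n)) (gl_d (GL n)) /avn /avg; congr (_ * _).
apply: eq_Rintegral => p; rewrite inE /cell /= in_itv/= => -[/andP[+ _] _].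
move=> ip; rewrite /drift indicE mem_set ?mulr1//=; apply: le_trans ip.
by rewrite mulr_ge0// invr_ge0 ltW// pow2_gt0.
Qed.

Lemma nT_lip f (B : R) r q w : bm2 f -> (forall p, `|f p| <= B) -> 0 <= r -> r <= q ->
  `|nT q f w - nT r f w| <= (q - r) * B.
Proof.
move=> bf fB r0 rq; have B0 : 0 <= B by exact: le_trans (fB (0, 0)).
have mq : measurable (`[0, q[%classic : set R) by exact: measurable_itv.
have mr : measurable (`[0, r[%classic : set R) by exact: measurable_itv.
have mrq : measurable (`[r, q[%classic : set R) by exact: measurable_itv.
have bq := path_bmf x0 ch l (U := U) (t := t) q w bf.
have uE : `[0, q[%classic = `[0, r[%classic `|` `[r, q[%classic :> set R.
  apply/seteqP; split => s /=; rewrite !in_itv/=.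
    by move=> /andP[s0 sq]; have [sr|rs] := ltP s r; [left; rewrite s0|right; rewrite sq].
  by move=> [/andP[s0 sr]|/andP[rs sq]]; apply/andP; split=> //;
    [exact: lt_le_trans rq|exact: le_trans rs].
have iq : mu.-integrable `[0, q[%classic (EFin \o (fun s => f (s, X s w))).
  exact: (bmf_integrable (mu := mu) mq (mu_itv_lty 0 q) bq).
have dj : [disjoint `[0%R, r[%classic & `[r, q[%classic].
  apply/disj_setPS => s [] /=; rewrite !in_itv/= => /andP[_ sr] /andP[rs _].
  by move: (lt_le_trans sr rs); rewrite ltxx.
have -> : nT q f w = nT r f w + Rintegral mu `[r, q[%classic (fun s => f (s, X s w)).
  by rewrite /path_integral uE Rintegral_setU// -uE.
rewrite addrAC subrr add0r.
have brq : bmf (`[r, q[%classic : set R) (fun s => f (s, X s w)).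
  apply: bmfS bq => // s; rewrite /= !in_itv/= => /andP[rs ->]; rewrite andbT.
  exact: le_trans rs.
have mE : fine (mu `[r, q[%classic) <= q - r.
  rewrite lebesgue_measure_itv/= lte_fin; case: ltP => [_|qr]; last by rewrite subr_ge0.
  by rewrite -EFinB.
have hb := bint_bound (mu := mu) (B := B) mrq (mu_itv_lty r q) brq (fun s _ => fB (s, X s w)).
by apply: (le_trans hb); rewrite mulrC; exact: ler_wpM2r B0 _ _ mE.
Qed.

Lemma V_lip r q w : 0 <= r -> r <= q -> `|V q w - V r w| <= (q - r) * K.
Proof.
move=> r0 rq; have q0 := le_trans r0 rq.
have br : ubd U (fun n => Ach (ch n) (stp (l n) r) (t w n)) by exact: (Ach_ubd K0 GL).
have bq : ubd U (fun n => Ach (ch n) (stp (l n) q) (t w n)) by exact: (Ach_ubd K0 GL).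
rewrite /limit_drift /std_part -ulimB// -ulim_norm; last by apply: ubdD => //; exact: ubdN.
have bn : ubd U (fun n => `|Ach (ch n) (stp (l n) q) (t w n) - Ach (ch n) (stp (l n) r) (t w n)|).
  have [B hB] : ubd U (fun n => Ach (ch n) (stp (l n) q) (t w n) - Ach (ch n) (stp (l n) r) (t w n)).
    by apply: ubdD => //; exact: ubdN.
  exists B; have hB' := hB; move: hB'; by apply: filterS => n; rewrite normr_id.
apply: (ulim_le_cvg Uoo bn (b := fun n => (q - r + 2 ^- l n) * K)); last first.
  exact: (dt_cvg_lin GL).
apply: nearW => n; apply: (le_trans (Ach_bound (gl_ok (GL n)) _ (stp_mono (l n) rq))).
rewrite (gl_d (GL n)) ler_pM2r//.
by have := stp_dist (l n) r0 rq; rewrite ler_norml => /andP[_]; set z := _ * _; lra.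
Qed.

(** Both sides are Lipschitz in time on every path, so the identity at the countably many dyadic
    times [rd p r] passes to [r]. *)
Lemma V_nT_ae r : 0 <= r -> {ae P, forall w, V r w = nT r drift w}.
Proof.
move=> r0.
have : {ae P, forall w, forall p, V (rd p r) w = nT (rd p r) drift w}.
  apply: ae_foralln => p; have := ident_bm2 p (Num.truncn (r * 2 ^+ p)).+1 drift_bm2.
  by apply: filterS => w; rewrite V_mT.
apply: filterS => w hw; apply/eqP; rewrite -subr_eq0 -normr_le0.
apply/ler_addgt0Pr => e e0; rewrite add0r.
have K2 : 0 < e / (2 * K) by rewrite divr_gt0// mulr_gt0.
have [p _ hp] := rd_lt r0 K2; have := hp p (leqnn p); rewrite /= => pr.
have rp := ltW (rd_gt p r0).
have -> : V r w - nT r drift w = (nT (rd p r) drift w - nT r drift w) - (V (rd p r) w - V r w).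
  by rewrite hw; ring.
apply: (le_trans (ler_normB _ _)).
apply: (le_trans (lerD (nT_lip w drift_bm2 drift_norm r0 rp) (V_lip w r0 rp))).
have : (rd p r - r) * (2 * K) <= e.
  by rewrite -ler_pdivlMr ?mulr_gt0// lerBlDr addrC ltW.
by set z := rd p r - r; rewrite mulrA [z * 2]mulrC -mulrA; set y := z * K; lra.
Qed.

Lemma nT_integral r w : 0 <= r ->
  Rintegral mu `[0, r] (fun s => a s (X s w)) = nT r drift w.
Proof.
move=> r0; rewrite /path_integral Rintegral_itv_bndo_bndc; last first.
  exact: (bmf_integrable (mu := mu) (measurable_itv _) (mu_itv_lty 0 r) (path_bmf x0 ch l r w drift_bm2)).
apply: eq_Rintegral => s; rewrite inE/= in_itv/= => /andP[s0 _].
by rewrite /drift indicE mem_set ?mulr1.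
Qed.

End IdentificationAll.

(** * The solution *)

Section Solution.
Context {R : realType} (c : R) (nu : {measure set R -> \bar R}) (a : R -> R -> R).
Variables (K x0 M0 : R).
Hypothesis Hnu : levy_measure nu.
Hypothesis K0 : 0 < K.
Hypothesis ma : measurable_fun [set p : R * R | 0 <= p.1] (fun p : R * R => a p.1 p.2).
Hypothesis aK : forall s x, 0 <= s -> `|a s x| <= K.
Variables (ch : nat -> chain R) (l : nat -> nat).
Hypothesis GL : forall n, good_level c nu a K x0 M0 n (ch n) (l n).
Context {U : set_system nat} {UU : UltraFilter U}.
Hypothesis Uoo : \oo `<=` U.
Context {d : measure_display} {T : measurableType d} {P : probability T R}.
Context {t : T -> nat -> seq int}.

Hypothesis HP : complete_prob P.
Hypothesis HI : forall A : nat -> set (seq int),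
  measurable (internal_event (U := U) (t := t) A) /\
  P (internal_event (U := U) (t := t) A) = (ulim U (fun n => En ch l n (\1_(A n))))%:E.

Local Notation X := (limit_path x0 ch l (U := U) (t := t)).
Local Notation Sl := (limit_noise x0 ch l (U := U) (t := t)).
Local Notation V := (limit_drift ch l (U := U) (t := t)).
Local Notation nT := (path_integral x0 ch l (U := U) (t := t)).
Local Notation F := (Gs l (U := U) (P := P) (t := t)).

(* With this definition the equation is an identity; that [noise] is a version of
   [limit_noise] comes from the identification of the drift. *)
Definition noise (r : R) (w : T) : R := X r w - x0 - nT r (drift a) w.

Lemma nT_cadlag w : cadlag (fun r => nT r (drift a) w).
Proof.
have lip r q : 0 <= r -> 0 <= q -> `|nT r (drift a) w - nT q (drift a) w| <= K * `|r - q|.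
  move=> r0 q0; have h u v : 0 <= u -> u <= v -> `|nT v (drift a) w - nT u (drift a) w| <= K * `|v - u|.
    move=> u0 uv; rewrite [`|v - u|]ger0_norm ?subr_ge0// mulrC.
    exact: (nT_lip x0 ch l w (drift_bm2 K0 ma aK) (drift_norm K0 aK) u0 uv).
  have [rq|/ltW qr] := leP r q; last exact: h.
  by rewrite distrC [`|r - q|]distrC; exact: h.
have near_t (r e : R) : 0 <= r -> 0 < e -> \forall s \near r, 0 <= s ->
    `|nT r (drift a) w - nT s (drift a) w| <= e.
  move=> r0 e0; have ek : 0 < e / K by rewrite divr_gt0.
  exists (e / K) => //= s rs s0; apply: (le_trans (lip r s r0 s0)).
  by rewrite mulrC -ler_pdivlMr// ltW.
split => r r0.
  apply/cvgrPdist_le => e e0; rewrite /at_right near_withinE.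
  by apply: filterS (near_t r e r0 e0) => s h rs; apply: h; rewrite ltW// (le_lt_trans r0).
exists (nT r (drift a) w); apply/cvgrPdist_le => e e0; rewrite /at_left near_withinE.
apply: filterS2 (near_t r e (ltW r0) e0) (lt_nbhsr r0) => s h s0 _.
by apply: h; rewrite ltW.
Qed.

Lemma noise_cadlag w : cadlag (fun r => noise r w).
Proof.
have [X1 X2] := X_cadlag x0 ch l w (U := U) (t := t); have [n1 n2] := nT_cadlag w.
split => r r0.
  by apply: cvgB; [apply: cvgB; [exact: X1|exact: cvg_cst]|exact: n1].
have [u hu] := X2 r r0; have [v hv] := n2 r r0; exists (u - x0 - v).
by apply: cvgB => //; apply: cvgB => //; exact: cvg_cst.
Qed.

Lemma noise0 w : noise 0 w = 0.
Proof. by rewrite /noise X0 subrr sub0r /path_integral set_itvco0 Rintegral_set0 oppr0. Qed.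

Lemma noise_ae r : 0 <= r -> {ae P, forall w, Sl r w = noise r w}.
Proof.
move=> r0.
have h1 : {ae P, forall w, X r w = std_path x0 ch l (U := U) (t := t) r w}.
  exact: (XY_ae Hnu K0 GL Uoo HI r0).
have h2 : {ae P, forall w, V r w = nT r (drift a) w}.
  exact: (V_nT_ae Hnu K0 ma aK GL Uoo HI r0).
by apply: filterS2 h1 h2 => w hX hV; rewrite /noise /limit_noise hX hV.
Qed.

Lemma X_adapted : adapted F X.
Proof.
move=> r r0; apply/(Gs_preimage l HP).
apply: (Gs_fun_ae HP (Y_Gs Hnu K0 GL Uoo HP HI r0)).
have h1 : {ae P, forall w, X r w = std_path x0 ch l (U := U) (t := t) r w}.
  exact: (XY_ae Hnu K0 GL Uoo HI r0).
by apply: filterS h1 => w ->.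
Qed.

Lemma noise_adapted : adapted F noise.
Proof.
move=> r r0; apply/(Gs_preimage l HP).
apply: (Gs_fun_ae HP _ (noise_ae r0)).
apply: measurable_funB; last exact: (V_Gs K0 GL HP HI r0).
by apply: measurable_funB; [exact: (Y_Gs Hnu K0 GL Uoo HP HI r0)|exact: measurable_cst].
Qed.

Lemma noise_levy : levy_process P F noise (psi_re nu) (psi_im c nu).
Proof.
split; first exact: noise0.
split; first exact: noise_cadlag.
split; first exact: noise_adapted.
move=> s u xi s0 su A FA; have u0 : 0 <= u by rewrite (le_trans s0)// ltW.
have D : {ae P, forall w, noise u w - noise s w = Sl u w - Sl s w}.
  by apply: filterS2 (noise_ae s0) (noise_ae u0) => w -> ->.
have key al : Rintegral P A (fun w => cos (al + xi * (noise u w - noise s w))) =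
    fine (P A) * (expR (- (u - s) * psi_re nu xi) * cos (al - (u - s) * psi_im c nu xi)).
  exact: (levy_Gs Hnu K0 GL Uoo HP HI xi al s0 su FA D).
split.
  have := key 0; under eq_Rintegral do rewrite add0r.
  by move=> ->; rewrite sub0r cosN.
(* A quarter turn of the phase turns the cosine statement into the one for the sine. *)
have := key (- (pi / 2)); under eq_Rintegral do rewrite addrC cosBpihalf.
have E x : cos (- (pi / 2) - x) = - sin x :> R.
  by rewrite -opprD cosN addrC cosDpihalf.
by move=> ->; rewrite E !mulrN.
Qed.

End Solution.

(** The Loeb construction chooses sequences of points, hence asks for a pointed path space. *)
HB.instance Definition _ := isPointed.Build (seq int) [::].

Theorem theorem3p1 (R : realType) (c : R) (nu : {measure set R -> \bar R})
  (a : R -> R -> R) (K : R) (x0 : R) :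
  levy_measure nu ->
  (* 1 / Re psi(xi) = o(|xi|^{-1}) as |xi| -> oo *)
  (forall e : R, 0 < e -> exists M : R, forall xi : R, M < `|xi| ->
      0 < psi_re nu xi /\ `|xi| <= e * psi_re nu xi) ->
  measurable_fun [set p : R * R | 0 <= p.1] (fun p : R * R => a p.1 p.2) ->
  0 < K ->
  (forall t x, 0 <= t -> `|a t x| <= K) ->
  exists (d : measure_display) (T : measurableType d) (P : probability T R)
         (F : R -> set (set T)) (X S : R -> T -> R),
    complete_prob P /\ filtration F /\
    levy_process P F S (psi_re nu) (psi_im c nu) /\
    (forall w, cadlag (fun t => X t w)) /\ adapted F X /\
    {ae P, forall w, forall t, 0 <= t ->
       X t w = x0 + S t w
               + Rintegral (@lebesgue_measure R) `[0, t] (fun s => a s (X s w))}.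
Proof.
move=> Hnu Hpsi ma K0 aK.
have [M0 [_ [ch [l GL]]]] := chain_seq c x0 Hnu Hpsi ma K0 aK.
(* [U] refines the filter of cofinite sets, so what holds from some level on holds along [U]. *)
have [U [UU Uoo]] := @ultraFilterLemma nat \oo _.
have [d [T [P [t [HP HI]]]]] := loeb_space (W := seq int) Uoo (En_mean GL).
exists d, T, P, (Gs l (U := U) (P := P) (t := t)), (limit_path x0 ch l (U := U) (t := t)),
  (noise a x0 ch l (U := U) (t := t)).
split; first exact: HP.
split; first exact: (Gs_filtration l HP).
split; first exact: (noise_levy Hnu K0 ma aK GL Uoo HP HI).
split; first by move=> w; exact: X_cadlag.
split; first exact: (X_adapted Hnu K0 GL Uoo HP HI).
apply: filterE => w r r0; rewrite (nT_integral x0 K0 ma aK)// /noise; ring.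
Qed.
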